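(* Let $\mathfrak{T}$ be a polytopal tiling of $\mathbb{R}^2$ with Euclidean finite local complexity and with points of local rotational symmetry contained in the vertex set of $\mathfrak{T}$. Then there is a Poincaré duality isomorphism $$H^\bullet(\mathfrak{T}^0)\cong H^\dagger_{2-\bullet}(\mathfrak{T}^0)$$ between the ePE cohomology (over $\mathbb{Z}$) and the modified ePE homology of $\mathfrak{T}$.
   Context: **Tilings.** A cellular tiling of $\mathbb{R}^d$ is a pair $\mathfrak{T}=(\mathcal{T},l)$, where $\mathcal{T}$ is a regular CW decomposition of $\mathbb{R}^d$ and $l$ is a labelling of its cells. ''Cell'' means closed cell. It is polytopal if its cells are convex polytopes. A tile is a $d$-cell. A patch is a finite subcomplex together with the restricted labelling; equivalences of patches respect cells and labels. A rigid motion is an orientation-preserving isometry. $\mathfrak{T}$ has Euclidean finite local complexity (eFLC) if for every $r>0$ there are only finitely many patches of diameter at most $r$ up to rigid motion. **Coronas.** The $0$-corona of a tile $t$ is the patch whose only tile is $t$; for $i\ge1$ the $i$-corona of $t$ is the patch of tiles meeting its $(i-1)$-corona. The $i$-corona of a lower dimensional cell is the intersection of the $i$-coronas of the tiles containing it. For a tiling of $\mathbb{R}^2$, ''points of local rotational symmetry are contained in the vertex set'' means: for some $i$, no non-identity rigid motion maps an edge or a tile $c$ to itself while preserving the $i$-corona of $c$. Here $\mathbb{N}=\{1,2,\dots\}$ and $\mathbb{N}_0=\mathbb{N}\cup\{0\}$. **ePE (co)chains.** Integral cellular cochains and cellular Borel–Moore (possibly infinite) chains of $\mathcal{T}$ assign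 integers to oriented cells, with opposite values on opposite orientations. A $k$-(co)chain $\psi$ is Euclidean pattern-equivariant (ePE) if there is some $i\in\mathbb{N}_0$ such that $\psi(\omega_c)=\psi(f_*(\omega_c))$ whenever $f$ is a rigid motion taking a $k$-cell $c$ to a $k$-cell $f(c)$ and the $i$-corona of $c$ to that of $f(c)$, where $\omega_c$ is an orientation of $c$. ePE cochains form a subcomplex $C^\bullet(\mathfrak{T}^0)$ of the cellular cochain complex, with cohomology $H^\bullet(\mathfrak{T}^0)$; ePE chains form a subcomplex $C_\bullet(\mathfrak{T}^0)$ of the Borel–Moore chain complex. **Modified ePE homology.** $C^\dagger_\bullet(\mathfrak{T}^0)$ is the subcomplex of $C_\bullet(\mathfrak{T}^0)$ with $C^\dagger_k(\mathfrak{T}^0)=C_k(\mathfrak{T}^0)$ for $k=1,2$, and $C^\dagger_0(\mathfrak{T}^0)$ consisting of those ePE $0$-chains $\sigma$ for which there is some $i\in\mathbb{N}$ such that, whenever the $i$-corona of a vertex $v$ has rotational symmetry (about $v$) of order $n$, the coefficient of $v$ in $\sigma$ is divisible by $n$. Its homology is $H^\dagger_\bullet(\mathfrak{T}^0)$. *)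

(* Defs.v *)
From HB Require Import structures.
From mathcomp Require Import all_boot all_order all_algebra.
From mathcomp Require Import generic_quotient ring_quotient.
From mathcomp Require Import all_classical all_reals all_analysis.

Set Implicit Arguments.
Unset Strict Implicit.
Unset Printing Implicit Defensive.

Import Order.TTheory GRing.Theory Num.Theory.
Import numFieldNormedType.Exports.

Local Open Scope classical_set_scope.
Local Open Scope ring_scope.

Section Polytopes.
Context {R : realType}.
Local Notation V := 'rV[R]_2.
Implicit Types (c : set V) (x y : V).

Definition edist x y : R := Num.sqrt (\sum_j (x 0 j - y 0 j) ^+ 2).

Definition affine_hull c : set V :=
  [set x | exists n (p : 'I_n -> V) (w : 'I_n -> R),
     [/\ forall i, c (p i), \sum_i w i = 1 & x = \sum_i w i *: p i]].

Definition convex_hull n (p : 'I_n -> V) : set V :=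
  [set x | exists w : 'I_n -> R,
     [/\ forall i, 0 <= w i, \sum_i w i = 1 & x = \sum_i w i *: p i]].

(* Interior relative to the affine hull. *)
Definition relint c : set V :=
  [set x | c x /\ \forall y \near x, affine_hull c y -> c y].

(* The rows of B are a basis of the direction space of the affine hull of c.
   A k-dimensional convex set is one that has a frame with k rows. *)
Definition frame k c (B : 'M[R]_(k, 2)) :=
  row_free B /\
  forall x, c x -> affine_hull c = [set y | (y - x <= B)%MS].

Definition polytope k c :=
  [/\ c !=set0, exists n (p : 'I_n -> V), c = convex_hull p
    & exists B : 'M[R]_(k, 2), frame c B].

End Polytopes.

(* Regular CW decompositions of the plane into convex polytopes (of dimensions
   0, 1 and 2), with labelled cells. The members of [cell] are the closed
   cells, and the corresponding open cells are their relative interiors. Only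
   the values of [label] on cells are meaningful. *)
Record tiling (R : realType) (L : Type) := Tiling {
  cell : set (set 'rV[R]_2);
  label : set 'rV[R]_2 -> L;
  cell_polytope : forall c, cell c -> exists k, polytope k c;
  open_cell_partition : partition cell relint [set: 'rV[R]_2];
  cell_boundary : forall c, cell c ->
    c `\` relint c =
    \bigcup_(c' in [set c' | cell c' /\ c' `<=` c `\` relint c]) c';
  closure_finite : forall c, cell c ->
    finite_set [set c' | cell c' /\ relint c' `&` c !=set0];
  weak_topology : forall A : set 'rV[R]_2,
    (forall c, cell c -> closed (A `&` c)) -> closed A }.

(* Rigid motions x |-> x A + b, with A a rotation matrix. *)
Record motion (R : realType) := Motion {
  rot : 'M[R]_2;
  trans : 'rV[R]_2;
  rot_orthogonal : rot *m rot^T = 1%:M;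
  rot_det : \det rot = 1 }.

Definition move (R : realType) (f : motion R) (x : 'rV[R]_2) : 'rV[R]_2 :=
  x *m rot f + trans f.
Coercion move : motion >-> Funclass.

Section Tilings.
Context {R : realType} {L : Type}.
Variable T : tiling R L.
Local Notation V := 'rV[R]_2.
Implicit Types (c : set V) (P Q : set (set V)) (f : motion R) (i n : nat).

Definition kcell k c := cell T c /\ polytope k c.

Definition tile := kcell 2.

(* A patch is given by its finite set of cells; labels are inherited from T. *)
Definition patch P :=
  [/\ finite_set P, P `<=` cell T
    & forall c c', P c -> cell T c' -> c' `<=` c -> P c'].

Definition diam_le P (r : R) :=
  forall c c' x y, P c -> P c' -> c x -> c' y -> edist x y <= r.

(* f maps P to Q, respecting cells and labels. *)
Definition carries f P Q :=
  [set f @` c | c in P] = Q /\ forall c, P c -> label T (f @` c) = label T c.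

Definition eFLC :=
  forall r : R, 0 < r -> exists F : set (set (set V)),
    [/\ finite_set F, F `<=` patch
      & forall P, patch P -> diam_le P r ->
          exists2 Q, F Q & exists f, carries f P Q].

Fixpoint tile_corona i (t : set V) : set (set V) :=
  match i with
  | 0 => [set c | cell T c /\ c `<=` t]
  | i'.+1 => [set c | cell T c /\ exists s, [/\ tile s, c `<=` s
                        & exists2 c', tile_corona i' t c' & s `&` c' !=set0]]
  end.

(* When c is a tile, it is the only tile containing c. *)
Definition corona i c : set (set V) :=
  cell T `&` \bigcap_(t in [set t | tile t /\ c `<=` t]) tile_corona i t.

Definition rotations_at_vertices :=
  exists i, forall c f, kcell 1 c \/ kcell 2 c ->
    f @` c = c -> carries f (corona i c) (corona i c) -> f =1 id.

(* The i-corona of c has a symmetry of order n preserving c; for c a vertex,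
   this is rotational symmetry of order n about c. *)
Definition rot_symmetry i c n :=
  exists f, [/\ f @` c = c, carries f (corona i c) (corona i c),
    (0 < n)%N, iter n f =1 id
    & forall m, (0 < m < n)%N -> ~ (iter m f =1 id)].

(* Oriented k-cells: orientations are represented by frames, two frames of a
   cell giving the same orientation iff the change of frame has positive
   determinant. For k = 0 the only frame is the empty one, standing for the
   positive orientation of the vertex. *)
Record ocell k := OCell {
  supp : set V;
  ofr : 'M[R]_(k, 2);
  supp_kcell : kcell k supp;
  ofr_frame : frame supp ofr }.

HB.instance Definition _ k := gen_eqMixin (ocell k).
HB.instance Definition _ k := gen_choiceMixin (ocell k).

Definition oriented k (psi : ocell k -> int) :=
  forall (o o' : ocell k) (M : 'M[R]_k), supp o' = supp o ->
    ofr o' = M *m ofr o -> psi o' = sgz (\det M) * psi o.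

(* Integral k-cochains, and also Borel-Moore k-chains, that are ePE. *)
Definition ePE k (psi : ocell k -> int) :=
  oriented psi /\
  exists i, forall f (o o' : ocell k),
    supp o' = f @` supp o -> ofr o' = ofr o *m rot f ->
    carries f (corona i (supp o)) (corona i (supp o')) -> psi o' = psi o.

Definition dagger k (psi : ocell k -> int) :=
  ePE psi /\
  (k = 0%N -> exists2 i, (0 < i)%N & forall (o : ocell k) n,
     rot_symmetry i (supp o) n -> (n %| psi o)%Z).

(* Incidence number of a codimension one face s of t, by the convention
   "outward normal first"; a point of the relative interior of s minus one of
   that of t is an outward vector. *)
Definition incidence k (s : ocell k) (t : ocell k.+1) : int :=
  let outward := xget 0 (relint (supp s)) - xget 0 (relint (supp t)) in
  sgz (\det ((col_mx outward (ofr s) : 'M[R]_(k.+1, 2)) *m pinvmx (ofr t))).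

(* A choice of one orientation for each k-cell; the sums below do not depend
   on it, for oriented psi. *)
Definition chosen k : set (ocell k) :=
  [set o | ofr o = xget 0 [set B | frame (supp o) B]].

Definition coboundary k (psi : ocell k -> int) : ocell k.+1 -> int := fun t =>
  \sum_(s \in [set s | chosen s /\ supp s `<=` supp t]) incidence s t * psi s.

Definition boundary k (psi : ocell k.+1 -> int) : ocell k -> int := fun s =>
  \sum_(t \in [set t | chosen t /\ supp s `<=` supp t]) incidence s t * psi t.

Definition cocycles k : {pred ocell k -> int} := fun psi =>
  `[< ePE psi /\ coboundary psi = 0 >].

Definition coboundaries k : {pred ocell k -> int} :=
  match k with
  | 0 => fun psi => psi == 0
  | k'.+1 => fun psi => `[< exists2 phi : ocell k' -> int,
                              ePE phi & psi = coboundary phi >]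
  end.

Definition dagger_cycles k : {pred ocell k -> int} :=
  match k with
  | 0 => fun psi => `[< dagger psi >]
  | k'.+1 => fun psi => `[< dagger psi /\ boundary psi = 0 >]
  end.

Definition dagger_boundaries k : {pred ocell k -> int} := fun psi =>
  `[< exists2 phi : ocell k.+1 -> int, dagger phi & psi = boundary phi >].

End Tilings.

Section Motions.
Context {R : realType}.
Local Notation V := 'rV[R]_2.
Implicit Types (f : motion R) (c : set V).

Lemma rot_orthogonal_tr f : (rot f)^T *m rot f = 1%:M.
Proof. exact: mulmx1C (rot_orthogonal f). Qed.

Lemma inv_motion_orthogonal f : (rot f)^T *m (rot f)^T^T = 1%:M.
Proof. by rewrite trmxK rot_orthogonal_tr. Qed.

Lemma inv_motion_det f : \det (rot f)^T = 1.
Proof. by rewrite det_tr rot_det. Qed.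

Definition inv_motion f :=
  Motion (- (trans f *m (rot f)^T)) (inv_motion_orthogonal f) (inv_motion_det f).

Lemma moveK f : cancel f (inv_motion f).
Proof.
by move=> x; rewrite /move /= mulmxDl -mulmxA rot_orthogonal mulmx1 addrK.
Qed.

Lemma inv_moveK f : cancel (inv_motion f) f.
Proof.
move=> x.
by rewrite /move /= mulmxDl mulNmx -!mulmxA rot_orthogonal_tr !mulmx1 subrK.
Qed.

Lemma image_inv_motion f c : inv_motion f @` (f @` c) = c.
Proof.
rewrite image_comp; apply/seteqP; split=> [_ [x cx <-]|x cx] /=.
  by rewrite moveK.
by exists x => //=; rewrite moveK.
Qed.

Lemma move_affine f n (p : 'I_n -> V) (w : 'I_n -> R) : \sum_i w i = 1 ->
  f (\sum_i w i *: p i) = \sum_i w i *: f (p i).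
Proof.
move=> w1; rewrite /move mulmx_suml.
transitivity (\sum_i (w i *: (p i *m rot f) + w i *: trans f)); last first.
  by apply: eq_bigr => i _; rewrite scalerDr.
rewrite big_split/= -scaler_suml w1 scale1r; congr (_ + _).
by apply: eq_bigr => i _; rewrite scalemxAl.
Qed.

Lemma affine_hull_move f c : f @` affine_hull c `<=` affine_hull (f @` c).
Proof.
move=> _ [x [n [p [w [cp w1 ->]]]] <-]; exists n, (f \o p), w.
split => //; first by move=> i; exists (p i).
exact: move_affine.
Qed.

Lemma affine_hull_image f c : affine_hull (f @` c) = f @` affine_hull c.
Proof.
apply/seteqP; split; last exact: affine_hull_move.
move=> x hx; exists (inv_motion f x); last exact: inv_moveK.
rewrite -[c](image_inv_motion f); apply: affine_hull_move.
by exists x.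
Qed.

Lemma frame_image f k c (B : 'M[R]_(k, 2)) :
  frame c B -> frame (f @` c) (B *m rot f).
Proof.
have ufr : rot f \in unitmx by rewrite unitmxE rot_det unitr1.
move=> [fB hB]; split.
  by rewrite /row_free mxrankMfree ?row_free_unit.
move=> _ [x cx <-]; rewrite affine_hull_image (hB x cx).
apply/seteqP; split=> [_ [y /= yx <-]|y /= yx].
  by rewrite /= /move opprD addrACA subrr addr0 -mulmxBl submxMr.
exists (inv_motion f y); last exact: inv_moveK.
have -> : inv_motion f y - x = (y - f x) *m (rot f)^T.
  rewrite -{1}[x](moveK f) /move /= opprD addrACA subrr addr0.
  by rewrite -mulmxBl.
rewrite /=; apply: submx_trans (submxMr _ yx) _.
by rewrite -mulmxA rot_orthogonal mulmx1.
Qed.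

Lemma polytope_image f k c : polytope k c -> polytope k (f @` c).
Proof.
move=> [[x cx] [n [p cE]] [B cB]]; split.
- by exists (f x), x.
- exists n, (f \o p); rewrite cE; apply/seteqP; split.
    move=> _ [y [w [w0 w1 ->]] <-]; exists w; split=> //.
    exact: move_affine.
  move=> y [w [w0 w1 ->]]; exists (\sum_i w i *: p i); last exact: move_affine.
  by exists w.
- by exists (B *m rot f); exact: frame_image.
Qed.

End Motions.

Section Coronas.
Context {R : realType} {L : Type}.
Variable T : tiling R L.
Local Notation V := 'rV[R]_2.
Implicit Types (c t x : set V) (P Q : set (set V)) (f : motion R) (i : nat).

Lemma tile_corona_sub i t x :
  tile T t -> tile_corona T i t x ->
  exists2 s, tile T s & [/\ tile_corona T i t s, x `<=` s & cell T x].
Proof.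
move=> Tt; case: i => [[cx xt]|i [cx [s [Ts xs hs]]]].
  by exists t => //; split => //; split => //; exact: Tt.1.
exists s => //; split => //; split; first exact: Ts.1.
by exists s; split.
Qed.

Lemma cell_neq0 x : cell T x -> x !=set0.
Proof. by move=> /cell_polytope[k []]. Qed.

Lemma tile_corona_self i t : tile T t -> tile_corona T i t t.
Proof.
move=> Tt; elim: i => [|i IH]; first by split => //; exact: Tt.1.
split; first exact: Tt.1.
exists t; split => //; exists t => //.
by rewrite setIid; apply: cell_neq0; exact: Tt.1.
Qed.

Lemma tile_corona_near i t t' : tile T t -> tile T t' -> t `&` t' !=set0 ->
  tile_corona T i t `<=` tile_corona T i.+1 t'.
Proof.
move=> Tt Tt' tt'; elim: i => [x [cx xt]|i IH x [cx [s [Ts xs [y ty sy]]]]].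
  by split => //; exists t; split => //; exists t' => //; split => //; exact: Tt'.1.
by split => //; exists s; split => //; exists y => //; exact: IH.
Qed.

Lemma tile_corona_cell i t : tile T t -> tile_corona T i t `<=` cell T.
Proof. by move=> Tt x /(tile_corona_sub Tt)[? _ []]. Qed.

Lemma tile_corona_corona i c t : cell T c -> tile T t -> c `<=` t ->
  tile_corona T i t `<=` corona T i.+1 c.
Proof.
move=> /cell_neq0[z cz] Tt ct x tx; split; first exact: tile_corona_cell tx.
move=> t' [Tt' ct'].
by apply: tile_corona_near tx => //; exists z; split; [exact: ct|exact: ct'].
Qed.

Lemma corona_leS i c : cell T c -> corona T i c `<=` corona T i.+1 c.
Proof.
move=> Cc x [Cx cx]; split => // t [Tt ct].
exact: (tile_corona_corona Cc Tt ct (cx t (conj Tt ct))).2.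
Qed.

Lemma carries_inv f P Q : carries T f P Q -> carries T (inv_motion f) Q P.
Proof.
move=> [<- lab]; split.
  apply/seteqP; split=> [_ [_ [c Pc <-] <-]|c Pc].
    by rewrite image_inv_motion.
  by exists (f @` c); rewrite ?image_inv_motion//; exists c.
by move=> _ [c Pc <-]; rewrite image_inv_motion lab.
Qed.

Section Step.
Variables (f : motion R) (i : nat) (c : set V).
Hypotheses (Cc : cell T c) (Cc' : cell T (f @` c)).
Hypothesis fc : carries T f (corona T i.+1 c) (corona T i.+1 (f @` c)).

Let in_corona x : corona T i.+1 c x -> cell T (f @` x).
Proof.
move=> cx; suff [] : corona T i.+1 (f @` c) (f @` x) by [].
by rewrite -fc.1; exists x.
Qed.

Let carries_tile t : tile T t -> corona T i.+1 c t -> tile T (f @` t).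
Proof. by move=> Tt ct; split; [exact: in_corona|exact/polytope_image/Tt.2]. Qed.

Lemma carries_tile_corona t x : tile T t -> c `<=` t ->
  tile_corona T i t x -> tile_corona T i (f @` t) (f @` x).
Proof.
move=> Tt ct.
have H j : (j <= i)%N -> tile_corona T j t `<=` corona T i.+1 c.
  move=> ji; apply: (@subset_trans _ (corona T j.+1 c)).
    exact: tile_corona_corona.
  rewrite -(subnKC ji); elim: (i - j)%N => [|k IH]; first by rewrite addn0.
  by apply: subset_trans IH _; rewrite -addSn addnS; exact: corona_leS.
have : (i <= i)%N by [].
elim: {1 3 4}i x => [|j IH] x ji.
  move=> tx; split; first by apply/in_corona/(H 0).
  by apply: image_subset; case: tx.
move=> tx; split; first by apply/in_corona/(H j.+1).
case: (tx) => Cx [s [Ts xs [y ty [z [sz yz]]]]].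
exists (f @` s); split.
- apply: carries_tile => //; apply: (H j.+1) => //.
  by split; [exact: Ts.1|exists s; split => //; exists y => //; exists z].
- exact: image_subset.
- exists (f @` y); first by apply: IH => //; exact: ltnW.
  by exists (f z); split; exists z.
Qed.

Lemma carries_tile_over t : tile T t -> c `<=` t -> tile T (f @` t).
Proof.
move=> Tt ct; apply: carries_tile => //.
exact: (tile_corona_corona Cc Tt ct (tile_corona_self i Tt)).
Qed.

End Step.

Lemma image_motion_inv f c : f @` (inv_motion f @` c) = c.
Proof.
rewrite image_comp; apply/seteqP; split=> [_ [x cx <-]|x cx] /=.
  by rewrite inv_moveK.
by exists x => //=; rewrite inv_moveK.
Qed.

Lemma carries_corona_step f i c : cell T c -> cell T (f @` c) ->
  carries T f (corona T i.+1 c) (corona T i.+1 (f @` c)) ->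
  forall x, corona T i c x -> corona T i (f @` c) (f @` x).
Proof.
move=> Cc Cc' fc x cx; split.
  have /(corona_leS Cc) : corona T i c x by [].
  move=> cx'; suff [] : corona T i.+1 (f @` c) (f @` x) by [].
  by rewrite -fc.1; exists x.
move=> t' [Tt' ct'].
have fc' := carries_inv fc.
have ct : c `<=` inv_motion f @` t'.
  by rewrite -[c](image_inv_motion f); exact: image_subset.
have Tt : tile T (inv_motion f @` t').
  apply: (@carries_tile_over _ i (f @` c)) => //; rewrite image_inv_motion //.
rewrite -[t'](image_motion_inv f); apply: (carries_tile_corona Cc fc) => //.
by apply: cx.2; split.
Qed.

Lemma carries_coronaS f i c : cell T c -> cell T (f @` c) ->
  carries T f (corona T i.+1 c) (corona T i.+1 (f @` c)) ->
  carries T f (corona T i c) (corona T i (f @` c)).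
Proof.
move=> Cc Cc' fc; split; last by move=> x /(corona_leS Cc); exact: fc.2.
apply/seteqP; split=> [_ [x cx <-]|x cx]; first exact: carries_corona_step.
exists (inv_motion f @` x); last exact: image_motion_inv.
rewrite -[c](image_inv_motion f); apply: carries_corona_step => //;
  rewrite image_inv_motion //.
exact: carries_inv.
Qed.

Lemma carries_corona_le f i j c c' : (j <= i)%N -> cell T c -> cell T c' ->
  c' = f @` c ->
  carries T f (corona T i c) (corona T i c') ->
  carries T f (corona T j c) (corona T j c').
Proof.
move=> ji Cc Cc' c'E; rewrite {}c'E in Cc' *.
rewrite -(subnKC ji); elim: (i - j)%N => [|k IH]; first by rewrite addn0.
by rewrite addnS => /(carries_coronaS Cc Cc').
Qed.

End Coronas.

Section Finiteness.
Context {R : realType} {L : Type}.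
Variable T : tiling R L.
Local Notation V := 'rV[R]_2.
Implicit Types (c : set V) (x y : V).

Lemma polytope_relint_segment k c x y (e : R) : polytope k c -> c x ->
  relint c y -> 0 < e -> e <= 1 -> relint c (x + e *: (y - x)).
Proof.
move=> [_ [n [p cE]] [B [_ hB]]] cx [cy /nbhs_normP[d /= d0 hd]] e0 e1.
have seg z : c z -> c (x + e *: (z - x)).
  move: cx => + +; rewrite cE => -[v [v0 v1 ->]] [w [w0 w1 ->]].
  exists (fun i => (1 - e) * v i + e * w i); split.
  - by move=> i; rewrite addr_ge0// mulr_ge0// ?subr_ge0// ltW.
  - by rewrite big_split/= -!mulr_sumr v1 w1 !mulr1 subrK.
  under [RHS]eq_bigr do rewrite scalerDl -!scalerA.
  rewrite big_split/= -!scaler_sumr scalerBl scale1r scalerBr addrA.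
  by rewrite addrAC.
split; first exact: seg.
apply/nbhs_normP; exists (e * d); first by rewrite /= mulr_gt0.
move=> z /= hz az.
have -> : z = x + e *: ((x + e^-1 *: (z - x)) - x).
  by rewrite [x + _ - x]addrC addKr scalerA divff ?gt_eqF// scale1r addrC subrK.
apply: seg; apply: hd => /=; last first.
  move: az; rewrite (hB x cx) /= => zB.
  by rewrite [x + _ - x]addrC addKr scalemx_sub.
rewrite -(ltr_pM2l e0) -[X in X * `|_|](gtr0_norm e0) -normrZ.
rewrite (_ : e *: _ = x + e *: (y - x) - z)//.
rewrite opprD addrA scalerBr scalerA divff ?gt_eqF// scale1r.
by rewrite opprB addrCA addrA.
Qed.

Lemma star_finite x : finite_set [set c | cell T c /\ c x].
Proof.
apply: contrapT => /infiniteP /pcard_leP/unsquash g.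
have gS n : cell T (g n) /\ g n x by apply: (@funS _ _ _ _ g).
have gI : injective g by move=> m n gmn; apply: (@inj _ _ _ g) => //; rewrite inE.
have [cov triv ne] := open_cell_partition T.
have near_pt n : exists y, relint (g n) y /\ `|y - x| < n.+1%:R^-1.
  have [Cg gx] := gS n; have [k gk] := cell_polytope Cg.
  have [y gy] := ne _ Cg.
  pose e : R := Num.min 1 (n.+1%:R^-1 / (1 + `|y - x|)).
  have y1 : 0 < 1 + `|y - x| by rewrite ltr_wpDr.
  have e0 : 0 < e by rewrite lt_min ltr01 divr_gt0.
  exists (x + e / 2 *: (y - x)); split.
    apply: (polytope_relint_segment gk) => //; first by rewrite divr_gt0.
    by rewrite ler_pdivrMr// mul1r (@le_trans _ _ 1) ?ge_min ?lexx// ler1n.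
  rewrite [x + _]addrC addrK normrZ gtr0_norm ?divr_gt0//.
  apply: (@le_lt_trans _ _ (e / 2 * (1 + `|y - x|))).
    by rewrite ler_wpM2l ?lerDr ?ltW ?divr_gt0.
  rewrite -ltr_pdivlMr// ltr_pdivrMr// mulrC.
  apply: (@le_lt_trans _ _ (n.+1%:R^-1 / (1 + `|y - x|))).
    by rewrite ge_min lexx orbT.
  by rewrite ltr_pMl ?divr_gt0// ltr1n.
have [p /= hp] := choice near_pt.
have [c0 Cc0 c0x] : exists2 c, cell T c & relint c x.
  by have : cover (cell T) relint x; [rewrite cov|move=> [c]; exists c].
pose A : set V := p @` [set n | g n <> c0].
have clA : closed A.
  apply: (weak_topology (t := T)) => c Cc.
  have [acc _] := @accessible_finite_set_closed V.
  apply: acc; first exact/hausdorff_accessible/norm_hausdorff.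
  have fs : finite_set (g @^-1` [set c' | cell T c' /\ relint c' `&` c !=set0]).
    apply: finite_preimage (closure_finite Cc) => m n _ _; exact: gI.
  apply: (@sub_finite_set _ _ (p @` (g @^-1` [set c' | cell T c' /\ relint c' `&` c !=set0]))).
    move=> _ [[n _ <-] cn]; exists n => //=; split; first exact: (gS n).1.
    by exists (p n); split => //; exact: (hp n).1.
  exact: finite_image.
have Ax : A x.
  apply: clA => U /nbhs_normP[e /= e0 hU].
  have [m hm] : exists m, forall n, (m <= n)%N -> n.+1%:R^-1 < e.
    near \oo => m; exists m => n mn; apply: (@le_lt_trans _ _ m.+1%:R^-1).
      by rewrite lef_pV2 ?posrE// ler_nat.
    by near: m; exact: near_infty_natSinv_lt (PosNum e0).
  have [n mn gn] : exists2 n, (m <= n)%N & g n <> c0.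
    have [gm|gm] := pselect (g m = c0); last by exists m.
    exists m.+1 => // gm'; have /esym/eqP := gI m m.+1 (etrans gm (esym gm')).
    by rewrite gtn_eqF.
  exists (p n); split; first by exists n.
  apply: hU => /=; rewrite distrC; apply: lt_trans (hm n mn); exact: (hp n).2.
case: Ax => n gn pn; apply: gn; apply: triv => //; first exact: (gS n).1.
by exists (p n); split; [exact: (hp n).1|rewrite pn].
Unshelve. all: by end_near.
Qed.

Lemma faces_finite c : cell T c ->
  finite_set [set c' | cell T c' /\ c' `<=` c].
Proof.
move=> Cc; apply: sub_finite_set (closure_finite Cc) => c' [Cc' cc'].
have [_ _ /(_ _ Cc')[x xc']] := open_cell_partition T.
by split => //; exists x; split => //; apply/cc'/xc'.1.
Qed.

Lemma cofaces_finite c : cell T c ->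
  finite_set [set c' | cell T c' /\ c `<=` c'].
Proof.
move=> Cc; have [x cx] := cell_neq0 Cc.
by apply: sub_finite_set (star_finite x) => c' [Cc' /(_ _ cx)].
Qed.

Lemma chosen_finite k (D : set (set V)) :
  finite_set D -> finite_set [set o : ocell T k | chosen o /\ D (supp o)].
Proof.
move=> fD.
pose h (B : set V) : option (ocell T k) :=
  xget None [set z | if z is Some o then chosen o /\ supp o = B else False].
have fS : finite_set (h @` D) by exact: finite_image.
apply: (@sub_finite_set _ _ (Some @^-1` (h @` D))).
  move=> o [co Do]; exists (supp o) => //; rewrite /h.
  apply: xget_unique => //; case=> //= o' [co' soo'].
  congr Some; clear Do; case: o o' co co' soo' => [s B hs hB] [s' B' hs' hB'].
  rewrite /chosen /= => BE BE' ss; subst s'.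
  have BB : B' = B by rewrite BE BE'.
  clear BE BE'.
  by subst B'; rewrite (Prop_irrelevance hs' hs) (Prop_irrelevance hB' hB).
by apply: finite_preimage => // ? ? _ _ [].
Qed.

End Finiteness.

(* Z modulo the intersection of Z and B. *)
Section Subquotient.
Variables (C : zmodType) (Z B : zmodClosed C).

Record subgroup := Subgroup { sgval : C; _ : sgval \in Z }.

HB.instance Definition _ := [isSub for sgval].
HB.instance Definition _ := [Choice of subgroup by <:].
HB.instance Definition _ := [SubChoice_isSubZmodule of subgroup by <:].

Definition sub_pred : {pred subgroup} := fun z => sgval z \in B.

Lemma sub_pred_closed : zmod_closed sub_pred.
Proof.
split=> [|x y xB yB]; rewrite unfold_in /sub_pred; first exact: rpred0.
exact: rpredB.
Qed.

HB.instance Definition _ := GRing.isZmodClosed.Build _ sub_pred sub_pred_closed.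

Definition subquotient := Quotient.quot sub_pred.

HB.instance Definition _ := GRing.Zmodule.on subquotient.

End Subquotient.

Section Homology.
Context {R : realType} {L : Type}.
Variable T : tiling R L.

Lemma coboundaryB k : {morph @coboundary R L T k : x y / x - y}.
Proof.
move=> x y; apply/funext => t; transitivity (coboundary x t - coboundary y t) => //; rewrite /coboundary.
have fin : finite_set [set s : ocell T k | chosen s /\ supp s `<=` supp t].
  apply: (@sub_finite_set _ _ [set s : ocell T k | chosen s /\
     [set c | cell T c /\ c `<=` supp t] (supp s)]).
    by move=> s [cs st]; split => //; split => //; exact: (supp_kcell s).1.
  by apply/chosen_finite/faces_finite/(supp_kcell t).1.
rewrite !fsbig_finite//= -sumrB; apply: eq_bigr => s _.
exact: mulrBr.
Qed.

Lemma boundaryB k : {morph @boundary R L T k : x y / x - y}.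
Proof.
move=> x y; apply/funext => s; transitivity (boundary x s - boundary y s) => //; rewrite /boundary.
have fin : finite_set [set t : ocell T k.+1 | chosen t /\ supp s `<=` supp t].
  apply: (@sub_finite_set _ _ [set t : ocell T k.+1 | chosen t /\
     [set c | cell T c /\ supp s `<=` c] (supp t)]).
    by move=> t [cs st]; split => //; split => //; exact: (supp_kcell t).1.
  by apply/chosen_finite/cofaces_finite/(supp_kcell s).1.
rewrite !fsbig_finite//= -sumrB; apply: eq_bigr => t _.
exact: mulrBr.
Qed.

Lemma coboundary0 k : @coboundary R L T k 0 = 0.
Proof. by rewrite -(subrr 0) coboundaryB subrr. Qed.

Lemma boundary0 k : @boundary R L T k 0 = 0.
Proof. by rewrite -(subrr 0) boundaryB subrr. Qed.

Lemma ePE0 k : @ePE R L T k 0.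
Proof. by split; [move=> o o' M _ _; rewrite mulr0|exists 0%N]. Qed.

Lemma ePEB k (x y : ocell T k -> int) : ePE x -> ePE y -> ePE (x - y).
Proof.
move=> [ox [i hx]] [oy [j hy]]; split.
  move=> o o' M so fo; rewrite mulrBr -(ox o o' M so fo) -(oy o o' M so fo) //.
exists (maxn i j) => f o o' so fo hf.
have Co := (supp_kcell o).1; have Co' := (supp_kcell o').1.
by congr (_ - _); [apply: (hx f)|apply: (hy f)] => //; apply: carries_corona_le hf;
  rewrite // (leq_maxl, leq_maxr).
Qed.

Lemma dagger0 k : @dagger R L T k 0.
Proof. by split=> [|_]; [exact: ePE0|exists 1%N => // o n _; exact: dvdz0]. Qed.

Lemma rot_symmetry_le i j c n : (j <= i)%N -> cell T c ->
  rot_symmetry T i c n -> rot_symmetry T j c n.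
Proof.
move=> ji Cc [f [fc hf n0 hn hm]]; exists f; split => //.
exact: carries_corona_le hf.
Qed.

Lemma daggerB k (x y : ocell T k -> int) :
  dagger x -> dagger y -> dagger (x - y).
Proof.
move=> [ex hx] [ey hy]; split=> [|k0]; first exact: ePEB.
have [i i0 dx] := hx k0; have [j j0 dy] := hy k0.
exists (maxn i j) => [|o n ho]; first by rewrite leq_max i0.
have Co := (supp_kcell o).1.
apply: (@rpredB _ _ (x o) (y o)); [apply: dx|apply: dy];
  by apply: rot_symmetry_le ho; rewrite // (leq_maxl, leq_maxr).
Qed.

Lemma cocycles_closed k : zmod_closed (@cocycles R L T k).
Proof.
split=> [|x y]; rewrite !unfold_in.
  by apply/asboolP; split; [exact: ePE0|exact: coboundary0].
move=> /asboolP[ex hx] /asboolP[ey hy]; apply/asboolP; split; first exact: ePEB.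
by rewrite coboundaryB hx hy subrr.
Qed.

Lemma coboundaries_closed k : zmod_closed (@coboundaries R L T k).
Proof.
case: k => [|k]; split=> [|x y]; rewrite !unfold_in /=.
- by [].
- by move=> /eqP-> /eqP->; rewrite subrr.
- by apply/asboolP; exists 0; [exact: ePE0|rewrite coboundary0].
move=> /asboolP[a ea ->] /asboolP[b eb ->]; apply/asboolP.
by exists (a - b); [exact: ePEB|rewrite coboundaryB].
Qed.

Lemma dagger_cycles_closed k : zmod_closed (@dagger_cycles R L T k).
Proof.
case: k => [|k]; split=> [|x y]; rewrite !unfold_in /=.
- by apply/asboolP; exact: dagger0.
- by move=> /asboolP ex /asboolP ey; apply/asboolP; exact: daggerB.
- by apply/asboolP; split; [exact: dagger0|exact: boundary0].
move=> /asboolP[ex hx] /asboolP[ey hy]; apply/asboolP; split; first exact: daggerB.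
by rewrite boundaryB hx hy subrr.
Qed.

Lemma dagger_boundaries_closed k : zmod_closed (@dagger_boundaries R L T k).
Proof.
split=> [|x y]; rewrite !unfold_in /=.
  by apply/asboolP; exists 0; [exact: dagger0|rewrite boundary0].
move=> /asboolP[a ea ->] /asboolP[b eb ->]; apply/asboolP.
by exists (a - b); [exact: daggerB|rewrite boundaryB].
Qed.

HB.instance Definition _ k :=
  GRing.isZmodClosed.Build _ (@cocycles R L T k) (cocycles_closed k).
HB.instance Definition _ k :=
  GRing.isZmodClosed.Build _ (@coboundaries R L T k) (coboundaries_closed k).
HB.instance Definition _ k :=
  GRing.isZmodClosed.Build _ (@dagger_cycles R L T k) (dagger_cycles_closed k).
HB.instance Definition _ k := GRing.isZmodClosed.Build _
  (@dagger_boundaries R L T k) (dagger_boundaries_closed k).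

Definition ePE_cohomology k : zmodType :=
  subquotient (@cocycles R L T k) (@coboundaries R L T k).

Definition dagger_homology k : zmodType :=
  subquotient (@dagger_cycles R L T k) (@dagger_boundaries R L T k).

End Homology.

(* Main.v *)
Require Import Defs.
From HB Require Import structures.
From mathcomp Require Import all_boot all_order all_algebra.
From mathcomp Require Import generic_quotient ring_quotient.
From mathcomp Require Import all_classical all_reals all_analysis.
From mathcomp Require Import ring lra zify.

Set Implicit Arguments.
Unset Strict Implicit.
Unset Printing Implicit Defensive.

Import Order.TTheory GRing.Theory Num.Theory.
Import numFieldNormedType.Exports.
Import Defs.

Local Open Scope classical_set_scope.
Local Open Scope ring_scope.

(** A dart [(v, w, t)] is an edge from [v] to [w] with the tile [t] on its left.
Three permutations act on darts: [flip] reverses the edge, [prev] steps back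
along the boundary of the tile, and [turn], which is [prev] followed by [flip],
rotates about the tail. The orbits of [prev], [turn] and [flip] are the tiles,
vertices and edges, so (co)chains become functions on darts: of degree 2 if
[prev]-invariant, of degree 0 if [turn]-invariant, of degree 1 if odd under
[flip]; they are ePE iff they are invariant under the motions that preserve
large coronas.

Duality is then a symmetric correspondence given by ePE functions [h] on darts.
In degree 0, [h] is both a 0-cocycle and a 2-cycle if it is invariant under all
three permutations. In degree 1, the differences of [h] along [prev] agree on the
two sides of every edge iff those along [turn] do; the former then give a cocycle
and the latter a cycle. In degree 2, the sums of [h] over the orbits of [prev]
give a 2-cochain and its sums over the orbits of [turn] a 0-chain.
All cocycles and all cycles arise in this way: differences can be integrated
equivariantly along an orbit even in the presence of rotational symmetry, since
integers have no torsion, while a function on orbits is an orbit sum of an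
invariant function exactly when its value is divisible by the order of the
symmetry of the orbit, which is trivial for tiles and is the condition on
modified chains for vertices. Finally, [h] gives a coboundary iff it gives a
boundary. *)

(** * Isomorphic subquotients *)

(** Duality usually pairs a complex with its dual complex, whose cells are not cells of the tiling.
    On darts the dual is the same set with [prev] and [turn] exchanged: [flip] is an involution, so
    [flip] after [prev] is [turn] and [flip] after [turn] is [prev]. Hence each statement about
    abstract permutations [A], [B], [e] with [e (A x) = B x] can be used in both directions. The
    correspondence is a relation and not a map, since [h] depends on choices; only its class modulo
    boundaries is determined. A motion that matches coronas of tiles is compatible with [prev], one
    that matches coronas of vertices with [turn], and one that matches coronas of edges with [flip].
    Equivalence of darts is therefore measured at tiles, vertices or edges according to the
    permutation in use; the three measures interleave, because passing to another cell of a common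
    tile costs a bounded number of coronas. The hypothesis on rotations enters in degree 2: a tile
    has no symmetry, so that every 2-cochain is an orbit sum, and no edge is equivalent to its
    reversal, so that an odd function is a difference [k x - k (e x)]. *)

Section SubquotientIso.
Local Open Scope quotient_scope.
Variables (C1 C2 : zmodType) (Z1 B1 : zmodClosed C1) (Z2 B2 : zmodClosed C2).
Variable rel : C1 -> C2 -> Prop.
Hypothesis relB : forall x x' y y', rel x y -> rel x' y' -> rel (x - x') (y - y').
Hypothesis rel_total : forall x, x \in Z1 -> exists2 y, y \in Z2 & rel x y.
Hypothesis rel_onto : forall y, y \in Z2 -> exists2 x, x \in Z1 & rel x y.
Hypothesis rel_boundary :
  forall x y, x \in Z1 -> y \in Z2 -> rel x y -> (x \in B1) = (y \in B2).

Lemma sgvalB (C : zmodType) (Z : zmodClosed C) (x y : subgroup Z) :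
  sgval (x - y) = sgval x - sgval y.
Proof. exact: (raddfB (\val : subgroup Z -> C)). Qed.

Lemma subquotient_eq (C : zmodType) (Z B : zmodClosed C) (x y : subgroup Z) :
  (\pi_(subquotient Z B) x == \pi y) = (sgval x - sgval y \in B).
Proof. by rewrite -Quotient.idealrBE unfold_in /sub_pred sgvalB. Qed.

Lemma piB (C : zmodType) (Z B : zmodClosed C) (x y : subgroup Z) :
  \pi_(subquotient Z B) (x - y) =
  \pi_(subquotient Z B) x - \pi_(subquotient Z B) y.
Proof. by rewrite raddfB. Qed.

(** The partner [g x] is an arbitrary choice and need not be additive, but its class is forced: two
    partners of one element differ by a partner of 0, which is a boundary by [rel_boundary]. The
    same equivalence read backwards gives injectivity. *)
Lemma subquotient_iso :
  exists f : {additive subquotient Z1 B1 -> subquotient Z2 B2}, bijective f.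
Proof.
have [|g hg] := @choice _ _ (fun (x : subgroup Z1) (y : subgroup Z2) =>
    rel (sgval x) (sgval y)).
  move=> [x xZ]; have [y yZ xy] := rel_total xZ.
  by exists (Subgroup yZ).
have inZ (C : zmodType) (Z : zmodClosed C) (x : subgroup Z) : sgval x \in Z.
  by case: x.
have gE x y : rel (sgval x) (sgval y) ->
    \pi_(subquotient Z2 B2) (g x) = \pi_(subquotient Z2 B2) y.
  move=> xy; apply/eqP; rewrite subquotient_eq -(rel_boundary (x := 0)).
  - exact: rpred0.
  - exact: rpred0.
  - by apply: rpredB; exact: inZ.
  - by rewrite -(subrr (sgval x)); exact: relB.
have gpi x x' : (\pi_(subquotient Z2 B2) (g x) == \pi_(subquotient Z2 B2) (g x'))
              = (\pi_(subquotient Z1 B1) x == \pi_(subquotient Z1 B1) x').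
  rewrite !subquotient_eq; apply/esym/rel_boundary; last exact: relB.
    by apply: rpredB; exact: inZ.
  by apply: rpredB; exact: inZ.
pose f (q : subquotient Z1 B1) : subquotient Z2 B2 :=
  \pi_(subquotient Z2 B2) (g (repr q)).
have fpi x : f (\pi_(subquotient Z1 B1) x) =
    \pi_(subquotient Z2 B2) (g x).
  by apply/eqP; rewrite gpi; apply/eqP; exact: reprK.
have fB : {morph f : x y / x - y}.
  move=> q q'; rewrite -[q]reprK -[q']reprK -piB !fpi -piB.
  by apply: gE; rewrite !sgvalB; exact: relB.
pose F : {additive subquotient Z1 B1 -> subquotient Z2 B2} :=
  HB.pack f (GRing.isZmodMorphism.Build _ _ f fB).
have [|h hh] := @choice _ _ (fun q p => f p = q).
  move=> q; have [x xZ xy] := rel_onto (inZ _ _ (repr q)).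
  exists (\pi_(subquotient Z1 B1) (Subgroup xZ)); rewrite fpi -[RHS]reprK; apply/eqP.
  rewrite subquotient_eq -(rel_boundary (x := 0)).
  - exact: rpred0.
  - exact: rpred0.
  - by apply: rpredB; exact: inZ.
  - by rewrite -(subrr x); exact: relB (hg (Subgroup xZ)) xy.
exists F, h => [q|q]; last exact: hh.
by have /eqP := hh (f q); rewrite gpi !reprK => /eqP.
Qed.

End SubquotientIso.

(** * Orbits of a periodic map *)

Section Orbits.
Variables (D : Type) (s : D -> D).

Definition ord x : nat := xget 0%N
  [set n | [/\ (0 < n)%N, iter n s x = x
    & forall m, (0 < m)%N -> iter m s x = x -> (n <= m)%N]].

Definition osum (f : D -> int) x : int := \sum_(j < ord x) f (iter j s x).

Definition psum (f : D -> int) x n : int := \sum_(j < n) f (iter j s x).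

Hypothesis periodic : forall x, exists2 n, (0 < n)%N & iter n s x = x.

Lemma ord_spec x : [/\ (0 < ord x)%N, iter (ord x) s x = x
  & forall m, (0 < m)%N -> iter m s x = x -> (ord x <= m)%N].
Proof.
apply: (@xgetPex _ 0%N [set n | [/\ (0 < n)%N, iter n s x = x
  & forall m, (0 < m)%N -> iter m s x = x -> (n <= m)%N]]).
have [n0 n0_gt0 n0x] := periodic x.
have ex : exists n, (0 < n)%N && `[< iter n s x = x >].
  by exists n0; rewrite n0_gt0; apply/asboolP.
case: (ex_minnP ex) => n /andP[n_gt0 /asboolP nx] n_min.
exists n; split => // m m_gt0 mx; apply: n_min.
by rewrite m_gt0; apply/asboolP.
Qed.

Lemma ord_gt0 x : (0 < ord x)%N. Proof. by have [] := ord_spec x. Qed.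

Lemma iter_ord x : iter (ord x) s x = x. Proof. by have [] := ord_spec x. Qed.

Lemma iter_mul_ord x n : iter (n * ord x) s x = x.
Proof. by elim: n => // n IH; rewrite mulSn iterD IH iter_ord. Qed.

Lemma iter_mod_ord x n : iter (n %% ord x) s x = iter n s x.
Proof. by rewrite [in RHS](divn_eq n (ord x)) addnC iterD iter_mul_ord. Qed.

Lemma iter_eqP x n : (iter n s x = x) <-> (ord x %| n)%N.
Proof.
split=> [nx|/dvdnP[q ->]]; last exact: iter_mul_ord.
have [_ _ min] := ord_spec x; have := ltn_pmod n (ord_gt0 x).
rewrite ltnNge; apply: contraR; rewrite /dvdn -lt0n => n_gt0.
by apply: min; rewrite // iter_mod_ord.
Qed.

Lemma ord_involution x : s (s x) = x -> s x <> x -> ord x = 2%N.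
Proof.
move=> ssx sx; have /(iter_eqP x 2)/dvdn_leq := ssx; rewrite -ltnS => /(_ isT).
have := ord_gt0 x; have := iter_ord x.
by case: (ord x) => [|[|[|?]]].
Qed.

(** Periodicity suffices: completing a common period of [x] and [y] undoes the application of
    [s]. *)
Lemma perm_inj : injective s.
Proof.
move=> x y sxy; set n := (ord x * ord y)%N.
have n_gt0 : (0 < n)%N by rewrite muln_gt0 !ord_gt0.
have nx : iter n s x = x by rewrite /n mulnC iter_mul_ord.
have ny : iter n s y = y by rewrite /n iter_mul_ord.
by rewrite -nx -ny -(prednK n_gt0) !iterSr sxy.
Qed.

Lemma iter_inj n : injective (iter n s).
Proof. by elim: n => // n IH x y /= /perm_inj/IH. Qed.

Lemma ord_perm x : ord (s x) = ord x.
Proof.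
apply/eqP; rewrite eqn_dvd; apply/andP; split; apply/iter_eqP.
  by rewrite -iterSr iterS iter_ord.
by apply: perm_inj; rewrite -iterS iterSr iter_ord.
Qed.

Lemma ord_iter n x : ord (iter n s x) = ord x.
Proof. by elim: n => // n IH; rewrite iterS ord_perm. Qed.

Lemma psumD f x m n : psum f x (m + n) = psum f x m + psum f (iter m s x) n.
Proof.
rewrite /psum big_split_ord /=; congr (_ + _); apply: eq_bigr => j _.
by rewrite -iterD addnC.
Qed.

Lemma osum_shift f x : osum (f \o s) x = osum f x.
Proof.
rewrite /osum /=; have := iter_ord x; have := ord_gt0 x.
case: (ord x) => // n _ nx; rewrite big_ord_recr big_ord_recl /= addrC -iterS nx.
by congr (_ + _); apply: eq_bigr => j _; rewrite lift0.
Qed.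

Lemma osum_perm f x : osum f (s x) = osum f x.
Proof.
rewrite -[RHS]osum_shift /osum ord_perm; apply: eq_bigr => j _.
by rewrite /= -iterSr.
Qed.

Lemma osum_iter f n x : osum f (iter n s x) = osum f x.
Proof. by elim: n => // n IH; rewrite iterS osum_perm. Qed.

Lemma eq_osum f g x : f =1 g -> osum f x = osum g x.
Proof. by move=> fg; apply: eq_bigr => j _. Qed.

Lemma osumB f g x : osum (f \- g) x = osum f x - osum g x.
Proof. by rewrite /osum -sumrB. Qed.

Section Equivariant.
Variable E : D -> D -> Prop.
Hypothesis Erefl : forall x, E x x.
Hypothesis Esym : forall x y, E x y -> E y x.
Hypothesis Etrans : forall x y z, E x y -> E y z -> E x z.
Hypothesis Eperm : forall x y, E x y -> E (s x) (s y).
Hypothesis Eperiod : forall x y n, E x y -> iter n s x = x -> iter n s y = y.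

Definition invariant (f : D -> int) := forall x y, E x y -> f x = f y.

Lemma E_iter n x y : E x y -> E (iter n s x) (iter n s y).
Proof. by move=> xy; elim: n => //= n; exact: Eperm. Qed.

Lemma E_ord x y : E x y -> ord x = ord y.
Proof.
move=> xy; apply/eqP; rewrite eqn_dvd; apply/andP; split; apply/iter_eqP.
  by apply: Eperiod (Esym xy) _; exact: iter_ord.
by apply: Eperiod xy _; exact: iter_ord.
Qed.

(** Iterating further, up to a common multiple of the two periods, leads back to [x] and [y]. *)
Lemma E_iterK n x y : E (iter n s x) (iter n s y) -> E x y.
Proof.
move=> xy; set N := (ord x * ord y * n - n)%N.
have Nn : (N + n = ord x * ord y * n)%N.
  by rewrite subnK // -[leqLHS]mul1n leq_mul2r muln_gt0 !ord_gt0 orbT.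
have := E_iter N xy; rewrite -!iterD Nn.
by rewrite -{1}mulnA mulnC iter_mul_ord mulnAC iter_mul_ord.
Qed.

Lemma E_psum f : invariant f ->
  forall x y n, E x y -> psum f x n = psum f y n.
Proof. by move=> fE x y n xy; apply: eq_bigr => j _; exact/fE/E_iter. Qed.

Lemma invariant_osum f : invariant f -> invariant (osum f).
Proof. by move=> fE x y xy; rewrite /osum -(E_ord xy); exact: E_psum. Qed.

Let cls x y := exists k, E x (iter k s y).

(** The choice is applied to a whole class, as a set of points, so that points with equal classes
    receive the same representative. *)
Lemma orbit_class_repr :
  exists r : D -> D, (forall x, cls x (r x)) /\
    forall x y, cls x y -> r x = r y.
Proof.
have cls_refl x : cls x x by exists 0%N; exact: Erefl.
have cls_sym x y : cls x y -> cls y x.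
  (* Together with the given [k] steps these make [k] full periods. *)
  move=> [k xy]; exists (k * (ord y).-1)%N.
  apply: (@E_iterK k); rewrite -iterD -mulnS prednK ?ord_gt0 //.
  apply: Etrans (Esym xy) _; rewrite (_ : ord y = ord x).
    by rewrite iter_mul_ord; exact: Erefl.
  by rewrite (E_ord xy) ord_iter.
have cls_trans x y z : cls x y -> cls y z -> cls x z.
  move=> [k xy] [l yz]; exists (k + l)%N; rewrite iterD.
  exact: Etrans xy (E_iter k yz).
pose c x : set D := [set y | cls x y].
have cE x : exists y, c x y by exists x; exact: cls_refl.
exists (fun x => projT1 (cid (cE x))); split=> [x|x y xy].
  exact: (projT2 (cid (cE x))).
have cxy : c x = c y.
  apply/seteqP; split=> z /=; first exact/cls_trans/cls_sym.
  exact: cls_trans.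
have irr (P Q : set D) (p : exists z, P z) (q : exists z, Q z) : P = Q ->
    projT1 (cid p) = projT1 (cid q).
  by move=> PQ; move: p q; rewrite PQ => p q; rewrite (Prop_irrelevance p q).
exact: irr.
Qed.

(** This is where the absence of torsion in the integers is used. Going [c] steps to an equivalent
    point, [ord x] times over, amounts to [c] full turns of the orbit; so [ord x] times the partial
    sum is 0. *)
Lemma psum_E_eq0 f x c : invariant f -> osum f x = 0 ->
  E x (iter c s x) -> psum f x c = 0.
Proof.
move=> fE f0 xc.
have mulc q : psum f x (q * c) = psum f x c *+ q.
  elim: q => [|q IH]; first by rewrite /psum big_ord0.
  by rewrite mulSn psumD -(E_psum fE _ xc) IH mulrS.
have mulo q : psum f x (q * ord x) = 0.
  elim: q => [|q IH]; first by rewrite /psum big_ord0.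
  by rewrite mulSn psumD iter_ord IH addr0.
have /eqP := mulc (ord x); rewrite mulnC mulo eq_sym mulrn_eq0.
by rewrite eqn0Ngt ord_gt0 => /eqP.
Qed.

(** The value of [h] at [x] is the sum of [f] on the way from the representative of the class of [x]
    to a point equivalent to [x]. *)
Lemma antiderivative f : invariant f -> (forall x, osum f x = 0) ->
  exists2 h, invariant h & forall x, h (s x) - h x = f x.
Proof.
move=> fE f0; have [r [rE r_eq]] := orbit_class_repr.
have [k hk] := choice rE.
(* The number of steps taken is immaterial: two choices differ by a passage between equivalent
   points of one orbit, along which [f] sums to 0. *)
have indep x i j : E (iter i s x) (iter j s x) -> psum f x i = psum f x j.
  wlog ij : i j / (i <= j)%N.
    move=> H; case/orP: (leq_total i j) => ij; first exact: H.
    by move=> /Esym/H->.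
  rewrite -(subnKC ij) => xij; rewrite psumD (psum_E_eq0 (x := iter i s x)) ?addr0 //.
  by rewrite -iterD addnC.
exists (fun x => psum f (r x) (k x)) => [x y xy|x].
  have rxy : r x = r y by apply: r_eq; exists 0%N.
  rewrite rxy; apply: indep; apply: Etrans (Esym _) _.
    by rewrite -rxy; exact: hk.
  exact: Etrans xy (hk y).
have rx : r (s x) = r x.
  apply: r_eq; exists 1%N; exact: Erefl.
rewrite rx (indep _ _ (k x).+1); last first.
  apply: Etrans (Esym _) (Eperm (hk x)); rewrite -rx; exact: hk.
rewrite -addn1 psumD addrAC subrr add0r /psum big_ord1 /=.
by apply: fE; exact: Esym.
Qed.

(** The numbers of steps that lead from [x] to an equivalent point are closed under subtraction,
    hence are the multiples of the least positive one. The orbit then has a cyclic symmetry of order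
    [ord x %/ d]. *)
Lemma orbit_symmetry x : exists d, [/\ (0 < d)%N, (d %| ord x)%N
  & forall j, E x (iter j s x) <-> (d %| j)%N].
Proof.
have ex : exists n, (0 < n)%N && `[< E x (iter n s x) >].
  exists (ord x); rewrite ord_gt0 iter_ord; apply/asboolP; exact: Erefl.
case: (ex_minnP ex) => d /andP[d_gt0 /asboolP Ed] d_min.
have Emul q : E x (iter (q * d) s x).
  elim: q => [|q IH]; first exact: Erefl.
  by rewrite mulSnr iterD; apply: Etrans IH (E_iter _ Ed).
have dvd j : E x (iter j s x) <-> (d %| j)%N.
  split=> [xj|/dvdnP[q ->]]; last exact: Emul.
  have := ltn_pmod j d_gt0; rewrite ltnNge; apply: contraR.
  rewrite /dvdn -lt0n => j_gt0; apply: d_min; rewrite j_gt0; apply/asboolP.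
  apply: (@E_iterK (j %/ d * d)%N); rewrite -iterD -divn_eq.
  exact: Etrans (Esym (Emul _)) xj.
by exists d; split => //; apply/dvd; rewrite iter_ord; exact: Erefl.
Qed.

Lemma psum_mul f x d n : invariant f -> E x (iter d s x) ->
  psum f x (n * d) = psum f x d *+ n.
Proof.
move=> fE xd; elim: n => [|n IH]; first by rewrite /psum big_ord0.
by rewrite mulSn psumD -(E_psum fE _ xd) IH mulrS.
Qed.

(* The coefficient [f x] is shared equally among the [ord x %/ d] elements of
   one class of the orbit of [x], the class being chosen once for all the
   orbits equivalent to that of [x]. *)
Lemma distribute f : invariant f -> (forall x, f (s x) = f x) ->
  (forall x d, (0 < d)%N -> (d %| ord x)%N -> E x (iter d s x) ->
     ((ord x %/ d)%N %| f x)%Z) ->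
  exists2 h, invariant h & forall x, osum h x = f x.
Proof.
move=> fE fs fdvd; have [r [rE r_eq]] := orbit_class_repr.
pose n x : int := osum (fun y => `[< E x y >]%:R) x.
have nE : invariant n.
  move=> x y xy; rewrite /n /osum -(E_ord xy); apply: eq_bigr => j _.
  congr (_%:R); congr nat_of_bool; apply: asbool_equiv_eq; split=> H.
    exact: Etrans (Esym xy) (Etrans H (E_iter j xy)).
  exact: Etrans xy (Etrans H (Esym (E_iter j xy))).
have ns x : n (s x) = n x.
  rewrite /n osum_perm -[LHS]osum_shift; apply: eq_osum => y /=.
  congr (_%:R); congr nat_of_bool; apply: asbool_equiv_eq.
  by split; [exact: (@E_iterK 1)|exact: Eperm].
have ndvd x : (n x %| f x)%Z.
  have [d [d_gt0 d_ord dP]] := orbit_symmetry x.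
  rewrite (_ : n x = (ord x %/ d)%N); first by apply: fdvd => //; exact/dP.
  rewrite /n /osum.
  transitivity (psum (fun y => `[< E x y >]%:R) x (ord x %/ d * d)).
    by rewrite divnK.
  rewrite psum_mul; last exact/dP.
    rewrite /psum -(prednK d_gt0) big_ord_recl /= asboolT ?big1 ?addr0 => [|j _|].
    - by rewrite mulr1n natz.
    - rewrite asboolF // => /(dP j.+1); rewrite gtnNdvd //.
      by have := ltn_ord j; lia.
    - exact: Erefl.
  move=> y z yz; congr (_%:R); congr nat_of_bool; apply: asbool_equiv_eq.
  by split=> H; [exact: Etrans yz|exact: Etrans (Esym yz)].
exists (fun x => `[< E x (r x) >]%:R * (f x %/ n x)%Z) => [x y xy|x].
  have -> : r x = r y by apply: r_eq; exists 0%N.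
  rewrite (fE _ _ xy) (nE _ _ xy); congr (_%:R * _); congr nat_of_bool.
  apply: asbool_equiv_eq.
  by split=> H; [exact: Etrans (Esym xy) _|exact: Etrans xy _].
have [k hk] : exists k, E (iter k s x) (r x).
  have [k hk] := rE x; exists (k * (ord x).-1)%N.
  apply: (@E_iterK k); rewrite -iterD -mulnS prednK ?ord_gt0 //.
  by rewrite iter_mul_ord.
have ri j : r (iter j s x) = r x.
  apply: r_eq; exists j; exact: Erefl.
have fi j : f (iter j s x) = f x by elim: j => // j; rewrite iterS fs.
have ni j : n (iter j s x) = n x by elim: j => // j; rewrite iterS ns.
rewrite /osum (eq_bigr (fun j : 'I_(ord x) =>
    `[< E (iter k s x) (iter j s x) >]%:R * (f x %/ n x)%Z)); last first.
  move=> j _; rewrite ri fi ni; congr (_%:R * _); congr nat_of_bool.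
  apply: asbool_equiv_eq; split=> H.
    exact: Etrans hk (Esym H).
  exact: Etrans (Esym H) hk.
rewrite -mulr_suml.
rewrite (_ : \sum_(j < ord x) _ = n x); first by rewrite mulrC divzK.
by rewrite -(ni k) /n osum_iter.
Qed.

End Equivariant.
End Orbits.

(** * Invariant functions on darts *)

Section Families.
Variables (D : Type) (pe : (D -> int) -> Prop).

(** A presentation of [pe] by relations [E i], finer as [i] grows, each of which [s] respects. One
    predicate [pe] has a presentation for each of the three permutations, and [famP] allows
    switching between them. *)
Record family (s : D -> D) (E : nat -> D -> D -> Prop) : Prop := Family {
  fam_periodic : forall x, exists2 n, (0 < n)%N & iter n s x = x;
  fam_refl : forall i x, E i x x;
  fam_sym : forall i x y, E i x y -> E i y x;
  fam_trans : forall i x y z, E i x y -> E i y z -> E i x z;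
  fam_perm : forall i x y, E i x y -> E i (s x) (s y);
  fam_period : forall i x y n, E i x y -> iter n s x = x -> iter n s y = y;
  fam_le : forall i j x y, (i <= j)%N -> E j x y -> E i x y;
  famP : forall h, pe h <-> exists i, invariant (E i) h }.

Section Family.
Variables (s : D -> D) (E : nat -> D -> D -> Prop).
Hypothesis F : family s E.

Lemma invariant_le i j h : (i <= j)%N -> invariant (E i) h -> invariant (E j) h.
Proof. by move=> ij hE x y /(fam_le F ij)/hE. Qed.

Lemma pe_op (op : int -> int -> int) f g :
  pe f -> pe g -> pe (fun x => op (f x) (g x)).
Proof.
move=> /(famP F)[i fi] /(famP F)[j gj]; apply/(famP F); exists (maxn i j).
move=> x y xy; congr op; first exact: (invariant_le (leq_maxl i j) fi).
exact: (invariant_le (leq_maxr i j) gj).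
Qed.

Lemma pe_opp f : pe f -> pe (fun x => - f x).
Proof.
by move=> /(famP F)[i fi]; apply/(famP F); exists i => x y /fi ->.
Qed.

Lemma pe_comp f : pe f -> pe (f \o s).
Proof.
move=> /(famP F)[i fi]; apply/(famP F); exists i => x y xy.
exact/fi/(fam_perm F).
Qed.

Definition inv_perm x := iter (ord s x).-1 s x.

Lemma inv_permK x : s (inv_perm x) = x.
Proof.
have p := fam_periodic F.
by rewrite /inv_perm -iterS (prednK (ord_gt0 p x)) (iter_ord p).
Qed.

Lemma pe_comp_inv f : pe f -> pe (f \o inv_perm).
Proof.
move=> /(famP F)[i fi]; apply/(famP F); exists i => x y xy /=; apply: fi.
apply: (@E_iterK _ s (fam_periodic F) _ (@fam_perm _ _ F i) 1).
by rewrite /= !inv_permK.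
Qed.

Lemma pe_osum f : pe f -> pe (osum s f).
Proof.
move=> /(famP F)[i fi]; apply/(famP F); exists i.
apply: invariant_osum fi; [exact: (fam_periodic F)|exact: (fam_sym F)
  |exact: (fam_perm F)|exact: (fam_period F)].
Qed.

Lemma pe_antiderivative f : pe f -> (forall x, osum s f x = 0) ->
  exists2 h, pe h & forall x, h (s x) - h x = f x.
Proof.
move=> /(famP F)[i fi] f0.
have [h hE hf] := antiderivative (fam_periodic F) (fam_refl F i) (@fam_sym _ _ F i)
  (@fam_trans _ _ F i) (@fam_perm _ _ F i) (@fam_period _ _ F i) fi f0.
by exists h => //; apply/(famP F); exists i.
Qed.

Lemma pe_distribute f : pe f -> (forall x, f (s x) = f x) ->
  (exists i, forall x d, (0 < d)%N -> (d %| ord s x)%N -> E i x (iter d s x) ->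
     ((ord s x %/ d)%N %| f x)%Z) ->
  exists2 h, pe h & forall x, osum s h x = f x.
Proof.
move=> /(famP F)[i fi] fs [j fj]; pose k := maxn i j.
have fk := invariant_le (leq_maxl i j) fi.
have [x d d0 dx xd|h hE hf] := distribute (fam_periodic F) (fam_refl F k)
  (@fam_sym _ _ F k) (@fam_trans _ _ F k) (@fam_perm _ _ F k)
  (@fam_period _ _ F k) fk fs.
  by apply: fj => //; apply: (fam_le F) xd; exact: leq_maxr.
by exists h => //; apply/(famP F); exists k.
Qed.

End Family.

Definition odd_under (e : D -> D) (f : D -> int) := forall x, f (e x) = - f x.

Section Duality.
Variables (A B e : D -> D) (EA EB Ee : nat -> D -> D -> Prop).
Hypothesis FA : family A EA.
Hypothesis FB : family B EB.
Hypothesis Fe : family e Ee.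
Hypothesis eK : forall x, e (e x) = x.
Hypothesis eA : forall x, e (A x) = B x.

Lemma eB x : e (B x) = A x. Proof. by rewrite -eA eK. Qed.

Let pA := fam_periodic FA.
Let pB := fam_periodic FB.

(** Evaluating each function at the image of [x] under the other permutation makes the definition
    symmetric under the exchange of [A], [psi] with [B], [phi]. *)
Definition dual1 (psi phi h : D -> int) :=
  [/\ pe h, forall x, psi (B x) = h (A x) - h x
    & forall x, phi (A x) = h (B x) - h x].

(** By oddness [psi (B x)] is [- psi (A x)], whose sum over an orbit of [A] vanishes by the cocycle
    condition; so it has an antiderivative [h] along [A]. The differences of [h] along [B] define
    [phi], and telescope over the orbits of [B]. *)
Lemma dual1_exists psi : pe psi -> odd_under e psi ->
    (forall x, osum A psi x = 0) ->
  exists phi h, [/\ pe phi, odd_under e phi, forall x, osum B phi x = 0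
    & dual1 psi phi h].
Proof.
move=> psi_pe psi_odd psi0.
have psiB x : psi (B x) = - psi (A x) by rewrite -eA psi_odd.
have [||h h_pe hP] := @pe_antiderivative A EA FA (fun x => psi (B x)).
- exact: (pe_comp FB).
- move=> x; rewrite (eq_osum _ (g := fun y => - psi (A y))) //.
  by rewrite /osum sumrN -/(osum A (psi \o A) x) osum_shift // psi0 oppr0.
pose phi x := h (B (inv_perm A x)) - h (inv_perm A x).
have AK : cancel A (inv_perm A).
  by move=> x; apply: (perm_inj pA); rewrite (inv_permK FA).
have phiA x : phi (A x) = h (B x) - h x by rewrite /phi AK.
have phi_odd : odd_under e phi.
  move=> x; rewrite -[x](inv_permK FA); set y := inv_perm A x.
  (* The dart [z] plays for the reversed edge the part of [y]: [A z] is [B y] and [B z] is [A y].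
     Comparing the two equations for [psi] at [y] and [z] gives the oddness of [phi]. *)
  rewrite eA phiA; set z := inv_perm A (B y).
  have Az : A z = B y by rewrite (inv_permK FA).
  have Bz : B z = A y by rewrite -eA Az eB.
  rewrite -[in LHS]Az phiA Bz.
  have := hP z; rewrite Bz Az; have := hP y; have := psiB y; lia.
exists phi, h; split => //.
- apply: (@pe_comp_inv _ _ FA (fun y => h (B y) - h y)).
  by apply: (pe_op FA (fun a b => a - b)) => //; exact: (pe_comp FB).
- move=> x; rewrite -(osum_shift pB).
  rewrite (eq_osum _ (g := h \- (h \o B))); last first.
    by move=> y /=; rewrite -eA phi_odd phiA opprB eA.
  by rewrite osumB (osum_shift pB h) subrr.
- by split => // x; rewrite hP.
Qed.

(** If [psi] is the coboundary of [c], then [h] and [c] have equal differences along [A], so [h - c]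
    is constant on its orbits; subtracting [c] does not alter the differences along [B], where [c]
    is invariant. *)
Lemma dual1_boundary psi phi h c : dual1 psi phi h -> pe c ->
    (forall x, c (B x) = c x) -> (forall x, psi (B x) = c (A x) - c x) ->
  exists2 f, pe f & (forall x, f (A x) = f x) /\
    forall x, phi (A x) = f (B x) - f x.
Proof.
move=> [h_pe hpsi hphi] c_pe cB cpsi; exists (fun x => h x - c x).
  by apply: (pe_op FA (fun a b => a - b)).
split=> x; first by have := hpsi x; rewrite cpsi; lia.
by rewrite hphi cB; lia.
Qed.

Hypothesis no_flip : exists i, forall x, ~ Ee i x (e x).

(** An orbit of [e] consists of two inequivalent darts, so the constant 1 is an orbit sum: some
    equivariant [k] satisfies [k x + k (e x) = 1]. Multiplying [eta] by this [k] splits it. *)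
Lemma split_odd eta : pe eta -> odd_under e eta ->
  exists2 k, pe k & forall x, eta x = k x - k (e x).
Proof.
move=> eta_pe eta_odd; have [i flip] := no_flip.
have e_neq x : e x <> x by move=> ex; apply: (flip x); rewrite ex; exact: (fam_refl Fe).
have ord_e x : ord e x = 2%N.
  by apply: (ord_involution (fam_periodic Fe)); [exact: eK|exact: e_neq].
have [|//||k k_pe k1] := @pe_distribute e Ee Fe (fun=> 1).
- by apply/(famP Fe); exists 0%N.
- exists i => x d d0; rewrite ord_e => d2; have : (d <= 2)%N by exact: dvdn_leq d2.
  by case: d d0 d2 => [|[|[|?]]] //= _ _ _ /flip.
exists (fun x => eta x * k x).
  exact: (pe_op FA (fun a b => a * b)).
move=> x; rewrite eta_odd mulNr opprK -mulrDr.
have := k1 x; rewrite /osum ord_e big_ord_recr big_ord1 /= => ->.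
by rewrite mulr1.
Qed.

(** Write [eta] as [k' x - k' (e x)]. Shifting by [A] turns [k' (e x)] into [k' (B x)] without
    changing orbit sums of [A], so [k x - (k' x - k' (B x))] sums to 0 over these orbits and is a
    difference [l (A x) - l x]. Over an orbit of [B] the correction telescopes away, while
    [l (A x) = l (e (B x))] has the sum of [l (e x)]; what remains is the odd function
    [l (e x) - l x]. *)
Lemma dual2_boundary k eta : pe k -> pe eta -> odd_under e eta ->
    (forall x, osum A k x = osum A eta x) ->
  exists2 phi, pe phi /\ odd_under e phi & forall x, osum B k x = osum B phi x.
Proof.
move=> k_pe eta_pe eta_odd k_eta.
have [k' k'_pe k'P] := split_odd eta_pe eta_odd.
pose k1 x := k x - (k' x - k' (B x)).
have [|x|l l_pe lP] := @pe_antiderivative A EA FA k1.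
- apply: (pe_op FA (fun a b => a - b)) => //.
  by apply: (pe_op FA (fun a b => a - b)) => //; exact: (pe_comp FB).
- rewrite /k1 osumB k_eta -(osumB A) /=.
  rewrite (eq_osum _ (g := fun y => (k' \o B) y - (k' \o e) y)); last first.
    by move=> y /=; rewrite k'P; lia.
  rewrite osumB -(osum_shift pA (k' \o e)) -osumB /osum big1 // => j _ /=.
  by rewrite eA subrr.
exists (fun x => l (e x) - l x).
  split; last by move=> x; rewrite eK opprB.
  by apply: (pe_op FA (fun a b => a - b)) => //; exact: (pe_comp Fe).
move=> x; rewrite osumB -(osum_shift pB (l \o e)).
rewrite (eq_osum _ (f := (l \o e) \o B) (g := l \o A)); last first.
  by move=> y /=; rewrite eB.
rewrite -osumB (eq_osum _ (f := (l \o A) \- l) (g := k1)); last by move=> y; exact: lP.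
rewrite /k1 osumB osumB.
by rewrite (osum_shift pB k') subrr subr0.
Qed.

End Duality.
End Families.

(** * The plane *)

Section Plane.
Context {R : realType}.
Local Notation V := 'rV[R]_2.
Implicit Types (a b u v w x y z : V) (s t : R) (c : set V).

Definition cross u v : R := u 0 0 * v 0 1 - u 0 1 * v 0 0.

Lemma vecP u v : u 0 0 = v 0 0 -> u 0 1 = v 0 1 -> u = v.
Proof.
move=> h0 h1; apply/rowP => j; have : j = 0 \/ j = 1.
  by case: j => [[|[|//]] ?]; [left|right]; exact: val_inj.
by case=> ->.
Qed.

Lemma crossDl u v w : cross (u + v) w = cross u w + cross v w.
Proof. by rewrite /cross !mxE; ring. Qed.

Lemma crossZl s u v : cross (s *: u) v = s * cross u v.
Proof. by rewrite /cross !mxE; ring. Qed.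

Lemma crossZr s u v : cross u (s *: v) = s * cross u v.
Proof. by rewrite /cross !mxE; ring. Qed.

Lemma crossNl u v : cross (- u) v = - cross u v.
Proof. by rewrite /cross !mxE; ring. Qed.

Lemma crossC u v : cross u v = - cross v u.
Proof. by rewrite /cross; ring. Qed.

Lemma crossvv u : cross u u = 0.
Proof. by rewrite /cross; ring. Qed.

(** Cramer's rule. *)
Lemma cross_basis u v z : cross u v != 0 ->
  z = (cross z v / cross u v) *: u + (cross u z / cross u v) *: v.
Proof.
by move=> uv; apply: vecP; rewrite !mxE; move: uv; rewrite /cross => uv; field.
Qed.

Lemma cross_eq0 u v : u != 0 -> cross u v = 0 -> exists s, v = s *: u.
Proof.
move=> u0 uv; have [u00|u00] := eqVneq (u 0 0) 0.
  have u01 : u 0 1 != 0.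
    by apply: contraNN u0 => /eqP u01; apply/eqP/vecP; rewrite !mxE.
  have v0 : v 0 0 = 0.
    apply/eqP; move/eqP: uv; rewrite /cross u00 mul0r sub0r oppr_eq0 mulf_eq0.
    by rewrite (negbTE u01).
  exists (v 0 1 / u 0 1); apply: vecP; rewrite !mxE; last by field.
  by rewrite u00 v0 mulr0.
exists (v 0 0 / u 0 0); apply: vecP; rewrite !mxE; first by field.
apply: (mulfI u00); move: uv; rewrite /cross => /eqP; rewrite subr_eq0 => /eqP ->.
by field.
Qed.

Definition perp u : V := \row_j (if j == 0 then - u 0 1 else u 0 0).

Lemma cross_perp_gt0 u : u != 0 -> 0 < cross u (perp u).
Proof.
move=> u0; rewrite /cross !mxE /= mulrN opprK -!expr2 lt_neqAle eq_sym.
rewrite addr_ge0 ?sqr_ge0 // andbT paddr_eq0 ?sqr_ge0 // !sqrf_eq0.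
apply: contraNN u0 => /andP[/eqP h0 /eqP h1]; apply/eqP/vecP; by rewrite !mxE.
Qed.

Lemma det2E (M : 'M[R]_2) : \det M = M 0 0 * M 1 1 - M 0 1 * M 1 0.
Proof.
rewrite (expand_det_row _ 0) !big_ord_recl big_ord0 addr0 /cofactor !det_mx11 !mxE.
have -> : lift 0 0 = 1 :> 'I_2 by exact: val_inj.
have -> : lift 1 0 = 0 :> 'I_2 by exact: val_inj.
by rewrite /= expr0 expr1; ring.
Qed.

Lemma det_col_mx u v : \det (col_mx u v : 'M[R]_2) = cross u v.
Proof.
rewrite det2E; set M := (X in fun_of_matrix X 0 0 * _).
have M0 j : M 0 j = u 0 j.
  by rewrite -(col_mxEu u v 0 j); congr (fun_of_matrix M _ _); exact: val_inj.
have M1 j : M 1 j = v 0 j.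
  by rewrite -(col_mxEd u v 0 j); congr (fun_of_matrix M _ _); exact: val_inj.
by rewrite !M0 !M1.
Qed.

Definition seg a b : set V := [set x | exists2 s, 0 <= s <= 1 & x = a + s *: (b - a)].

Lemma seg_l a b : seg a b a.
Proof. by exists 0; rewrite ?scale0r ?addr0 ?lexx ?ler01. Qed.

Lemma seg_r a b : seg a b b.
Proof. by exists 1; rewrite ?scale1r ?subrKC ?lexx ?ler01. Qed.

Lemma segC a b : seg a b = seg b a.
Proof.
suff H a' b' : seg a' b' `<=` seg b' a' by apply/seteqP.
move=> _ [s s01 ->]; exists (1 - s); first by lra.
by apply: vecP; rewrite !mxE; ring.
Qed.

Lemma seg_inj_r a b b' : a != b -> seg a b = seg a b' -> b = b'.
Proof.
move=> ab ss; have [s s01 bE] : seg a b' b by rewrite -ss; exact: seg_r.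
have [t t01 bE'] : seg a b b' by rewrite ss; exact: seg_r.
have : b - a = (s * t) *: (b - a).
  by rewrite {1}bE addrC addKr {1}bE' [in X in _ *: X]addrC addKr scalerA.
move/eqP; rewrite -subr_eq0 -{1}[b - a]scale1r -scalerBl scaler_eq0 !subr_eq0.
rewrite (eq_sym b) (negbTE ab) orbF => /eqP st.
have s1 : s = 1 by nra.
by rewrite bE s1 scale1r subrKC.
Qed.

End Plane.

(** * Polytopes of dimension at most two *)

Section PolytopeTopology.
Context {R : realType}.
Local Notation V := 'rV[R]_2.
Implicit Types (a b u v w x y z : V) (s t : R) (c : set V) (k : nat).

Lemma polytope_convex k c x y s :
  polytope k c -> c x -> c y -> 0 <= s <= 1 -> c (x + s *: (y - x)).
Proof.
move=> [_ [n [p ->]] _] [v [v0 v1 ->]] [w [w0 w1 ->]] /andP[s0 s1].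
exists (fun i => (1 - s) * v i + s * w i); split.
- by move=> i; rewrite addr_ge0 // mulr_ge0 // subr_ge0.
- by rewrite big_split /= -!mulr_sumr v1 w1 !mulr1 subrK.
under [RHS]eq_bigr do rewrite scalerDl -!scalerA.
rewrite big_split /= -!scaler_sumr scalerBl scale1r scalerBr addrA.
by rewrite addrAC.
Qed.

(** A polytope is the continuous image of a standard simplex, which is a closed part of a cube. *)
Lemma polytope_compact k c : polytope k c -> compact c.
Proof.
move=> [_ [n [p ->]] _].
pose S := [set w : 'rV[R]_n | forall i, `[0, 1]%classic (w ord0 i)] `&`
  (fun w : 'rV[R]_n => \sum_i w ord0 i) @^-1` [set 1].
pose h (w : 'rV[R]_n) : V := \sum_i w ord0 i *: p i.
have -> : convex_hull p = h @` S.
  apply/seteqP; split=> [x [w [w0 w1 ->]]|_ [w [w01 w1] <-]].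
    exists (\row_i w i); last by apply: eq_bigr => i _; rewrite mxE.
    split=> /= [i|]; last by rewrite -w1; apply: eq_bigr => i _; rewrite mxE.
    rewrite in_itv /= mxE w0 -w1 (bigD1 i) //= lerDl.
    by apply: sumr_ge0 => j _.
  exists (w ord0); split => // i.
  by have := w01 i; rewrite /= in_itv /= => /andP[].
apply: continuous_compact.
  apply: continuous_subspaceT.
  apply: (continuous_big add_continuous (F := fun i (w : 'rV[R]_n) => w ord0 i *: p i)).
  move=> i _ w.
  apply: (@continuous_comp _ _ _ (fun w : 'rV[R]_n => w ord0 i) (fun r => r *: p i)).
    exact: coord_continuous.
  exact: scalel_continuous.
have I01 : compact [set w : 'rV[R]_n | forall i, `[0, 1]%classic (w ord0 i)].
  by apply: (@rV_compact R n (fun=> `[0, 1]%classic)) => _; exact: segment_compact.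
apply: (subclosed_compact _ I01).
- apply: closedI.
    rewrite (_ : [set w | _] = \bigcap_i [set w : 'rV[R]_n | `[0, 1]%classic (w ord0 i)]).
      apply: closed_bigI => i _.
      apply: (@preimage_closed _ _ (fun w : 'rV[R]_n => w ord0 i)).
        by move=> w _; exact: coord_continuous.
      exact: interval_closed.
    by apply/seteqP; split=> [w hw i _|w hw i]; exact: hw.
  apply: preimage_closed; last exact: closed_eq.
  move=> w _; move: w.
  apply: (continuous_big add_continuous (F := fun i (w : 'rV[R]_n) => w ord0 i)).
  by move=> i _; exact: coord_continuous.
- by move=> w [].
Qed.

Lemma polytope_closed k c : polytope k c -> closed c.
Proof.
by move=> /polytope_compact; apply: compact_closed; exact: norm_hausdorff.
Qed.

Lemma frame_dim k l c (B : 'M[R]_(k, 2)) (C : 'M[R]_(l, 2)) :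
  c !=set0 -> frame c B -> frame c C -> (B :=: C)%MS /\ k = l.
Proof.
move=> [x cx] [fB hB] [fC hC].
have sub m n (M : 'M[R]_(m, 2)) (N : 'M[R]_(n, 2)) :
    [set y | (y - x <= M)%MS] = [set y | (y - x <= N)%MS] -> (M <= N)%MS.
  move=> MN; apply/rV_subP => v vM.
  suff : [set y | (y - x <= N)%MS] (v + x) by rewrite /= addrK.
  by rewrite -MN /= addrK.
have BC : (B :=: C)%MS.
  apply/eqmxP; rewrite !sub //.
    by rewrite -(hB x cx) -(hC x cx).
  by rewrite -(hC x cx) -(hB x cx).
split=> //; have : \rank B = \rank C by rewrite BC.
by rewrite (eqP fB) (eqP fC).
Qed.

Lemma polytope_dim k l c : polytope k c -> polytope l c -> k = l.
Proof. by move=> [c0 _ [B hB]] [_ _ [C hC]]; have [] := frame_dim c0 hB hC. Qed.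


Lemma polytope0P c : polytope 0 c -> exists x, c = [set x].
Proof.
move=> [[x cx] _ [B [_ hB]]]; exists x; apply/seteqP; split=> [y cy|_ ->//].
have : affine_hull c y.
  exists 1%N, (fun=> y), (fun=> 1); split=> //; rewrite big_ord1 ?scale1r//.
rewrite (hB x cx) /= => /submxP[M]; rewrite (flatmx0 B) mulmx0.
by move/eqP; rewrite subr_eq0 => /eqP.
Qed.

Lemma set1_relint k c x : polytope k c -> c = [set x] -> relint c x.
Proof.
move=> [_ _ _] cE; rewrite cE; split=> //; apply/nbhs_normP.
exists 1 => /= [|y _ [n [p [w [pc w1 ->]]]]] //.
rewrite (eq_bigr (fun i => w i *: x)); last by move=> i _; rewrite [p i]pc.
by rewrite -scaler_suml w1 scale1r.
Qed.

Lemma polytope0_set1 x : polytope 0 [set x].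
Proof.
split; first by exists x.
  exists 1%N, (fun=> x); apply/seteqP; split=> [_ ->|y [w [_ w1 ->]]].
    exists (fun=> 1); split=> //; first by rewrite big_ord1.
    by rewrite big_ord1 scale1r.
  by rewrite big_ord1; move: w1; rewrite big_ord1 => ->; rewrite scale1r.
exists 0; split; first by rewrite /row_free mxrank0.
move=> _ ->; apply/seteqP; split=> [y [n [p [w [pc w1 ->]]]]|y] /=; last first.
  move=> /submxP[M]; rewrite mulmx0 => /eqP; rewrite subr_eq0 => /eqP ->.
  by exists 1%N, (fun=> x), (fun=> 1); split=> //; rewrite big_ord1 ?scale1r.
rewrite (eq_bigr (fun i => w i *: x)); last by move=> i _; rewrite [p i]pc.
by rewrite -scaler_suml w1 scale1r subrr sub0mx.
Qed.

Lemma affine_hull_seg a b :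
  affine_hull (seg a b) = [set y | exists s, y = a + s *: (b - a)].
Proof.
apply/seteqP; split=> [x [n [p [w [ps w1 ->]]]]|_ [s ->]].
  have ps' i : exists s, p i = a + s *: (b - a) by have [s _ ->] := ps i; exists s.
  have [t ht] := choice ps'.
  exists (\sum_i w i * t i).
  rewrite (eq_bigr (fun i => w i *: a + (w i * t i) *: (b - a))).
    by rewrite big_split /= -!scaler_suml w1 scale1r.
  by move=> i _; rewrite ht scalerDr scalerA.
exists 2%N, (fun i => if i == 0 then a else b), (fun i => if i == 0 then 1 - s else s).
split=> [i| |].
- by case: ifP => _; [exact: seg_l|exact: seg_r].
- by rewrite !big_ord_recl big_ord0 /= addr0 subrK.
- rewrite !big_ord_recl big_ord0 /= addr0.
  by apply: vecP; rewrite !mxE; ring.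
Qed.

Lemma frame_seg a b : a != b -> frame (seg a b) (b - a).
Proof.
move=> ab; have ba : b - a != 0 by rewrite subr_eq0 eq_sym.
split; first by rewrite /row_free rank_rV ba.
move=> _ [s _ ->]; rewrite affine_hull_seg; apply/seteqP; split=> y /=.
  move=> [t ->]; apply/sub_rVP; exists (t - s).
  by rewrite scalerBl opprD addrACA subrr add0r.
move=> /sub_rVP[t yE]; exists (t + s).
by rewrite scalerDl -yE addrCA subrK.
Qed.

Lemma relint_seg a b x : a != b -> relint (seg a b) x <->
  exists2 s, 0 < s < 1 & x = a + s *: (b - a).
Proof.
move=> ab; have ba : 0 < `|b - a| by rewrite normr_gt0 subr_eq0 eq_sym.
have inj s t : a + s *: (b - a) = a + t *: (b - a) -> s = t.
  move=> /addrI/eqP; rewrite -subr_eq0 -scalerBl scaler_eq0 -[_ - a == 0]normr_eq0.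
  by rewrite (gt_eqF ba) orbF subr_eq0 => /eqP.
split=> [[[s s01 ->]]|[s /andP[s0 s1] ->]].
  rewrite affine_hull_seg => /nbhs_normP[d /= d0 hd].
  have H e : `|e| < d / `|b - a| -> 0 <= s + e <= 1.
    move=> he; have : seg a b (a + (s + e) *: (b - a)).
      apply: hd; last by exists (s + e).
      rewrite /= opprD addrACA subrr add0r -scalerBl opprD addrA subrr sub0r.
      by rewrite normrZ normrN -ltr_pdivlMr.
    by move=> [t t01 /inj ->].
  pose e := d / `|b - a| / 2.
  have e0 : 0 < e by rewrite !divr_gt0.
  have ed : e < d / `|b - a| by rewrite ltr_pdivrMr // ltr_pMr ?divr_gt0 // ltr1n.
  exists s => //; have := H e; have := H (- e).
  rewrite normrN gtr0_norm // => /(_ ed) + /(_ ed); lra.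
split; first by exists s => //; rewrite !ltW.
rewrite affine_hull_seg; apply/nbhs_normP.
exists (Num.min s (1 - s) * `|b - a|) => /=.
  by rewrite mulr_gt0 // lt_min s0 subr_gt0.
move=> _ /[swap] -[t ->].
rewrite /= opprD addrACA subrr add0r -scalerBl normrZ ltr_pM2r // lt_min => /andP[].
rewrite !ltr_norml => ? ?; exists t => //; lra.
Qed.

(** The generating points lie on one line; those with the extreme coordinates are the ends, and they
    are distinct because a single point has dimension 0. *)
Lemma polytope1P c : polytope 1 c -> exists a b, a != b /\ c = seg a b.
Proof.
move=> cP; have [[x cx] [n [p cE]] [B [fB hB]]] := cP.
have cp i : c (p i).
  rewrite cE; exists (fun j => (j == i)%:R); split=> [j||].
  - by case: (j == i).
  - by rewrite (bigD1 i) //= eqxx big1 ?addr0 // => j /negbTE ->.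
  - rewrite (bigD1 i) //= eqxx scale1r big1 ?addr0 // => j /negbTE ->.
    by rewrite scale0r.
have line y : c y -> exists s, y = x + s *: B.
  move=> cy; have : affine_hull c y.
    exists 1%N, (fun=> y), (fun=> 1); split=> //; rewrite big_ord1 ?scale1r//.
  rewrite (hB x cx) => /sub_rVP[s yE]; exists s.
  by rewrite -yE addrC subrK.
have [t ht] := choice (fun i => line _ (cp i)).
have n0 : (0 < n)%N.
  case: n p cE cp t ht => // p cE; move: cx; rewrite cE => -[w [_ + _]].
  by rewrite big_ord0 => /eqP; rewrite eq_sym oner_eq0.
have [i0 hi0] : exists i, forall j, t i <= t j.
  have [i _ hi] := @arg_minP _ R _ (Ordinal n0) xpredT t isT.
  by exists i => j; exact: hi.
have [i1 hi1] : exists i, forall j, t j <= t i.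
  have [i _ hi] := @arg_maxP _ R _ (Ordinal n0) xpredT t isT.
  by exists i => j; exact: hi.
exists (p i0), (p i1).
have cseg : c = seg (p i0) (p i1).
  apply/seteqP; split=> [y cy|_ [s s01 ->]]; last exact: (polytope_convex cP).
  move: cy; rewrite {1}cE => -[w [w0 w1 ->]]; pose m := \sum_i w i * t i.
  have yE : \sum_i w i *: p i = x + m *: B.
    rewrite (eq_bigr (fun i => w i *: x + (w i * t i) *: B)).
      by rewrite big_split /= -!scaler_suml w1 scale1r.
    by move=> i _; rewrite ht scalerDr scalerA.
  have m0 : t i0 <= m.
    rewrite -[t i0]mul1r -w1 mulr_suml; apply: ler_sum => i _.
    by rewrite ler_wpM2l.
  have m1 : m <= t i1.
    rewrite -[t i1]mul1r -w1 mulr_suml; apply: ler_sum => i _.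
    by rewrite ler_wpM2l.
  rewrite yE !ht; have [t01|t01] := eqVneq (t i0) (t i1).
    rewrite (_ : m = t i0); last by lra.
    by exists 0; rewrite ?lexx ?ler01 // scale0r addr0.
  have t_gt0 : 0 < t i1 - t i0 by move: t01; rewrite neq_lt subr_gt0; case/orP; lra.
  exists ((m - t i0) / (t i1 - t i0)).
    by rewrite divr_ge0 ?subr_ge0 ?(le_trans m0) //= ler_pdivrMr // mul1r lerB.
  have t_neq0 : t i1 - t i0 != 0 by rewrite gt_eqF.
  by clear - t_neq0; apply: vecP; rewrite !mxE; field.
split=> //; apply/eqP => pp.
have c1 : c = [set p i0].
  rewrite cseg -pp; apply/seteqP; split=> [_ [s _ ->]|_ ->]; last exact: seg_l.
  by rewrite subrr scaler0 addr0.
have := polytope0_set1 (p i0); rewrite -c1 => c0.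
by have := polytope_dim cP c0.
Qed.

Lemma affine_hull_tile c : polytope 2 c -> affine_hull c = setT.
Proof.
move=> [[x cx] _ [B [fB hB]]]; rewrite (hB x cx); apply/seteqP; split=> // y _ /=.
by apply: submx_full; rewrite /row_full -/(row_free B).
Qed.

Lemma frame_tile c (B : 'M[R]_2) : polytope 2 c -> frame c B <-> B \in unitmx.
Proof.
move=> cP; rewrite -row_free_unit; split=> [[]//|fB]; split=> // x cx.
rewrite (affine_hull_tile cP); apply/seteqP; split=> // y _ /=.
by apply: submx_full; rewrite /row_full -/(row_free B).
Qed.

Lemma relint_tile c x : polytope 2 c ->
  relint c x <-> exists2 e, 0 < e & forall y, `|y - x| < e -> c y.
Proof.
move=> cP; split=> [[cx]|[e e0 he]].
  rewrite (affine_hull_tile cP) => /nbhs_normP[e /= e0 he]; exists e => // y yx.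
  by apply: he => //=; rewrite distrC.
split; first by apply: he; rewrite subrr normr0.
apply/nbhs_normP; exists e => // y /= yx _; apply: he; rewrite distrC; exact: yx.
Qed.

Lemma polytope_dim_le2 k c : polytope k c -> (k <= 2)%N.
Proof. by move=> [_ _ [B [/eqP fB _]]]; have := rank_leq_col B; rewrite fB. Qed.

Lemma polytope_le k l c c' : polytope k c -> polytope l c' -> c `<=` c' ->
  (k <= l)%N.
Proof.
move=> [[x cx] _ [B [fB hB]]] [_ _ [C [fC hC]]] cc'.
rewrite -(eqP fB) -(eqP fC); apply: mxrankS; apply/rV_subP => v vB.
have hv : affine_hull c (v + x) by rewrite (hB x cx) /= addrK.
have : affine_hull c' (v + x).
  by case: hv => n [p [w [pc w1 E]]]; exists n, p, w; split=> // i; exact: cc'.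
by rewrite (hC x (cc' _ cx)) /= addrK.
Qed.

End PolytopeTopology.

(** * Cells of a tiling *)

Section Cells.
Context {R : realType} {L : Type}.
Variable T : tiling R L.
Local Notation V := 'rV[R]_2.
Implicit Types (a b u v w x y z : V) (s t : R) (c e : set V) (k : nat).

Lemma relint_cover x : exists2 c, cell T c & relint c x.
Proof.
have [cov _ _] := open_cell_partition T.
by have : cover (cell T) relint x; [rewrite cov|move=> [c]; exists c].
Qed.

Lemma relint_uniq c c' x : cell T c -> cell T c' -> relint c x -> relint c' x ->
  c = c'.
Proof.
have [_ triv _] := open_cell_partition T.
by move=> Cc Cc' cx cx'; apply: triv => //; exists x.
Qed.

Lemma relint_neq0 c : cell T c -> exists x, relint c x.
Proof. by have [_ _ ne] := open_cell_partition T => /ne. Qed.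

Lemma kcell_cases c : cell T c -> [\/ kcell T 0 c, kcell T 1 c | kcell T 2 c].
Proof.
move=> Cc; have [k ck] := cell_polytope Cc.
have := polytope_dim_le2 ck; case: k ck => [|[|[|//]]] ck _.
- by constructor 1.
- by constructor 2.
- by constructor 3.
Qed.

Lemma kcell_inj k l c : kcell T k c -> kcell T l c -> k = l.
Proof. by move=> [_ ck] [_ cl]; exact: polytope_dim ck cl. Qed.

Lemma vertexP c : kcell T 0 c -> exists v, c = [set v].
Proof. by move=> [_ /polytope0P]. Qed.

Lemma set1_kcell v : cell T [set v] -> kcell T 0 [set v].
Proof. by split => //; exact: polytope0_set1. Qed.

Lemma relint_set1 v : relint [set v] v.
Proof. exact: set1_relint (polytope0_set1 v) erefl. Qed.

Lemma boundary_cell c x : cell T c -> c x -> ~ relint c x ->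
  exists c', [/\ cell T c', c' `<=` c `\` relint c & c' x].
Proof.
move=> Cc cx ncx; have : (c `\` relint c) x by [].
by rewrite [X in X x](cell_boundary Cc) => -[c' [Cc' c'c] c'x]; exists c'; split.
Qed.

Lemma edge_neq a b : kcell T 1 (seg a b) -> a != b.
Proof.
move=> [_ ab]; apply/eqP => E; have := polytope0_set1 a.
rewrite (_ : [set a] = seg a b); first by move=> /(polytope_dim ab).
rewrite -E; apply/seteqP; split=> [_ ->|_ [s _ ->]]; first exact: seg_l.
by rewrite /= subrr scaler0 addr0.
Qed.

Lemma edge_relint a b x : kcell T 1 (seg a b) -> seg a b x ->
  [\/ x = a, x = b | relint (seg a b) x].
Proof.
move=> E [s /andP[s0 s1] ->].
have [->|s_neq0] := eqVneq s 0; first by constructor 1; rewrite scale0r addr0.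
have [->|s_neq1] := eqVneq s 1; first by constructor 2; rewrite scale1r subrKC.
constructor 3; apply/(relint_seg _ (edge_neq E)); exists s => //.
by rewrite !lt_neqAle eq_sym s_neq0 s0 s_neq1.
Qed.

Lemma seg_relint_l a b : a != b -> ~ relint (seg a b) a.
Proof.
move=> ab /(relint_seg _ ab)[s /andP[s0 _]] /eqP.
rewrite -subr_eq0 opprD addrA subrr sub0r oppr_eq0 scaler_eq0 (gt_eqF s0).
by rewrite subr_eq0 eq_sym (negbTE ab). 
Qed.

(** The point [a] lies in a cell contained in the two-point set of ends. If that cell also contained
    [b] it would contain the midpoint, by convexity. *)
Lemma edge_end a b : kcell T 1 (seg a b) -> cell T [set a].
Proof.
move=> E; have ab := edge_neq E.
have [c' [Cc' c'E c'a]] := boundary_cell E.1 (seg_l a b) (seg_relint_l ab).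
suff <- : c' = [set a] by [].
apply/seteqP; split=> [z c'z|_ ->//]; apply: contrapT => /= za.
have [sz nz] := c'E z c'z; have [//||//] := edge_relint E sz => zb.
have [k c'k] := cell_polytope Cc'.
have : c' (a + 2^-1 *: (b - a)).
  by rewrite -zb; apply: (polytope_convex c'k) => //; lra.
move/c'E => -[_]; apply; apply/(relint_seg _ ab); exists 2^-1 => //; lra.
Qed.

Lemma edge_end_r a b : kcell T 1 (seg a b) -> cell T [set b].
Proof. by rewrite segC; exact: edge_end. Qed.

Lemma edgeP e : kcell T 1 e -> exists a b, e = seg a b.
Proof. by move=> [_ /polytope1P[a [b [_ ->]]]]; exists a, b. Qed.

Lemma cell_face_edge c c' x : cell T c -> ~ kcell T 2 c -> cell T c' ->
  relint c' x -> c x -> c' `<=` c.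
Proof.
move=> Cc c2 Cc' c'x; case: (kcell_cases Cc) => //.
- move=> /vertexP[v cE]; rewrite cE => xv.
  have -> // : c' = [set v].
  apply: (relint_uniq Cc' _ c'x); first by rewrite -cE.
  by rewrite xv; exact: relint_set1.
- move=> E; have [a [b cE]] := edgeP E; move: E; rewrite cE => E cx.
  have end_sub y : cell T [set y] -> x = y -> seg a b y -> c' `<=` seg a b.
    move=> Cy xy yE; have -> : c' = [set y].
      apply: (relint_uniq Cc' Cy c'x); rewrite xy; exact: relint_set1.
    by move=> _ ->.
  have [xa|xb|rx] := edge_relint E cx.
  + by apply: end_sub xa _; [exact: edge_end E|exact: seg_l].
  + by apply: end_sub xb _; [exact: edge_end_r E|exact: seg_r].
  + by rewrite (relint_uniq Cc' E.1 c'x rx).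
Qed.

Lemma tile_boundary c c' : tile T c -> cell T c' -> c' `<=` c `\` relint c ->
  ~ tile T c'.
Proof.
move=> Tc Cc' c'c Tc'; have [z c'z] := relint_neq0 Cc'.
have [cz] := c'c z c'z.1; apply; apply/(relint_tile _ Tc.2).
have [d d0 hd] := (relint_tile _ Tc'.2).1 c'z.
by exists d => // y /hd /c'c[].
Qed.

(** A boundary point of a tile lies in a cell of the boundary, which cannot be a tile since it has
    no interior; this reduces the claim to vertices and edges, whose boundaries are explicit. *)
Lemma cell_face c c' x : cell T c -> cell T c' -> relint c' x -> c x ->
  c' `<=` c.
Proof.
move=> Cc Cc' c'x cx; have [Tc|] := pselect (tile T c); last first.
  by move=> nTc; exact: cell_face_edge cx.
have [rx|nrx] := pselect (relint c x); first by rewrite (relint_uniq Cc' Cc c'x rx).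
have [c'' [Cc'' c''c c''x]] := boundary_cell Cc cx nrx.
apply: subset_trans (_ : c'' `<=` c); last by move=> y /c''c[].
apply: cell_face_edge c'x c''x => //; exact: tile_boundary c''c.
Qed.

Lemma cell_closed c : cell T c -> closed c.
Proof. by move=> /cell_polytope[k]; exact: polytope_closed. Qed.

(** The union of the cells that miss [x] is closed in the weak topology, because it meets each cell
    in a finite union of faces. *)
Lemma local_cells x : exists2 d : R, 0 < d &
  forall c y, cell T c -> c y -> `|y - x| < d -> c x.
Proof.
pose A : set V := \bigcup_(c in [set c | cell T c /\ ~ c x]) c.
have Acl : closed A.
  apply: (weak_topology (t := T)) => c Cc.
  rewrite (_ : A `&` c =
    \bigcup_(c' in [set c' | [/\ cell T c', c' `<=` c & ~ c' x]]) c').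
    apply: closed_bigcup => [|c' [Cc' _ _]]; last exact: cell_closed.
    by apply: sub_finite_set (faces_finite Cc) => c' [].
  apply/seteqP; split=> [z [[c1 [Cc1 c1x] c1z] cz]|z [c' [Cc' c'c c'x] c'z]].
    have [c' Cc' c'z] := relint_cover z.
    exists c'; last exact: c'z.1.
    split=> //; first exact: (cell_face Cc Cc' c'z cz).
    by move=> /(cell_face Cc1 Cc' c'z c1z).
  by split; [exists c'|exact: c'c].
have nAx : (~` A) x by move=> [c [_]].
have : nbhs x (~` A) by apply: open_nbhs_nbhs; split => //; exact: closed_openC.
move=> /nbhs_normP[d /= d0 hd]; exists d => // c y Cc cy yx.
apply: contrapT => ncx; apply: (hd y); first by rewrite /= distrC.
by exists c.
Qed.

End Cells.

(** * Sides of an edge *)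

Section DartGeometry.
Context {R : realType} {L : Type}.
Variable T : tiling R L.
Local Notation V := 'rV[R]_2.
Implicit Types (a b u v w x y z n : V) (s : R) (c e t : set V) (k : nat).

Definition left_of a b t := forall z, relint t z -> 0 < cross (b - a) (z - a).

Definition is_dart v w t :=
  [/\ kcell T 1 (seg v w), tile T t, seg v w `<=` t & left_of v w t].

Lemma edge_tile_disjoint e t y : kcell T 1 e -> tile T t -> e y -> ~ relint t y.
Proof.
move=> E Tt ey ty; have := cell_face E.1 Tt.1 ty ey.
by move=> /(polytope_le Tt.2 E.2).
Qed.

Lemma cross_flip a b z : cross (a - b) (z - b) = - cross (b - a) (z - a).
Proof. by rewrite /cross !mxE; ring. Qed.

Lemma cross_segment u x y s :
  cross u (x + s *: (y - x)) = cross u x + s * (cross u y - cross u x).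
Proof. by rewrite /cross !mxE; ring. Qed.

Lemma cross_shear u x s : cross u (x - s *: u) = cross u x.
Proof. by rewrite /cross !mxE; ring. Qed.

(** An interior point of the tile on the line of the edge would make the midpoint of the edge
    interior to the tile. *)
Lemma edge_side_neq0 a b t z : kcell T 1 (seg a b) -> tile T t -> seg a b `<=` t ->
  relint t z -> cross (b - a) (z - a) != 0.
Proof.
move=> E Tt et tz; apply/eqP => /cross_eq0[|s zE].
  by rewrite subr_eq0 eq_sym (edge_neq E).
have {}zE : z = a + s *: (b - a) by rewrite -zE subrKC.
have mid : seg a b (a + 2^-1 *: (b - a)) by exists 2^-1 => //; lra.
apply: (edge_tile_disjoint E Tt mid).
(* The midpoint lies between [z] and whichever end is on its other side: [a] in the first case, [b]
   in the second. *)
have [s2|s2] := leP (2^-1) s.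
  have s0 : 0 < s by lra.
  have -> : a + 2^-1 *: (b - a) = a + (2 * s)^-1 *: (z - a).
    have s_neq0 : s != 0 by rewrite gt_eqF.
    by rewrite zE; apply: vecP; rewrite !mxE; field.
  apply: (polytope_relint_segment Tt.2) => //; first by apply: et; exact: seg_l.
    by rewrite invr_gt0; lra.
  by rewrite invf_le1; lra.
have s0 : 0 < 1 - s by lra.
have -> : a + 2^-1 *: (b - a) = b + (2 * (1 - s))^-1 *: (z - b).
  have s_neq1 : 1 - s != 0 by rewrite gt_eqF.
  by rewrite zE; apply: vecP; rewrite !mxE; field.
apply: (polytope_relint_segment Tt.2) => //; first by apply: et; exact: seg_r.
  by rewrite invr_gt0; lra.
by rewrite invf_le1; lra.
Qed.

(** The interior of the tile is convex and misses the line, so interior points on both sides would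
    be joined by a segment with a zero of the affine function in between. *)
Lemma edge_side a b t : kcell T 1 (seg a b) -> tile T t -> seg a b `<=` t ->
  left_of a b t \/ left_of b a t.
Proof.
move=> E Tt et; have nz := edge_side_neq0 E Tt et.
have [[z1 tz1 z1_gt0]|no] :=
    pselect (exists2 z, relint t z & 0 < cross (b - a) (z - a)).
  left=> z2 tz2; rewrite lt_neqAle eq_sym nz //= leNgt; apply/negP => z2_lt0.
  set g1 := cross _ (z1 - _) in z1_gt0; set g2 := cross _ _ in z2_lt0.
  pose h := g1 / (g1 - g2).
  have tz : relint t (z1 + h *: (z2 - z1)).
    apply: (polytope_relint_segment Tt.2) => //; first exact: tz1.1.
      by rewrite divr_gt0 //; lra.
    by rewrite ler_pdivrMr; lra.
  have /eqP[] := nz _ tz.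
  have -> : z1 + h *: (z2 - z1) - a = (z1 - a) + h *: ((z2 - a) - (z1 - a)).
    by apply: vecP; rewrite !mxE; ring.
  have g_neq0 : g1 - g2 != 0 by rewrite gt_eqF; lra.
  by rewrite cross_segment -/g1 -/g2 /h; field.
right=> z tz; rewrite cross_flip oppr_gt0 lt_neqAle nz //= leNgt.
by apply/negP => z_gt0; apply: no; exists z.
Qed.

Lemma left_of_ge0 a b t y : tile T t -> left_of a b t -> t y ->
  0 <= cross (b - a) (y - a).
Proof.
move=> Tt lt ty; have [z tz] := relint_neq0 Tt.1; have z_gt0 := lt _ tz.
rewrite leNgt; apply/negP => y_lt0.
set gz := cross _ (z - _) in z_gt0; set gy := cross _ _ in y_lt0.
pose h := - gy / (gz - gy).
have : relint t (y + h *: (z - y)).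
  apply: (polytope_relint_segment Tt.2) => //.
    by rewrite divr_gt0 //; lra.
  by rewrite ler_pdivrMr; lra.
move/lt; have -> : y + h *: (z - y) - a = (y - a) + h *: ((z - a) - (y - a)).
  by apply: vecP; rewrite !mxE; ring.
have g_neq0 : gz - gy != 0 by rewrite gt_eqF; lra.
rewrite cross_segment -/gz -/gy (_ : _ + _ = 0) ?ltxx // /h.
by field.
Qed.

(** A point slightly to the left of the midpoint is put on a segment from some point of the edge to
    an interior point [z] of the tile. This gives uniqueness of the tile to the left of an edge. *)
Lemma left_tile_near a b t n : is_dart a b t -> 0 < cross (b - a) n ->
  exists2 d : R, 0 < d & forall s, 0 < s < d ->
    relint t (a + 2^-1 *: (b - a) + s *: n).
Proof.
move=> [E Tt et lt] n_gt0; have [z tz] := relint_neq0 Tt.1.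
set m := a + 2^-1 *: (b - a).
have gz : 0 < cross (b - a) (z - m).
  have -> : z - m = (z - a) - 2^-1 *: (b - a) by rewrite /m opprD addrA.
  by rewrite cross_shear; exact: lt.
set al := cross (z - m) n / cross (b - a) n.
set be := cross (b - a) (z - m) / cross (b - a) n.
have be_gt0 : 0 < be by rewrite divr_gt0.
have zE : z - m = al *: (b - a) + be *: n.
  by apply: cross_basis; rewrite gt_eqF.
(* The bound makes both [h] and [h * |al|] at most 1/4, so that [q] is at most 1/2 in absolute value
   and the starting point [m - q *: (b - a)] stays on the edge. *)
pose e0 : R := (4 * (`|al| + 1))^-1.
have al1 : 0 < 4 * (`|al| + 1) by rewrite mulr_gt0 // ltr_wpDl.
exists (be * e0); first by rewrite mulr_gt0 // invr_gt0.
move=> s /andP[s0 sd]; pose h := s / be.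
have h0 : 0 < h by rewrite divr_gt0.
have hd : h < e0 by rewrite ltr_pdivrMr // mulrC.
have h4 : h * (4 * (`|al| + 1)) < 1 by rewrite -ltr_pdivlMr // mul1r.
have al_ge0 := normr_ge0 al.
have h_le : h <= 4^-1 by nra.
have hal : h * `|al| <= 4^-1 by nra.
have {}hal : `|h * al| <= 4^-1 by rewrite normrM gtr0_norm.
pose q := h * al / (1 - h).
have h1 : 0 < 1 - h by lra.
have q_le : `|q| <= 2^-1.
  rewrite normrM (gtr0_norm (x := (1 - h)^-1)) ?invr_gt0 // ler_pdivrMr //.
  by apply: (le_trans hal); lra.
have -> : m + s *: n = (m - q *: (b - a)) + h *: (z - (m - q *: (b - a))).
  have -> : z - (m - q *: (b - a)) = al *: (b - a) + be *: n + q *: (b - a).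
    by rewrite opprB addrA [z + _]addrC -addrA zE addrC.
  have -> : s = h * be by rewrite /h divfK // gt_eqF.
  have : q * (1 - h) = h * al by rewrite /q divfK // gt_eqF.
  move=> qE; apply/eqP; rewrite -subr_eq0.
  have -> : m + (h * be) *: n - (m - q *: (b - a) + h *: (al *: (b - a) +
      be *: n + q *: (b - a))) = (q * (1 - h) - h * al) *: (b - a).
    by apply: vecP; rewrite !mxE; ring.
  by rewrite qE subrr scale0r.
apply: (polytope_relint_segment Tt.2) => //; last by lra.
apply: et; exists (2^-1 - q).
  by move: q_le; rewrite ler_norml; lra.
by rewrite /m scalerBl addrA.
Qed.

Lemma left_tile_uniq a b t t' : is_dart a b t -> is_dart a b t' -> t = t'.
Proof.
move=> dt dt'; have [E Tt _ _] := dt; have [_ Tt' _ _] := dt'.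
have n_gt0 : 0 < cross (b - a) (perp (b - a)).
  by apply: cross_perp_gt0; rewrite subr_eq0 eq_sym; exact: edge_neq E.
have [d d0 hd] := left_tile_near dt n_gt0.
have [d' d'0 hd'] := left_tile_near dt' n_gt0.
pose s := Num.min d d' / 2.
have m0 : 0 < Num.min d d' by rewrite lt_min d0.
have s0 : 0 < s by rewrite divr_gt0.
have sm : s < Num.min d d' by rewrite ltr_pdivrMr // ltr_pMr // ltr1n.
move: sm; rewrite lt_min => /andP[sd sd'].
apply: (relint_uniq Tt.1 Tt'.1 (hd s _) (hd' s _)); by rewrite s0.
Qed.

(** The cell whose relative interior contains a point just left of the midpoint also contains the
    midpoint, hence the edge; it is larger than the edge because that point is off the line. *)
Lemma left_tile_exists a b : kcell T 1 (seg a b) -> exists t, is_dart a b t.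
Proof.
move=> E; have ab := edge_neq E; pose n := perp (b - a).
have n_gt0 : 0 < cross (b - a) n.
  by apply: cross_perp_gt0; rewrite subr_eq0 eq_sym.
set m := a + 2^-1 *: (b - a).
have mE : relint (seg a b) m by apply/(relint_seg _ ab); exists 2^-1 => //; lra.
have [d d0 hd] := local_cells T m.
have n1 : 0 < 1 + `|n| by rewrite ltr_wpDr.
pose s := d / (1 + `|n|) / 2.
have s0 : 0 < s by rewrite !divr_gt0.
have [c Cc cz] := relint_cover T (m + s *: n).
have cm : c m.
  apply: (hd c (m + s *: n)) => //; first exact: cz.1.
  rewrite [m + _]addrC addrK normrZ gtr0_norm //.
  apply: (@le_lt_trans _ _ (s * (1 + `|n|))); first by rewrite ler_pM2l // lerDr.
  by rewrite /s mulrAC divfK ?gt_eqF // ltr_pdivrMr // ltr_pMr // ltr1n.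
have Ec : seg a b `<=` c := cell_face Cc E.1 mE cm.
have gE : cross (b - a) (m + s *: n - a) = s * cross (b - a) n.
  have -> : m + s *: n - a = s *: n - (- 2^-1) *: (b - a).
    by apply: vecP; rewrite !mxE; ring.
  by rewrite cross_shear crossZr.
have g_gt0 : 0 < cross (b - a) (m + s *: n - a) by rewrite gE mulr_gt0.
have Tc : tile T c.
  case: (kcell_cases Cc) => // K; first by have := polytope_le E.2 K.2 Ec.
  have [x [y cE]] := edgeP K; move: K cm Ec; rewrite cE => K cm Ec.
  have sub_end p : cell T [set p] -> m = p -> False.
    move=> Cp mp; have Cp' := set1_kcell Cp.
    have pE : [set p] = seg a b.
      apply: (relint_uniq Cp E.1 _ mE); rewrite mp; exact: relint_set1.
    by move: Cp'; rewrite pE => /(kcell_inj E).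
  have [] := edge_relint K cm.
  - by move/(sub_end _ (edge_end K)).
  - by move/(sub_end _ (edge_end_r K)).
  move=> mc; have ee := relint_uniq K.1 E.1 mc mE.
  move: cz; rewrite cE ee => -[[q _ zE] _].
  move: g_gt0; rewrite zE [a + _]addrC addrK.
  by rewrite crossZr crossvv mulr0 ltxx.
exists c; split => //; have [//|lft] := edge_side E Tc Ec.
have := lft _ cz; rewrite cross_flip oppr_gt0 => neg.
by have := lt_trans g_gt0 neg; rewrite ltxx.
Qed.

Lemma edge_parallel v w w' s : kcell T 1 (seg v w) -> kcell T 1 (seg v w') ->
  0 < s -> w' - v = s *: (w - v) -> w = w'.
Proof.
move=> E E' s0 ww'; have vw := edge_neq E; have vw' := edge_neq E'.
apply: (seg_inj_r vw).
pose m := Num.min 1 s / 2.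
have m0 : 0 < m by rewrite divr_gt0 // lt_min ltr01 s0.
have m1 : m < 1 by rewrite ltr_pdivrMr // mul1r gt_min ltr1n.
have ms : m < s.
  by rewrite ltr_pdivrMr // gt_min; apply/orP; right; rewrite ltr_pMr // ltr1n.
apply: (relint_uniq E.1 E'.1 (x := v + m *: (w - v))).
  by apply/(relint_seg _ vw); exists m => //; rewrite m0.
apply/(relint_seg _ vw'); exists (m / s).
  by rewrite divr_gt0 //= ltr_pdivrMr // mul1r.
by rewrite ww' scalerA divfK // gt_eqF.
Qed.

(** Each of the two edges lies to the left of the other, so they are parallel; an interior point of
    the tile to the left of both shows that they point the same way. *)
Lemma out_uniq v w w' t : is_dart v w t -> is_dart v w' t -> w = w'.
Proof.
move=> [E Tt et lt] [E' _ et' lt'].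
have vw : w - v != 0 by rewrite subr_eq0 eq_sym (edge_neq E).
have h : 0 <= cross (w - v) (w' - v) by apply: left_of_ge0 lt (et' _ _); [|exact: seg_r].
have h' : 0 <= cross (w' - v) (w - v) by apply: left_of_ge0 lt' (et _ _); [|exact: seg_r].
have /cross_eq0[//|s ww'] : cross (w - v) (w' - v) = 0 by move: h'; rewrite crossC; lra.
have [z tz] := relint_neq0 Tt.1.
have := lt' _ tz; rewrite ww' crossZl pmulr_lgt0; last exact: lt.
by move=> s0; exact: edge_parallel ww'.
Qed.

Lemma in_uniq u u' v t : is_dart u v t -> is_dart u' v t -> u = u'.
Proof.
move=> [E Tt et lt] [E' _ et' lt'].
have vu : u - v != 0 by rewrite subr_eq0 (edge_neq E).
have h : 0 <= - cross (u - v) (u' - v).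
  by rewrite -cross_flip; apply: left_of_ge0 lt (et' _ _); [|exact: seg_l].
have h' : 0 <= - cross (u' - v) (u - v).
  by rewrite -cross_flip; apply: left_of_ge0 lt' (et _ _); [|exact: seg_l].
have /cross_eq0[//|s uu'] : cross (u - v) (u' - v) = 0 by move: h'; rewrite crossC; lra.
have [z tz] := relint_neq0 Tt.1.
have := lt _ tz; have := lt' _ tz; rewrite cross_flip [X in _ -> 0 < X -> _]cross_flip.
rewrite uu' crossZl -mulrN => + q; rewrite pmulr_lgt0 // => s0.
by apply: edge_parallel s0 uu'; rewrite segC.
Qed.

End DartGeometry.

(** * Corners of a tile *)

Section Corners.
Context {R : realType} {L : Type}.
Variable T : tiling R L.
Local Notation V := 'rV[R]_2.
Implicit Types (a b u v w x y z n : V) (s : R) (c e t : set V) (k : nat).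

Lemma closed_ball_sep (A : set V) x : closed A -> ~ A x ->
  exists2 d : R, 0 < d & forall y, `|y - x| < d -> ~ A y.
Proof.
move=> Acl Ax; have : nbhs x (~` A).
  by apply: open_nbhs_nbhs; split => //; exact: closed_openC.
move=> /nbhs_normP[d /= d0 hd]; exists d => // y yx.
by apply: hd; rewrite /= distrC.
Qed.

(** The parameter is the supremum of those whose points lie in the tile: it is attained as the tile
    is closed, and an interior point could be pushed further. *)
Lemma exit_point t x y : tile T t -> relint t x -> ~ t y ->
  exists2 s, 0 < s < 1 & t (x + s *: (y - x)) /\ ~ relint t (x + s *: (y - x)).
Proof.
move=> Tt tx ty; have tcl := cell_closed Tt.1.
have xy : 0 < `|y - x|.
  by rewrite normr_gt0 subr_eq0; apply/eqP => yx; apply: ty; rewrite yx; exact: tx.1.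
pose S : set R := [set s | 0 <= s <= 1 /\ t (x + s *: (y - x))].
have S0 : S 0 by split; [lra|rewrite scale0r addr0; exact: tx.1].
have supS : has_sup S.
  by split; [exists 0|exists 1 => s [/andP[]]].
have S_le s : S s -> s <= sup S by move=> Ss; apply: (sup_upper_bound supS).
have sup_le : sup S <= 1 by apply: ge_sup; [exists 0|move=> s [/andP[]]].
have sup_ge : 0 <= sup S by exact: S_le.
have dist s s' : (x + s *: (y - x)) - (x + s' *: (y - x)) = (s - s') *: (y - x).
  by rewrite opprD addrACA subrr add0r -scalerBl.
have tsup : t (x + sup S *: (y - x)).
  apply: contrapT => /(closed_ball_sep tcl)[d d0 hd].
  have [|s Ss sd] := sup_adherent (E := S) (eps := d / `|y - x|) _ supS.
    by rewrite divr_gt0.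
  apply: (hd _ _ Ss.2); rewrite dist normrZ -ltr_pdivlMr //.
  by have := S_le _ Ss; rewrite ltr_norml; lra.
have sup_lt1 : sup S < 1.
  rewrite lt_neqAle sup_le andbT; apply/eqP => s1; apply: ty.
  by move: tsup; rewrite s1 scale1r subrKC.
have push s : 0 <= s < 1 -> relint t (x + s *: (y - x)) ->
    exists2 s', s < s' <= 1 & t (x + s' *: (y - x)).
  move=> /andP[s0 s1] /(relint_tile _ Tt.2)[d d0 hd].
  have m0 : 0 < Num.min (d / `|y - x|) (1 - s).
    by rewrite lt_min divr_gt0 //= subr_gt0.
  have m1 : Num.min (d / `|y - x|) (1 - s) <= 1 - s by rewrite ge_min lexx orbT.
  have m2 : Num.min (d / `|y - x|) (1 - s) <= d / `|y - x| by rewrite ge_min lexx.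
  exists (s + Num.min (d / `|y - x|) (1 - s) / 2); first by lra.
  apply: hd; rewrite dist normrZ -ltr_pdivlMr // [s + _]addrC addrK.
  by rewrite gtr0_norm; lra.
have sup_gt0 : 0 < sup S.
  have [||s /andP[s0 s1] ts] := push 0; first by rewrite lexx ltr01.
    by rewrite scale0r addr0.
  by apply: (lt_le_trans s0); apply: S_le; split; [lra|].
exists (sup S); first by rewrite sup_gt0.
split=> // rs; have [|s /andP[s0 s1] ts] := push _ _ rs; first by rewrite sup_ge.
have : s <= sup S by apply: S_le; split; [lra|].
by move/(lt_le_trans s0); rewrite ltxx.
Qed.

Lemma boundary_point t y : tile T t -> t y -> ~ relint t y ->
  exists c, [/\ cell T c, relint c y, c `<=` t & ~ tile T c].
Proof.
move=> Tt ty nty; have [c Cc cy] := relint_cover T y.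
have ct := cell_face Tt.1 Cc cy ty.
exists c; split=> // Tc; apply: nty; apply/(relint_tile _ Tt.2).
have [d d0 hd] := (relint_tile _ Tc.2).1 cy; exists d => // z /hd; exact: ct.
Qed.

Lemma vertex_of_edge v e : kcell T 1 e -> cell T [set v] -> e v ->
  exists w, e = seg v w.
Proof.
move=> E Cv; have [a [b eE]] := edgeP E; move: E; rewrite eE => E ev.
have [->|->|rv] := edge_relint E ev.
- by exists b.
- by exists a; rewrite segC.
have := relint_uniq Cv E.1 (relint_set1 v) rv => vE.
by have := set1_kcell Cv; rewrite vE => /(kcell_inj E).
Qed.

Lemma vertex_not_interior v t : cell T [set v] -> tile T t -> ~ relint t v.
Proof.
move=> Cv Tt tv; have vt := relint_uniq Cv Tt.1 (relint_set1 v) tv.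
by have := set1_kcell Cv; rewrite vt => /(kcell_inj Tt).
Qed.

(** Near [v], walk from a point of the tile in direction [z - v] to a point just beside the opposite
    ray, displaced towards [n]. The exit from the tile is close to [v] and strictly on the side of
    [n], so it lies on a boundary edge that ends at [v]. *)
Lemma corner_edge v t z n : cell T [set v] -> tile T t -> t v -> relint t z ->
  cross n (z - v) != 0 ->
  exists w, [/\ kcell T 1 (seg v w), seg v w `<=` t
    & 0 < cross (w - v) (z - v) * cross n (z - v)].
Proof.
move=> Cv Tt tv tz nz; set d0 := z - v in nz *.
(* Otherwise [v] would lie strictly between a point of the tile and an interior point, hence be
   interior. *)
have opposite s : 0 < s -> ~ t (v - s *: d0).
  move=> s0 ts; apply: (vertex_not_interior Cv Tt).
  have s1 : 1 + s != 0 by rewrite gt_eqF // ltr_wpDl.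
  have -> : v = (v - s *: d0) + (s / (1 + s)) *: (z - (v - s *: d0)).
    rewrite /d0; apply: vecP; rewrite !mxE; field; exact: s1.
  apply: (polytope_relint_segment Tt.2) => //; first by rewrite divr_gt0 //; lra.
  by rewrite ler_pdivrMr; lra.
have [d d_gt0 hd] := local_cells T v.
have N0 : 0 < 1 + `|d0| by rewrite ltr_wpDr.
pose h := Num.min 1 (d / (1 + `|d0|) / 2).
have h0 : 0 < h by rewrite lt_min ltr01 !divr_gt0.
have h1 : h <= 1 by rewrite ge_min lexx.
have hd0 : h * `|d0| < d / 2.
  apply: (@lt_le_trans _ _ (h * (1 + `|d0|))); first by rewrite ltr_pM2l // ltrDr.
  apply: (@le_trans _ _ (d / (1 + `|d0|) / 2 * (1 + `|d0|))).
    by rewrite ler_pM2r // ge_min lexx orbT.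
  by rewrite -mulrA [2^-1 * _]mulrC mulrA divfK // gt_eqF.
have z1 : relint t (v + h *: d0) by apply: (polytope_relint_segment Tt.2).
have [r r_gt0 hr] := closed_ball_sep (cell_closed Tt.1) (opposite _ h0).
have N1 : 0 < 1 + `|n| by rewrite ltr_wpDr.
(* The bound [r] keeps the end of the walk outside the tile, and [d / 2], with the same bound on
   [h *: d0], keeps the walk within the distance [d] of [v]. *)
pose q := Num.min r (d / 2) / (1 + `|n|).
have q0 : 0 < q by rewrite divr_gt0 // lt_min r_gt0 divr_gt0.
have qn : q * `|n| < Num.min r (d / 2).
  apply: (@lt_le_trans _ _ (q * (1 + `|n|))); first by rewrite ltr_pM2l // ltrDr.
  by rewrite divfK // gt_eqF.
have z2 : ~ t (v - h *: d0 + q *: n).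
  apply: hr; rewrite [_ + q *: n]addrC addrK normrZ gtr0_norm //.
  by apply: (lt_le_trans qn); rewrite ge_min lexx.
have [s s01 []] := exit_point Tt z1 z2.
have -> : v + h *: d0 + s *: (v - h *: d0 + q *: n - (v + h *: d0)) =
    v + ((h * (1 - 2 * s)) *: d0 + (s * q) *: n).
  by apply: vecP; rewrite !mxE; ring.
set y := v + _ => ty nty.
have yd : `|y - v| < d.
  rewrite /y [v + _]addrC addrK; apply: le_lt_trans (ler_normD _ _) _.
  have s0 : 0 < s by lra.
  have s1 : s <= 1 by lra.
  have hd0_ge0 : 0 <= h * `|d0| by rewrite mulr_ge0 // ltW.
  rewrite (normrZ (h * (1 - 2 * s)) d0) (normrZ (s * q) n).
  rewrite (normrM h) (gtr0_norm h0) (gtr0_norm (mulr_gt0 s0 q0)).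
  have p1 : h * `|1 - 2 * s| * `|d0| <= h * `|d0|.
    by rewrite mulrAC ler_piMr // ler_norml; lra.
  have p2 : s * q * `|n| <= q * `|n|.
    by rewrite -mulrA ler_piMl // mulr_ge0 // ltW.
  have : q * `|n| < d / 2 by apply: (lt_le_trans qn); rewrite ge_min lexx orbT.
  by lra.
have [c [Cc cy ct nTc]] := boundary_point Tt ty nty.
have cv : c v by apply: hd yd; [|exact: cy.1].
have gy : cross (y - v) d0 = s * q * cross n d0.
  by rewrite /y [v + _]addrC addrK crossDl !crossZl crossvv mulr0 add0r.
have sq : 0 < s * q by rewrite mulr_gt0 //; lra.
have [K|E|//] := kcell_cases Cc.
  have [p cE] := vertexP K; move: cv cy; rewrite cE /= => vp [/= yp _].
  move: gy; rewrite (_ : y - v = 0 *: d0); last by rewrite yp vp subrr scale0r.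
  by rewrite crossZl mul0r => /esym/eqP; rewrite mulf_eq0 (gt_eqF sq) (negbTE nz).
have [w cE] := vertex_of_edge E Cv cv.
rewrite cE in E cy ct; exists w; split=> //.
have [l /andP[l0 l1] yE] := cy.1.
move: gy; rewrite yE [v + _]addrC addrK crossZl => gy.
have n2 : 0 < cross n d0 * cross n d0 by rewrite -expr2 exprn_even_gt0.
have : 0 < l * (cross (w - v) d0 * cross n d0) by rewrite mulrA gy -mulrA mulr_gt0.
move=> lp; move: l0; rewrite le_eqVlt => /predU1P[l0|l0].
  by move: lp; rewrite -l0 mul0r ltxx.
by rewrite -(pmulr_rgt0 _ l0).
Qed.

Lemma tile_neq_vertex v t : cell T [set v] -> tile T t -> exists2 z, relint t z & z - v != 0.
Proof.
move=> Cv Tt; have [z tz] := relint_neq0 Tt.1; exists z => //.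
rewrite subr_eq0; apply/eqP => zv; apply: (vertex_not_interior Cv Tt).
by rewrite -zv.
Qed.

Lemma out_exists v t : cell T [set v] -> tile T t -> t v -> exists w, is_dart T v w t.
Proof.
move=> Cv Tt tv; have [z tz zv] := tile_neq_vertex Cv Tt.
have p := cross_perp_gt0 zv.
have [|w [E wt]] := corner_edge (n := - perp (z - v)) Cv Tt tv tz.
  by rewrite crossNl -crossC gt_eqF.
rewrite [cross (- _) _]crossNl -crossC pmulr_lgt0 // => h.
exists w; split=> //; have [//|lft] := edge_side E Tt wt.
have := lft _ tz; rewrite cross_flip oppr_gt0 => neg.
by have := lt_trans h neg; rewrite ltxx.
Qed.

Lemma in_exists v t : cell T [set v] -> tile T t -> t v -> exists u, is_dart T u v t.
Proof.
move=> Cv Tt tv; have [z tz zv] := tile_neq_vertex Cv Tt.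
have p := cross_perp_gt0 zv.
have [|u [E ut]] := corner_edge (n := perp (z - v)) Cv Tt tv tz.
  by rewrite crossC oppr_eq0 gt_eqF.
rewrite [cross (perp _) _]crossC mulrN oppr_gt0 pmulr_llt0 // => h.
exists u; split=> //; rewrite 1?segC //; have [|//] := edge_side E Tt ut.
by move=> /(_ _ tz) neg; have := lt_trans h neg; rewrite ltxx.
Qed.

End Corners.

(** * Propagation of labels over a finite closed cover of a segment or a punctured disc *)

Section Connectivity.
Context {R : realType}.
Local Notation V := 'rV[R]_2.
Implicit Types (p q u v x y z : V) (s : R).

Lemma closed_halfplane u x : closed [set z | 0 <= cross u (z - x)].
Proof.
apply: (@preimage_closed _ _ (fun z => cross u (z - x)) [set r | 0 <= r]).
  move=> z _.
  have -> : (fun z => cross u (z - x)) =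
      (fun z => u 0 0 * (z 0 1 - x 0 1) - u 0 1 * (z 0 0 - x 0 0)).
    by apply/funext => y; rewrite /cross !mxE.
  have cj j : (fun z : V => z 0 j - x 0 j) @ z --> z 0 j - x 0 j.
    by apply: (@cvgB _ _ _ (nbhs z)); [exact: coord_continuous|exact: cvg_cst].
  apply: (@cvgB _ _ _ (nbhs z)).
    by apply: (@cvgM _ _ (nbhs z)) (cj 1); exact: cvg_cst.
  by apply: (@cvgM _ _ (nbhs z)) (cj 0); exact: cvg_cst.
exact: closed_ge.
Qed.

Section Labels.
Variables (I : choiceType) (S : set I) (F : I -> set V) (lab : I -> Prop).
Hypothesis Sfin : finite_set S.
Hypothesis Fcl : forall i, S i -> closed (F i).

(** The parts of the segment covered by labelled and by unlabelled sets are closed and disjoint, so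
    connectedness leaves only one of them. *)
Lemma segment_labels x y :
    (forall s, 0 <= s <= 1 -> exists2 i, S i & F i (x + s *: (y - x))) ->
    (forall s i j, 0 <= s <= 1 -> S i -> S j -> F i (x + s *: (y - x)) ->
       F j (x + s *: (y - x)) -> lab i -> lab j) ->
  forall i j, S i -> S j -> F i x -> F j y -> lab i -> lab j.
Proof.
move=> cov ov i j Si Sj ix jy li.
pose z s := x + s *: (y - x).
have zcont : continuous z.
  move=> s; apply: (@cvgD _ _ _ (nbhs s)); first exact: cvg_cst.
  exact: scalel_continuous.
pose A b : set V := \bigcup_(i in [set i | S i /\ (lab i <-> b)]) F i.
have Acl b : closed (A b).
  apply: closed_bigcup => [|k [Sk _]]; last exact: Fcl.
  by apply: sub_finite_set Sfin => k [].
have z0 : z 0 = x by rewrite /z scale0r addr0.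
have z1 : z 1 = y by rewrite /z scale1r subrKC.
have AF s : 0 <= s <= 1 -> A True (z s) -> A False (z s) -> False.
  move=> s01 [k [Sk [_ lk]] kz] [l [Sl [ll _]] lz].
  by apply: ll; apply: ov s01 Sk Sl kz lz (lk Logic.I).
have in01 s : `[0, 1]%classic s -> 0 <= s <= 1 by rewrite /= in_itv.
have cont01 (b : Prop) : closed (z @^-1` A b).
  by apply: preimage_closed => // s _; exact: zcont.
have E : `[0, 1]%classic `&` (z @^-1` A True) = `[0, 1]%classic.
  apply: (@segment_connected R 0 1).
- exists 0; split; first by rewrite /= in_itv /= lexx ler01.
  by rewrite /= z0; exists i.
- exists (~` (z @^-1` A False)); first exact: closed_openC.
  apply/seteqP; split=> s [s01 sA]; split=> //.
    by move=> nA; exact: AF (in01 _ s01) sA nA.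
  have [k Sk kz] := cov s (in01 _ s01).
  have [lk|nlk] := pselect (lab k); first by exists k.
  by exfalso; apply: sA; exists k => //; split=> //; split.
- by exists (z @^-1` A True).
have : (`[0, 1]%classic `&` (z @^-1` A True)) 1.
  by rewrite E /= in_itv /= lexx ler01.
move=> [_ /= [k [Sk [_ lk]]]]; rewrite z1 => ky.
by apply: (ov 1 k j) (lk Logic.I); rewrite -/(z 1) ?z1 ?ler01 ?lexx.
Qed.

(** Two points of the punctured disc in independent directions from [v] are joined by a segment that
    avoids [v]; in dependent directions, a detour through a perpendicular point is taken. *)
Lemma around_labels v (d : R) :
    (forall p, p != v -> `|p - v| < d -> exists2 i, S i & F i p) ->
    (forall p i j, p != v -> `|p - v| < d -> S i -> S j -> F i p -> F j p ->
       lab i -> lab j) ->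
  forall p q i j, p != v -> `|p - v| < d -> q != v -> `|q - v| < d ->
    S i -> S j -> F i p -> F j q -> lab i -> lab j.
Proof.
move=> cov ov.
have base p q i j : cross (p - v) (q - v) != 0 -> `|p - v| < d -> `|q - v| < d ->
    S i -> S j -> F i p -> F j q -> lab i -> lab j.
  move=> pq pd qd; have pt s : 0 <= s <= 1 ->
      p + s *: (q - p) != v /\ `|p + s *: (q - p) - v| < d.
    move=> /andP[s0 s1]; split.
      apply: contraNN pq => /eqP E.
      have pv : p - v = (- s) *: (q - p) by rewrite -E opprD addrA subrr sub0r scaleNr.
      have qv : q - v = (1 - s) *: (q - p).
        by rewrite -[in LHS]E; apply: vecP; rewrite !mxE; ring.
      by rewrite pv qv crossZl crossZr crossvv !mulr0.
    have -> : p + s *: (q - p) - v = (1 - s) *: (p - v) + s *: (q - v).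
      by apply: vecP; rewrite !mxE; ring.
    apply: le_lt_trans (ler_normD _ _) _; rewrite !normrZ ger0_norm ?subr_ge0 //.
    rewrite (ger0_norm s0); move: s1; rewrite le_eqVlt => /predU1P[->|s1].
      by rewrite subrr mul0r add0r mul1r.
    rewrite [X in _ < X](_ : d = (1 - s) * d + s * d); last by ring.
    by apply: ltr_leD; [rewrite ltr_pM2l // subr_gt0|rewrite ler_wpM2l // ltW].
  apply: segment_labels => [s s01|s k l s01 Sk Sl kp lp].
    by have [pv pd'] := pt s s01; exact: cov.
  by have [pv pd'] := pt s s01; exact: ov lp.
move=> p q i j pv pd qv qd Si Sj ip jq li.
have [pq|] := eqVneq (cross (p - v) (q - v)) 0; last by move=> pq; exact: base ip jq li.
have pv0 : p - v != 0 by rewrite subr_eq0.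
have [l qE] := cross_eq0 pv0 pq.
have l0 : l != 0 by apply: contraNneq qv => l0; rewrite -subr_eq0 qE l0 scale0r.
have per := cross_perp_gt0 pv0; set n := perp _ in per.
have d0 : 0 < d by apply: le_lt_trans pd.
have N0 : 0 < 1 + `|n| by rewrite ltr_wpDr.
pose h := d / (1 + `|n|); have h0 : 0 < h by rewrite divr_gt0.
pose r := v + h *: n.
have rv : r - v = h *: n by rewrite /r [v + _]addrC addrK.
have rd : `|r - v| < d.
  rewrite rv normrZ gtr0_norm //; apply: (@lt_le_trans _ _ (h * (1 + `|n|))).
    by rewrite ltr_pM2l // ltrDr.
  by rewrite /h divfK // gt_eqF.
have [|k Sk kr] := cov r _ rd.
  apply: contraTneq per => rE; move: rv; rewrite rE subrr => /esym/eqP.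
  rewrite scaler_eq0 (gt_eqF h0) /= => /eqP ->.
  by rewrite /cross !mxE !mulr0 subrr ltxx.
apply: (base r q k j) => //.
  have nz : cross n (p - v) != 0 by rewrite crossC oppr_eq0 gt_eqF.
  by rewrite rv qE crossZl crossZr !mulf_neq0 // gt_eqF.
apply: (base p r i k) => //.
by rewrite rv crossZr mulf_neq0 ?gt_eqF.
Qed.

End Labels.
End Connectivity.

(** * Darts *)

Section Darts.
Context {R : realType} {L : Type}.
Variable T : tiling R L.
Local Notation V := 'rV[R]_2.

Record dart := Dart {
  tail : V; head : V; side : set V;
  dartP : is_dart T tail head side }.

HB.instance Definition _ := gen_eqMixin dart.
HB.instance Definition _ := gen_choiceMixin dart.

Implicit Types (x y z : dart) (u v w p q : V) (t c : set V).

Lemma dart_eq x y : tail x = tail y -> head x = head y -> side x = side y -> x = y.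
Proof.
case: x y => [v w t P] [v' w' t' P'] /= vv ww tt; subst v' w' t'.
by rewrite (Prop_irrelevance P P').
Qed.

Definition edge x := seg (tail x) (head x).

Lemma dart_edge x : kcell T 1 (edge x). Proof. by have [] := dartP x. Qed.

Lemma dart_tile x : tile T (side x). Proof. by have [] := dartP x. Qed.

Lemma edge_side_sub x : edge x `<=` side x. Proof. by have [] := dartP x. Qed.

Lemma dart_neq x : tail x != head x. Proof. exact: edge_neq (dart_edge x). Qed.

Lemma dart_tail x : cell T [set tail x].
Proof. exact: edge_end (dart_edge x). Qed.

Lemma dart_head x : cell T [set head x].
Proof. exact: edge_end_r (dart_edge x). Qed.

Lemma tail_edge x : edge x (tail x). Proof. exact: seg_l. Qed.

Lemma head_edge x : edge x (head x). Proof. exact: seg_r. Qed.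

Lemma tail_side x : side x (tail x).
Proof. exact/edge_side_sub/tail_edge. Qed.

(** This and the next two lemmas show that any two components determine a dart: the tile to the left
    is unique, and at a corner of a tile one edge leaves and one arrives. *)
Lemma dart_eq_edge x y : tail x = tail y -> head x = head y -> x = y.
Proof.
move=> vv ww; apply: dart_eq => //; have := dartP x; rewrite vv ww => dx.
exact: left_tile_uniq dx (dartP y).
Qed.

Lemma dart_eq_tail x y : tail x = tail y -> side x = side y -> x = y.
Proof.
move=> vv tt; apply: dart_eq => //; have := dartP x; rewrite vv tt => dx.
exact: out_uniq dx (dartP y).
Qed.

Lemma dart_eq_head x y : head x = head y -> side x = side y -> x = y.
Proof.
move=> ww tt; apply: dart_eq => //; have := dartP x; rewrite ww tt => dx.
exact: in_uniq dx (dartP y).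
Qed.

Lemma corner_dart v t : cell T [set v] -> tile T t -> t v ->
  exists x, tail x = v /\ side x = t.
Proof. by move=> Cv Tt tv; have [w d] := out_exists Cv Tt tv; exists (Dart d). Qed.

Lemma edge_dart v w : kcell T 1 (seg v w) -> exists x, tail x = v /\ head x = w.
Proof. by move=> E; have [t d] := left_tile_exists E; exists (Dart d). Qed.

Lemma flip_exists x : exists y, tail y = head x /\ head y = tail x.
Proof. by apply: edge_dart; rewrite segC; exact: dart_edge. Qed.

Definition flip x := projT1 (cid (flip_exists x)).

Lemma tail_flip x : tail (flip x) = head x.
Proof. by rewrite /flip; case: cid => y []. Qed.

Lemma head_flip x : head (flip x) = tail x.
Proof. by rewrite /flip; case: cid => y []. Qed.

Lemma edge_flip x : edge (flip x) = edge x.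
Proof. by rewrite /edge tail_flip head_flip segC. Qed.

Lemma flipK : involutive flip.
Proof. by move=> x; apply: dart_eq_edge; rewrite ?(tail_flip, head_flip). Qed.

Lemma flip_neq x : flip x <> x.
Proof.
by move=> /(congr1 tail); rewrite tail_flip => /esym/eqP; rewrite (negbTE (dart_neq x)).
Qed.

Lemma prev_exists x : exists y, head y = tail x /\ side y = side x.
Proof.
have [u d] := in_exists (dart_tail x) (dart_tile x) (@tail_side x).
by exists (Dart d).
Qed.

Definition prev x := projT1 (cid (prev_exists x)).

Lemma head_prev x : head (prev x) = tail x.
Proof. by rewrite /prev; case: cid => y []. Qed.

Lemma side_prev x : side (prev x) = side x.
Proof. by rewrite /prev; case: cid => y []. Qed.

Lemma prev_uniq x y : head y = tail x -> side y = side x -> y = prev x.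
Proof. by move=> h s; apply: dart_eq_head; rewrite ?head_prev ?side_prev. Qed.

Definition turn x := flip (prev x).

Lemma tail_turn x : tail (turn x) = tail x.
Proof. by rewrite /turn tail_flip head_prev. Qed.

Lemma prev_inj : injective prev.
Proof.
move=> x y xy; apply: dart_eq_tail.
  by rewrite -[LHS]head_prev xy head_prev.
by rewrite -[LHS]side_prev xy side_prev.
Qed.

Lemma flip_inj : injective flip. Proof. exact: inv_inj flipK. Qed.

Lemma turn_inj : injective turn. Proof. by move=> x y /flip_inj/prev_inj. Qed.

Lemma tail_iter_turn n x : tail (iter n turn x) = tail x.
Proof. by elim: n => // n IH; rewrite iterS tail_turn. Qed.

Lemma side_iter_prev n x : side (iter n prev x) = side x.
Proof. by elim: n => // n IH; rewrite iterS side_prev. Qed.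

Lemma dart_tail_side_inj : injective (fun x => (tail x, side x)).
Proof. by move=> x y [vv tt]; exact: dart_eq_tail. Qed.

Lemma darts_at_finite v : finite_set [set x | tail x = v].
Proof.
have fin := finite_setX (finite_set1 v) (star_finite T v).
have inj : {in (fun x => (tail x, side x)) @^-1`
    ([set v] `*` [set c | cell T c /\ c v]) &,
    injective (fun x => (tail x, side x))}.
  by move=> x y _ _; exact: dart_tail_side_inj.
apply: sub_finite_set (finite_preimage inj fin) => x /= <-.
by split=> //; split; [exact: (dart_tile x).1|exact: tail_side].
Qed.

Lemma darts_on_finite t : finite_set [set x | side x = t].
Proof.
have [Tt|nTt] := pselect (tile T t); last first.
  rewrite (_ : [set x | _] = set0); first exact: finite_set0.
  by apply/seteqP; split=> // x /= xt; apply: nTt; rewrite -xt; exact: dart_tile.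
have fin : finite_set (set1 @^-1` [set c | cell T c /\ c `<=` t] : set V).
  apply: finite_preimage (faces_finite Tt.1) => u v _ _ /seteqP[/(_ u erefl)]; exact.
have inj : {in (fun x => (tail x, side x)) @^-1`
    ((set1 @^-1` [set c | cell T c /\ c `<=` t] : set V) `*` [set t]) &,
    injective (fun x => (tail x, side x))}.
  by move=> x y _ _; exact: dart_tail_side_inj.
apply: sub_finite_set (finite_preimage inj (finite_setX fin (finite_set1 t))) => x /= <-.
split=> //; split; first exact: dart_tail.
by move=> _ ->; exact: tail_side.
Qed.

End Darts.

Lemma periodic_of_finite (D : Type) (s : D -> D) (P : set D) x :
  injective s -> finite_set P -> (forall n, P (iter n s x)) ->
  exists2 n, (0 < n)%N & iter n s x = x.
Proof.
move=> sI Pfin Px; apply: contrapT => per.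
have inj : injective (fun n => iter n s x).
  have lt m n : (m < n)%N -> iter m s x <> iter n s x.
    move=> mn E; apply: per; exists (n - m)%N; first by rewrite subn_gt0.
    have itI k : injective (iter k s) by elim: k => // k IH a b /= /sI/IH.
    by apply: (itI m); rewrite -iterD subnKC // ltnW.
  move=> m n E; case: (ltngtP m n) => // mn; first by have := lt _ _ mn.
  by have := lt _ _ mn; rewrite E.
apply: infinite_nat.
rewrite (_ : [set: nat] = (fun n => iter n s x) @^-1` P); last first.
  by apply/seteqP; split=> // n _; exact: Px.
by apply: finite_preimage Pfin => m n _ _ /inj.
Qed.

(** * The darts at a vertex form one orbit of [turn] *)

Section DartOrbits.
Context {R : realType} {L : Type}.
Variable T : tiling R L.
Local Notation V := 'rV[R]_2.
Implicit Types (x y z d : dart T) (u v w p q : V) (t c : set V).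

Lemma flip_periodic x : exists2 n, (0 < n)%N & iter n (@flip _ _ T) x = x.
Proof. by exists 2%N => //=; rewrite flipK. Qed.

Lemma prev_periodic x : exists2 n, (0 < n)%N & iter n (@prev _ _ T) x = x.
Proof.
apply: periodic_of_finite (@prev_inj _ _ T) (darts_on_finite T (side x)) _ => n.
exact: side_iter_prev.
Qed.

Lemma turn_periodic x : exists2 n, (0 < n)%N & iter n (@turn _ _ T) x = x.
Proof.
apply: periodic_of_finite (@turn_inj _ _ T) (darts_at_finite T (tail x)) _ => n.
exact: tail_iter_turn.
Qed.

Lemma orbit_inv (D : Type) (s : D -> D) (a b : D) : injective s ->
  (forall a, exists2 n, (0 < n)%N & iter n s a = a) ->
  (exists n, s b = iter n s a) -> exists n, b = iter n s a.
Proof.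
move=> sI per [[|n] E]; last by exists n; exact: sI.
have [[//|m] _ am] := per a; exists m; apply: sI.
by rewrite E -iterS am.
Qed.

Lemma tile_sub_eq t t' : tile T t -> tile T t' -> t `<=` t' -> t = t'.
Proof.
move=> Tt Tt' tt'; have [z tz] := relint_neq0 Tt.1.
apply: (relint_uniq Tt.1 Tt'.1 tz); apply/(relint_tile _ Tt'.2).
have [d d0 hd] := (relint_tile _ Tt.2).1 tz.
by exists d => // y /hd; exact: tt'.
Qed.

Lemma side_dart v w t : kcell T 1 (seg v w) -> tile T t -> seg v w `<=` t ->
  exists x, side x = t /\ ((tail x = v /\ head x = w) \/ (tail x = w /\ head x = v)).
Proof.
move=> E Tt et; have [l|l] := edge_side E Tt et.
  have d : is_dart T v w t by [].
  by exists (Dart d); split=> //; left.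
have d : is_dart T w v t by split; rewrite 1?segC.
by exists (Dart d); split=> //; right.
Qed.

Lemma near_point v t (r : R) : 0 < r -> cell T [set v] -> tile T t -> t v ->
  exists p, [/\ p != v, `|p - v| < r & t p].
Proof.
move=> r0 Cv Tt tv; have [z tz zv] := tile_neq_vertex Cv Tt.
have N0 : 0 < 1 + `|z - v| by rewrite ltr_wpDr.
pose h := Num.min 1 (r / (1 + `|z - v|)).
have h0 : 0 < h by rewrite lt_min ltr01 divr_gt0.
have h1 : h <= 1 by rewrite ge_min lexx.
exists (v + h *: (z - v)); split.
- by rewrite -subr_eq0 [v + _]addrC addrK scaler_eq0 (gt_eqF h0) (negbTE zv).
- rewrite [v + _]addrC addrK normrZ gtr0_norm //.
  apply: (@lt_le_trans _ _ (h * (1 + `|z - v|))); first by rewrite ltr_pM2l // ltrDr.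
  by rewrite -ler_pdivlMr // ge_min lexx orbT.
by apply: (polytope_convex Tt.2) => //; [exact: tz.1|rewrite (ltW h0)].
Qed.

(** The tiles at [v] cover a punctured disc around [v]. A tile is labelled if its dart leaving [v]
    is in the orbit of [x]; two tiles that meet in the disc are equal or share an edge at [v],
    across which [turn] or its inverse leads. *)
Lemma turn_connected x y : tail x = tail y -> exists n, y = iter n (@turn _ _ T) x.
Proof.
set v := tail x => vy; have Cv := dart_tail x.
pose lab t := exists d, [/\ tail d = v, side d = t & exists n, d = iter n (@turn _ _ T) x].
have [d d0 hd] := local_cells T v.
pose S := [set t | tile T t /\ t v].
have Sfin : finite_set S.
  by apply: sub_finite_set (star_finite T v) => t [[Ct _] tv].
have vertex_eq c p : cell T c -> relint c p -> c v -> kcell T 0 c -> p = v.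
  by move=> Cc [cp _] cv /vertexP[q cE]; move: cp cv; rewrite cE => -> ->.
have cov p : p != v -> `|p - v| < d -> exists2 t, S t & t p.
  move=> pv pd; have [c Cc cp] := relint_cover T p.
  have cv := hd c p Cc cp.1 pd.
  case: (kcell_cases Cc) => K.
  - by move: pv; rewrite (vertex_eq _ _ Cc cp cv K) eqxx.
  - have [a [b cE]] := edgeP K; rewrite cE in K cp cv.
    have [z [az bz]] := edge_dart K.
    have sub : seg a b `<=` side z by rewrite -az -bz; exact: edge_side_sub.
    exists (side z); last exact/sub/cp.1.
    by split; [exact: dart_tile|exact: sub].
  - by exists c; [split|exact: cp.1].
have ov p t t' : p != v -> `|p - v| < d -> S t -> S t' -> t p -> t' p ->
    lab t -> lab t'.
  move=> pv pd [Tt tv] [Tt' tv'] tp tp' [z [zv zt zx]].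
  have [c Cc cp] := relint_cover T p; have cv := hd c p Cc cp.1 pd.
  have ct := cell_face Tt.1 Cc cp tp; have ct' := cell_face Tt'.1 Cc cp tp'.
  case: (kcell_cases Cc) => K.
  - by move: pv; rewrite (vertex_eq _ _ Cc cp cv K) eqxx.
  - have [w cE] := vertex_of_edge K Cv cv; rewrite cE in K ct ct'.
    have [a [at_ ad]] := side_dart K Tt ct.
    have [b [bt bd]] := side_dart K Tt' ct'.
    (* Equal directions of [a] and [b] force equal tiles. If [a] leaves [v], it is the turn of the
       dart of [t']; if it arrives, [b] is the turn of the dart of [t]. *)
    case: ad bd => -[a1 a2] [] [b1 b2].
    + have ab : a = b by apply: dart_eq_edge; rewrite ?a1 ?a2.
      by exists z; split=> //; rewrite -bt -ab at_.
    + have [z' [zv' zt']] := corner_dart Cv Tt' tv'.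
      exists z'; split=> //; apply: orbit_inv (@turn_inj _ _ T) turn_periodic _.
      have [n zn] := zx; exists n; rewrite -zn.
      have za : z = a by apply: dart_eq_tail; rewrite ?zv ?zt.
      have bz' : b = prev z' by apply: prev_uniq; rewrite ?zv' ?zt'.
      by apply: dart_eq_edge; rewrite /turn -bz' za ?tail_flip ?head_flip ?a1 ?a2.
    + exists b; split=> //; have [n zn] := zx; exists n.+1; rewrite iterS -zn.
      have az : a = prev z by apply: prev_uniq; rewrite ?zv ?zt.
      by apply: dart_eq_edge; rewrite /turn -az ?tail_flip ?head_flip ?a1 ?a2.
    + have ab : a = b by apply: dart_eq_edge; rewrite ?a1 ?a2.
      by exists z; split=> //; rewrite -bt -ab at_.
  - have -> : t' = t by rewrite -(tile_sub_eq K Tt ct) (tile_sub_eq K Tt' ct').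
    by exists z.
have [p [pv pd tp]] := near_point d0 Cv (dart_tile x) (@tail_side _ _ _ x).
have vy' : side y v by rewrite vy; exact: tail_side.
have [q [qv qd tq]] := near_point d0 Cv (dart_tile y) vy'.
have Scl t : S t -> closed t by move=> [[Ct _] _]; exact: cell_closed Ct.
have Sx : S (side x) by split; [exact: dart_tile|exact: tail_side].
have Sy : S (side y) by split; [exact: dart_tile|].
have lx : lab (side x) by exists x; split=> //; exists 0%N.
have [z [zv zy [n zx]]] := around_labels Sfin Scl cov ov pv pd qv qd Sx Sy tp tq lx.
exists n; rewrite -zx.
by apply: dart_eq_tail; rewrite ?zv ?zy.
Qed.

End DartOrbits.

(** * The darts of a tile form one orbit of [prev] *)

Section TileBoundary.
Context {R : realType} {L : Type}.
Variable T : tiling R L.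
Local Notation V := 'rV[R]_2.
Implicit Types (x y z d : dart T) (u v w p q : V) (t c e : set V).

Lemma vertex_not_relint_edge v e : cell T [set v] -> kcell T 1 e -> ~ relint e v.
Proof.
move=> Cv E ev; have ve := relint_uniq Cv E.1 (relint_set1 v) ev.
by have := set1_kcell Cv; rewrite ve => /(kcell_inj E).
Qed.

Lemma side_flip x : side (flip x) <> side x.
Proof.
move=> sf; have [_ _ _ lx] := dartP x; have [_ _ _] := dartP (flip x).
rewrite tail_flip head_flip sf => lf.
have [z tz] := relint_neq0 (dart_tile x).1.
have := lf _ tz; rewrite cross_flip; have := lx _ tz; lra.
Qed.

Lemma dart_eq_side x y : edge x = edge y -> side x = side y -> x = y.
Proof.
move=> ee ss; have : edge x (tail y) by rewrite ee; exact: tail_edge.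
case/(edge_relint (dart_edge x)) => [vv|vw|/(vertex_not_relint_edge (dart_tail y))].
- exact: dart_eq_tail.
- have : edge x (head y) by rewrite ee; exact: head_edge.
  case/(edge_relint (dart_edge x)) => [wv|ww|/(vertex_not_relint_edge (dart_head y))].
  + have yx : y = flip x by apply: dart_eq_edge; rewrite ?tail_flip ?head_flip.
    by exfalso; apply: (@side_flip x); rewrite -yx ss.
  + by have := dart_neq y; rewrite vw ww eqxx.
  + by move/(_ (dart_edge x)).
- by move/(_ (dart_edge x)).
Qed.

Section Cone.
Variables (t : set V) (z0 : V).
Hypotheses (Tt : tile T t) (ot : relint t z0).

(** For a dart of the tile, the sector with apex [z0] over its edge: the two half-planes cut out
    just the sector because the edge is seen from [z0] under a positive angle less than a straight
    one. *)
Definition cone x : set V := [set p | 0 <= cross (tail x - z0) (p - z0)] `&`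
  [set p | 0 <= cross (z0 - head x) (p - z0)].

Lemma closed_cone x : closed (cone x).
Proof. by apply: closedI; exact: closed_halfplane. Qed.

Lemma cross_dart_gt0 x : side x = t -> 0 < cross (tail x - z0) (head x - z0).
Proof.
move=> xt; have [_ _ _ l] := dartP x; have := l z0; rewrite xt => /(_ ot).
by rewrite /cross !mxE; lra.
Qed.

Lemma edge_cone x p s : side x = t -> 0 < s -> edge x (z0 + s *: (p - z0)) ->
  cone x p.
Proof.
move=> /cross_dart_gt0 g s0 [r /andP[r0 r1] E].
have {}E : s *: (p - z0) = (tail x - z0) + r *: ((head x - z0) - (tail x - z0)).
  apply: (addrI z0); rewrite E; apply: vecP; rewrite !mxE; ring.
split; rewrite /= -(pmulr_rge0 _ s0) -crossZr E cross_segment.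
  by rewrite crossvv add0r subr0 mulr_ge0 // ltW.
have -> : cross (z0 - head x) (tail x - z0) = cross (tail x - z0) (head x - z0).
  by rewrite /cross !mxE; ring.
have -> : cross (z0 - head x) (head x - z0) = 0 by rewrite /cross !mxE; ring.
rewrite (_ : _ + _ = (1 - r) * cross (tail x - z0) (head x - z0)); last by ring.
by apply: mulr_ge0; [rewrite subr_ge0|exact: ltW].
Qed.

Lemma cone_edge x p : side x = t -> p != z0 -> cone x p ->
  exists2 s, 0 < s & edge x (z0 + s *: (p - z0)).
Proof.
move=> /cross_dart_gt0 g po [h1 h2]; rewrite /= in h1 h2.
set A := tail x - z0 in g h1; set B := head x - z0 in g.
have {}h2 : 0 <= cross (p - z0) B.
  by rewrite crossC -crossNl opprB.
have pE := cross_basis (p - z0) (lt0r_neq0 g).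
set al := _ / _ in pE; set be := _ / _ in pE.
have al0 : 0 <= al by rewrite divr_ge0 // ltW.
have be0 : 0 <= be by rewrite divr_ge0 // ltW.
have ab : 0 < al + be.
  rewrite lt_neqAle addr_ge0 // andbT eq_sym paddr_eq0 //.
  apply: contraNN po => /andP[/eqP a0 /eqP b0]; rewrite -subr_eq0 pE a0 b0.
  by rewrite !scale0r addr0.
have ab0 : al + be != 0 by rewrite gt_eqF.
exists (al + be)^-1; first by rewrite invr_gt0.
exists (be / (al + be)).
  by rewrite divr_ge0 ?(ltW ab) //= ler_pdivrMr // mul1r lerDr.
by rewrite pE /A /B; apply: vecP; rewrite !mxE; field.
Qed.

(** Of two different boundary points on a ray from an interior point, the nearer would be
    interior. *)
Lemma ray_uniq x y p s r : side x = t -> side y = t -> 0 < s -> 0 < r ->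
  edge x (z0 + s *: (p - z0)) -> edge y (z0 + r *: (p - z0)) -> s = r.
Proof.
wlog sr : x y s r / s < r.
  move=> H xt yt s0 r0 sx ry; case: (ltgtP s r) => // sr; first exact: (H x y).
  by apply/esym/(H y x).
move=> xt yt s0 r0 sx ry; exfalso; apply: (edge_tile_disjoint (dart_edge x) Tt sx).
have -> : z0 + s *: (p - z0) = (z0 + r *: (p - z0)) + (1 - s / r) *: (z0 - (z0 + r *: (p - z0))).
  by apply: vecP; rewrite !mxE; field; rewrite gt_eqF.
apply: (polytope_relint_segment Tt.2) => //.
- by rewrite -yt; exact: edge_side_sub.
- by rewrite subr_gt0 ltr_pdivrMr // mul1r.
- by rewrite gerBl divr_ge0 // ltW.
Qed.

Lemma cone_cover p : p != z0 -> exists2 x, side x = t & cone x p.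
Proof.
move=> po; have po' : 0 < `|p - z0| by rewrite normr_gt0 subr_eq0.
have [M Mt] : exists M, forall q, t q -> `|q| <= M.
  have [M [_ HM]] := compact_bounded (polytope_compact Tt.2).
  by exists (M + 1) => q; apply: HM; rewrite ltrDl.
(* With this factor the point on the ray has norm above the bound [M] of the tile, so the ray has
   left it. *)
pose l := (M + `|z0| + 1) / `|p - z0|.
have M0 : 0 <= M by apply: le_trans (Mt z0 ot.1).
have l0 : 0 < l by rewrite divr_gt0 // ltr_wpDl // addr_ge0.
have qt : ~ t (z0 + l *: (p - z0)).
  move=> /Mt; apply/negP; rewrite -ltNge.
  have : `|l *: (p - z0)| <= `|z0 + l *: (p - z0)| + `|z0|.
    by rewrite [z0 + _]addrC; have := ler_normB (l *: (p - z0) + z0) z0; rewrite addrK.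
  by rewrite normrZ gtr0_norm // /l divfK ?gt_eqF //; lra.
have [s /andP[s0 s1]] := exit_point Tt ot qt.
rewrite [z0 + _ - z0]addrC addKr scalerA; set y := z0 + _ => -[ty nty].
have [c [Cc cy ct nTc]] := boundary_point Tt ty nty.
have sl : 0 < s * l by rewrite mulr_gt0.
have on_edge x : side x = t -> edge x y -> exists2 x, side x = t & cone x p.
  by move=> xt xy; exists x => //; exact: edge_cone xt sl xy.
have [K|K|//] := kcell_cases Cc.
  have [v cE] := vertexP K; rewrite cE in Cc cy ct.
  have [x [xv xt]] := corner_dart Cc Tt (ct v erefl).
  by apply: on_edge xt _; rewrite [y]cy.1 -xv; exact: tail_edge.
have [a [b cE]] := edgeP K; rewrite cE in K cy ct.
have [x [xt [] [xa xb]]] := side_dart K Tt ct; apply: on_edge xt _.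
  by rewrite /edge xa xb; exact: cy.1.
by rewrite /edge xa xb segC; exact: cy.1.
Qed.

End Cone.

(** Labels are propagated around an interior point [z0], over the sectors of the edges. A ray common
    to two sectors meets both edges in the same point; so the edges coincide or share an end, where
    [prev] leads from one to the other. *)
Lemma prev_connected x y : side x = side y -> exists n, y = iter n (@prev _ _ T) x.
Proof.
set t := side x => yt; have Tt := dart_tile x.
have [z0 ot] := relint_neq0 Tt.1.
pose lab z := exists n, z = iter n (@prev _ _ T) x.
pose S := [set z : dart T | side z = t].
have Sfin : finite_set S by exact: darts_on_finite.
have Scl z : S z -> closed (cone z0 z) by move=> _; exact: closed_cone.
(* The sectors cover the punctured plane, so any radius that takes in both tails will do. *)
pose d := `|tail x - z0| + `|tail y - z0| + 1.
have cov p : p != z0 -> `|p - z0| < d -> exists2 z, S z & cone z0 z p.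
  by move=> po _; exact: (cone_cover Tt ot po).
have ov p z z' : p != z0 -> `|p - z0| < d -> S z -> S z' -> cone z0 z p ->
    cone z0 z' p -> lab z -> lab z'.
  move=> po _ zt zt' zp zp' [n zn].
  have [s s0 zs] := cone_edge ot zt po zp.
  have [r r0 zr] := cone_edge ot zt' po zp'.
  have sr := ray_uniq Tt ot zt zt' s0 r0 zs zr; rewrite -sr in zr.
  set q := z0 + _ in zs zr.
  have prev_lab : lab (prev z) by exists n.+1; rewrite zn.
  have lab_prev a : lab (prev a) -> lab a.
    move=> [m am]; apply: orbit_inv (@prev_inj _ _ T) (@prev_periodic _ _ T) _.
    by exists m.
  case: (edge_relint (dart_edge z) zs) => qz;
    case: (edge_relint (dart_edge z') zr) => qz'.
  - by rewrite -(dart_eq_tail (x := z) (y := z')) -?qz -?qz' ?zt ?zt' //; exists n.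
  - rewrite -(prev_uniq (x := z) (y := z')) -?qz -?qz' ?zt ?zt' // in prev_lab.
  - by case: (vertex_not_relint_edge (dart_tail z) (dart_edge z')); rewrite -qz.
  - apply: lab_prev.
    by rewrite -(prev_uniq (x := z') (y := z)) -?qz -?qz' ?zt ?zt' //; exists n.
  - by rewrite -(dart_eq_head (x := z) (y := z')) -?qz -?qz' ?zt ?zt' //; exists n.
  - by case: (vertex_not_relint_edge (dart_head z) (dart_edge z')); rewrite -qz.
  - by case: (vertex_not_relint_edge (dart_tail z') (dart_edge z)); rewrite -qz'.
  - by case: (vertex_not_relint_edge (dart_head z') (dart_edge z)); rewrite -qz'.
  - have zz : edge z = edge z' := relint_uniq (dart_edge z).1 (dart_edge z').1 qz qz'.
    by rewrite -(dart_eq_side zz) ?zt ?zt' //; exists n.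
have neq z : S z -> tail z != z0.
  move=> zt; apply/eqP => zo; apply: (vertex_not_interior (dart_tail z) Tt).
  by rewrite zo.
have tail_cone z : S z -> cone z0 z (tail z).
  move=> zt; apply: (edge_cone ot zt (s := 1)) => //.
  by rewrite scale1r subrKC; exact: tail_edge.
have Sx : S x by []; have Sy : S y by [].
apply: (around_labels Sfin Scl cov ov (neq x Sx) _ (neq y Sy) _ Sx Sy
  (tail_cone x Sx) (tail_cone y Sy)).
- by rewrite /d -addrA ltrDl ltr_wpDl.
- by rewrite /d addrAC addrC ltrDl ltr_wpDl.
- by exists 0%N.
Qed.

End TileBoundary.

(** * Motions and coronas *)

Section MotionGroup.
Context {R : realType}.
Local Notation V := 'rV[R]_2.
Implicit Types (f g : motion R) (c : set V) (u v : V).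

Lemma id_motion_orthogonal : 1%:M *m (1%:M : 'M[R]_2)^T = 1%:M.
Proof. by rewrite trmx1 mulmx1. Qed.

Definition id_motion : motion R := Motion 0 id_motion_orthogonal (det1 _ _).

Lemma id_motionE : id_motion =1 id.
Proof. by move=> x; rewrite /move /= mulmx1 addr0. Qed.

Lemma comp_motion_orthogonal g f :
  (rot f *m rot g) *m (rot f *m rot g)^T = 1%:M.
Proof.
by rewrite trmx_mul mulmxA -(mulmxA (rot f)) rot_orthogonal mulmx1 rot_orthogonal.
Qed.

Lemma comp_motion_det g f : \det (rot f *m rot g) = 1.
Proof. by rewrite det_mulmx !rot_det mulr1. Qed.

Definition comp_motion g f : motion R :=
  Motion (trans f *m rot g + trans g) (comp_motion_orthogonal g f)
    (comp_motion_det g f).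

Lemma comp_motionE g f x : comp_motion g f x = g (f x).
Proof. by rewrite /move /= mulmxDl mulmxA addrA. Qed.

Lemma image_id_motion c : id_motion @` c = c.
Proof. by rewrite (eq_imagel (f' := id)) ?image_id // => x _; exact: id_motionE. Qed.

Lemma image_comp_motion g f c : comp_motion g f @` c = g @` (f @` c).
Proof. by rewrite image_comp; apply: eq_imagel => x _; exact: comp_motionE. Qed.

Lemma moveB f u v : f u - f v = (u - v) *m rot f.
Proof. by rewrite /move opprD addrACA subrr addr0 -mulmxBl. Qed.

Lemma move_lerp f u v (s : R) : f (u + s *: (v - u)) = f u + s *: (f v - f u).
Proof. by rewrite moveB /move mulmxDl -scalemxAl addrAC. Qed.

Lemma cross_rot f u v : cross (u *m rot f) (v *m rot f) = cross u v.
Proof. by rewrite -!det_col_mx -mul_col_mx det_mulmx rot_det mulr1. Qed.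

Lemma image_seg f u v : f @` seg u v = seg (f u) (f v).
Proof.
apply/seteqP; split=> [_ [_ [s s01 ->] <-]|_ [s s01 ->]].
  by exists s; rewrite ?move_lerp.
by exists (u + s *: (v - u)); [exists s|rewrite move_lerp].
Qed.

Lemma sum_I2 (F : 'I_2 -> R) : \sum_j F j = F 0 + F 1.
Proof.
by rewrite !big_ord_recl big_ord0 addr0; congr (F _ + F _); exact: val_inj.
Qed.

Lemma perp_rot f u : perp u *m rot f = perp (u *m rot f).
Proof.
have E i j : rot f i 0 * rot f j 0 + rot f i 1 * rot f j 1 = (i == j)%:R.
  by have /matrixP/(_ i j) := rot_orthogonal f; rewrite !mxE sum_I2 !mxE.
have := rot_det f; rewrite det2E; have := E 0 0; have := E 1 1; rewrite !eqxx.
set A := rot f 0 0; set B := rot f 0 1; set C := rot f 1 0; set D := rot f 1 1.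
rewrite /= => E11 E00 D1.
(* The two unit rows contribute 2, and the mixed terms are minus twice the determinant. *)
have S : (A - D) ^+ 2 + (B + C) ^+ 2 = 0 by nra.
have AD : A = D.
  by apply/eqP; rewrite -subr_eq0 -sqrf_eq0; apply/eqP; nra.
have BC : C = - B.
  by apply/eqP; rewrite -addr_eq0 addrC -sqrf_eq0; apply/eqP; nra.
by apply: vecP; rewrite !mxE !sum_I2 !mxE /= ?sum_I2 -/A -/B -/C -/D BC AD; ring.
Qed.

Lemma motion_fix2 f u v : u != v -> f u = u -> f v = v -> f =1 id.
Proof.
move=> uv fu fv x; have vu : v - u != 0 by rewrite subr_eq0 eq_sym.
have dE : (v - u) *m rot f = v - u by rewrite -moveB fu fv.
have p := cross_perp_gt0 vu; set n := perp (v - u) in p.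
have nE : n *m rot f = n by rewrite perp_rot dE.
have xE := cross_basis (x - u) (lt0r_neq0 p).
have : f x - f u = x - u by rewrite moveB [in LHS]xE mulmxDl -!scalemxAl dE nE -xE.
by rewrite fu => /(congr1 (+%R^~ u)); rewrite !subrK.
Qed.

End MotionGroup.

(** * Comparing coronas of different cells of a tile *)

Section Carries.
Context {R : realType} {L : Type}.
Variable T : tiling R L.
Local Notation V := 'rV[R]_2.
Implicit Types (f g : motion R) (c d s t x y : set V) (P Q S : set (set V)).

Lemma carries_id P : carries T (id_motion (R := R)) P P.
Proof.
split; last by move=> c _; rewrite image_id_motion.
by apply/seteqP; split=> [_ [c Pc <-]|c Pc]; [|exists c]; rewrite ?image_id_motion.
Qed.

Lemma carries_comp g f P Q S : carries T f P Q -> carries T g Q S ->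
  carries T (comp_motion g f) P S.
Proof.
move=> [<- lf] [<- lg]; split.
  apply/seteqP; split=> [_ [c Pc <-]|_ [_ [c Pc <-] <-]].
    by rewrite image_comp_motion; exists (f @` c) => //; exists c.
  by exists c; rewrite ?image_comp_motion.
by move=> c Pc; rewrite image_comp_motion lg ?lf //; exists c.
Qed.

Lemma carries_in f P Q x : carries T f P Q -> P x -> Q (f @` x).
Proof. by move=> [<- _] Px; exists x. Qed.

Lemma image_tile f t : cell T (f @` t) -> tile T t -> tile T (f @` t).
Proof. by move=> C Tt; split=> //; exact: polytope_image Tt.2. Qed.

Lemma image_edge f e : cell T (f @` e) -> kcell T 1 e -> kcell T 1 (f @` e).
Proof. by move=> C E; split=> //; exact: polytope_image E.2. Qed.

Lemma tile_corona_le i j t : (i <= j)%N -> tile T t ->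
  tile_corona T i t `<=` tile_corona T j t.
Proof.
move=> ij Tt; rewrite -(subnKC ij); elim: (j - i)%N => [|k IH]; first by rewrite addn0.
rewrite addnS; apply: subset_trans IH _; apply: tile_corona_near => //.
by rewrite setIid; exact: cell_neq0 Tt.1.
Qed.

Lemma image_tile_corona f P i s x : (forall y, P y -> cell T (f @` y)) ->
  tile T s -> tile_corona T i s `<=` P ->
  tile_corona T i s x -> tile_corona T i (f @` s) (f @` x).
Proof.
move=> Pf Ts sP.
have H j : (j <= i)%N -> tile_corona T j s `<=` P.
  by move=> ji; apply: subset_trans sP; exact: tile_corona_le.
have : (i <= i)%N by [].
elim: {1 3 4}i x => [|j IH] x ji.
  by move=> sx; split; [exact/Pf/(H 0%N)|apply: image_subset; case: sx].
move=> sx; split; first exact/Pf/(H j.+1).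
case: (sx) => Cx [u [Tu xu [y sy [z [uz yz]]]]]; exists (f @` u); split.
- apply: (image_tile _ Tu); apply: Pf; apply: (H j.+1) => //.
  by split; [exact: Tu.1|exists u; split => //; exists y => //; exists z].
- exact: image_subset.
- exists (f @` y); first by apply: IH => //; exact: ltnW.
  by exists (f z); split; exists z.
Qed.

Lemma corona_star i c s d : cell T c -> tile T s -> c `<=` s -> cell T d ->
  d `<=` s -> corona T i.+1 c d.
Proof.
move=> Cc Ts cs Cd ds; apply: (tile_corona_corona Cc Ts cs).
by apply: (tile_corona_le (leq0n i)) => //; split.
Qed.

(** Of the two extra layers, one passes from [c] to the tile [t] and one from [t] to the tiles
    around [d], all of which meet [t]. So the corona of [c] contains the [i]-coronas of all these
    tiles. *)
Lemma carries_interleave_sub f i c d t x : cell T c -> cell T d -> tile T t ->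
  c `<=` t -> d `<=` t -> cell T (f @` c) -> cell T (f @` d) ->
  carries T f (corona T i.+2 c) (corona T i.+2 (f @` c)) ->
  corona T i d x -> corona T i (f @` d) (f @` x).
Proof.
move=> Cc Cd Tt ct dt Cfc Cfd fc dx; set P := corona T i.+2 c in fc.
have Pf y : P y -> cell T (f @` y) by move=> /(carries_in fc)[].
have tP s : tile T s -> t `&` s !=set0 -> tile_corona T i s `<=` P.
  move=> Ts st; apply: subset_trans (tile_corona_corona Cc Tt ct).
  by apply: tile_corona_near => //; rewrite setIC.
have tt0 : t `&` t !=set0 by rewrite setIid; exact: cell_neq0 Tt.1.
have Px : P x by apply: (tP t) => //; exact: dx.2.
split; first exact: Pf.
have Tft : tile T (f @` t).
  by apply: (image_tile _ Tt); apply: Pf; exact: (corona_star _ Cc Tt ct Tt.1).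
move=> t' [Tt' dt'].
have t'E : f @` (inv_motion f @` t') = t' by exact: image_motion_inv.
have Ps : P (inv_motion f @` t').
  rewrite (_ : P = corona T i.+2 (inv_motion f @` (f @` c))); last by rewrite image_inv_motion.
  apply: carries_in (_ : corona T i.+2 (f @` c) t').
    by rewrite image_inv_motion; exact: carries_inv.
  apply: (tile_corona_corona Cfc Tft); first exact: image_subset.
  apply: (tile_corona_le (isT : (1 <= i.+1)%N)) => //; split; first exact: Tt'.1.
  exists t'; split=> //; exists (f @` t).
    exact: (tile_corona_self 0 Tft).
  have [z dz] := cell_neq0 Cfd; exists z; split; first exact: dt'.
  by apply: image_subset dz; exact: dt.
have Ts : tile T (inv_motion f @` t').
  by apply: (image_tile _ Tt'); exact: Ps.1.
have ds : d `<=` inv_motion f @` t'.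
  by rewrite -[d](image_inv_motion f); exact: image_subset.
have [z dz] := cell_neq0 Cd.
rewrite -t'E; apply: (image_tile_corona Pf Ts); last exact: dx.2.
by apply: tP => //; exists z; split; [exact: dt|exact: ds].
Qed.

Lemma carries_interleave f i c d t : cell T c -> cell T d -> tile T t ->
  c `<=` t -> d `<=` t -> cell T (f @` c) -> cell T (f @` d) ->
  carries T f (corona T i.+2 c) (corona T i.+2 (f @` c)) ->
  carries T f (corona T i d) (corona T i (f @` d)).
Proof.
move=> Cc Cd Tt ct dt Cfc Cfd fc; split.
  apply/seteqP; split=> [_ [x dx <-]|x dx].
    exact: (carries_interleave_sub Cc Cd Tt ct dt Cfc Cfd fc dx).
  exists (inv_motion f @` x); last exact: image_motion_inv.
  rewrite -[d](image_inv_motion f).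
  apply: (@carries_interleave_sub (inv_motion f) i (f @` c) (f @` d) (f @` t)) dx => //;
    rewrite ?image_inv_motion //; try exact: image_subset; last exact: carries_inv.
  apply: (image_tile _ Tt); suff [] : corona T i.+2 (f @` c) (f @` t) by [].
  apply: (carries_in fc); exact: (corona_star _ Cc Tt ct Tt.1).
move=> x dx; apply: fc.2; apply: (tile_corona_corona Cc Tt ct).
by apply: (tile_corona_le (leqnSn i) Tt); exact: dx.2.
Qed.

End Carries.

(** * Darts related by motions that preserve coronas *)

Section Equivalences.
Context {R : realType} {L : Type}.
Variable T : tiling R L.
Local Notation V := 'rV[R]_2.
Local Notation D := (dart T).
Implicit Types (f g : motion R) (x y z : D) (c : D -> set V) (i j n : nat).

Definition acts f x y :=
  [/\ f (tail x) = tail y, f (head x) = head y & f @` side x = side y].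

Definition vertex x : set V := [set tail x].

(* A choice of vertex, edge or tile for each dart. *)
Definition selector c :=
  [/\ forall x, cell T (c x), forall x, c x `<=` side x
    & forall f x y, acts f x y -> f @` c x = c y].

Lemma vertex_selector : selector vertex.
Proof.
split=> [x|x _ ->|f x y [fv _ _]]; first exact: dart_tail.
  exact: tail_side.
by rewrite image_set1 fv.
Qed.

Lemma edge_selector : selector (@edge _ _ T).
Proof.
split=> [x|x|f x y [fv fw _]]; first by have [] := dart_edge x.
  exact: edge_side_sub.
by rewrite image_seg fv fw.
Qed.

Lemma side_selector : selector (@side _ _ T).
Proof. by split=> [x|x|f x y []//]; [have [] := dart_tile x|]. Qed.

(** The index [i.+1] ensures that even for [i = 0] the corona contains all the tiles around the
    cell, so that [f] acts on every dart whose side contains it. *)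
Definition carried c i f x y :=
  acts f x y /\ carries T f (corona T i.+1 (c x)) (corona T i.+1 (c y)).

Definition equivalent c i x y := exists f, carried c i f x y.

Lemma acts_uniq f x y z : acts f x y -> acts f x z -> y = z.
Proof.
by move=> [v w t] [v' w' t']; apply: dart_eq; rewrite -?v -?w -?t -?v' -?w' -?t'.
Qed.

Lemma acts_inv f x y : acts f x y -> acts (inv_motion f) y x.
Proof. by move=> [v w t]; split; rewrite -?v -?w -?t ?moveK ?image_inv_motion. Qed.

Lemma acts_prev f x y z : acts f x y -> acts f (prev x) z -> z = prev y.
Proof.
move=> [v w t] [v' w' t']; apply: prev_uniq; first by rewrite -w' head_prev v.
by rewrite -t' side_prev t.
Qed.

Lemma acts_flip f x y z : acts f x y -> acts f (flip x) z -> z = flip y.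
Proof.
move=> [v w t] [v' w' t']; apply: dart_eq_edge.
  by rewrite -v' !tail_flip w.
by rewrite -w' !head_flip v.
Qed.

Lemma motion_dart f x : kcell T 1 (f @` edge x) -> tile T (f @` side x) ->
  exists y, acts f x y.
Proof.
rewrite image_seg => E Tt; have [_ Tx xt lx] := dartP x.
have sub : seg (f (tail x)) (f (head x)) `<=` f @` side x.
  by rewrite -image_seg; exact: image_subset.
have [y [yt [] [yv yw]]] := side_dart E Tt sub; first by exists y; split.
(* Motions preserve [cross], so the image tile stays to the left of the image edge. *)
exfalso; have [_ _ _ ly] := dartP y; have [z' tz'] := relint_neq0 Tt.1.
have [z xz zE] := tz'.1; have := ly z'; rewrite yt => /(_ tz').
rewrite -zE yv yw !moveB cross_rot cross_flip oppr_gt0.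
by have := left_of_ge0 Tx lx xz; lra.
Qed.

Lemma star_dart (c : set V) i f z Q : cell T c -> carries T f (corona T i.+1 c) Q ->
  Q `<=` cell T -> c `<=` side z -> exists z', acts f z z'.
Proof.
move=> Cc fc QT cz.
have star d : cell T d -> d `<=` side z -> cell T (f @` d).
  move=> Cd dz; apply: QT; apply: (carries_in fc).
  exact: (corona_star _ Cc (dart_tile z) cz Cd dz).
apply: motion_dart.
  apply: image_edge (dart_edge z); apply: star; first exact: (dart_edge z).1.
  exact: edge_side_sub.
apply: (image_tile _ (dart_tile z)); apply: star => //; exact: (dart_tile z).1.
Qed.

Lemma carried_star c i f x y z : selector c -> carried c i f x y ->
  c x `<=` side z -> exists z', acts f z z'.
Proof. by move=> [cc _ _] [_ fc]; apply: star_dart fc _ => // d []. Qed.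

Lemma carried_le c i j f x y : selector c -> (j <= i)%N ->
  carried c i f x y -> carried c j f x y.
Proof.
move=> [cc _ cf] ji [xy fc]; split=> //.
by apply: carries_corona_le fc => //; exact/esym/cf.
Qed.

Lemma carried_other c d i f x y : selector c -> selector d ->
  carried c i.+2 f x y -> carried d i f x y.
Proof.
move=> [cc cs cf] [dc ds df] [xy fc]; split=> //.
rewrite -(cf _ _ _ xy) in fc; rewrite -(df _ _ _ xy).
apply: (carries_interleave (cc x) (dc x) (dart_tile x) (cs x) (ds x)) fc.
  by rewrite (cf _ _ _ xy).
by rewrite (df _ _ _ xy).
Qed.

Definition pe (h : D -> int) :=
  exists i, invariant (equivalent (@side _ _ T) i) h.

Lemma pe_selector c h : selector c ->
  pe h <-> exists i, invariant (equivalent c i) h.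
Proof.
move=> sc; split=> -[i hi]; exists i.+2 => x y [f fxy]; apply: hi; exists f.
  exact: carried_other sc side_selector fxy.
exact: carried_other side_selector sc fxy.
Qed.

Lemma equivalent_refl c i x : selector c -> equivalent c i x x.
Proof.
move=> sc; exists (id_motion); split; last exact: carries_id.
by split; rewrite ?id_motionE ?image_id_motion.
Qed.

Lemma equivalent_sym c i x y : equivalent c i x y -> equivalent c i y x.
Proof.
move=> [f [xy fc]]; exists (inv_motion f); split; first exact: acts_inv.
exact: carries_inv.
Qed.

Lemma equivalent_trans c i x y z :
  equivalent c i x y -> equivalent c i y z -> equivalent c i x z.
Proof.
move=> [f [[v w t] fc]] [g [[v' w' t'] gc]]; exists (comp_motion g f); split.
  by split; rewrite ?comp_motionE ?image_comp_motion ?v ?w ?t.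
exact: carries_comp fc gc.
Qed.

(** Asking for the same motion [f] after applying [s] yields more than compatibility of the
    relation: a period of [x] is one of [y], because the image of a dart under [f] is unique. *)
Lemma selector_family c s : selector c ->
  (forall x, exists2 n, (0 < n)%N & iter n s x = x) ->
  (forall i f x y, carried c i f x y -> carried c i f (s x) (s y)) ->
  family pe s (equivalent c).
Proof.
move=> sc per eq; split=> //.
- by move=> i x; exact: equivalent_refl.
- exact: equivalent_sym.
- exact: equivalent_trans.
- by move=> i x y [f fxy]; exists f; exact: eq.
- move=> i x y n [f fxy] nx.
  have : carried c i f (iter n s x) (iter n s y) by elim: n {nx} => // n; exact: eq.
  by rewrite nx => -[xy' _]; case: fxy => xy _; exact: acts_uniq xy' xy.
- by move=> i j x y ij [f fxy]; exists f; exact: carried_le fxy.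
- by move=> h; exact: pe_selector.
Qed.

Lemma carried_turn i f x y :
  carried vertex i f x y -> carried vertex i f (turn x) (turn y).
Proof.
move=> fxy; have [xy fc] := fxy; split; last first.
  by rewrite /vertex !tail_turn.
have [|p xp] := carried_star (z := prev x) vertex_selector fxy.
  by move=> _ ->; rewrite side_prev; exact: tail_side.
have [|q xq] := carried_star (z := turn x) vertex_selector fxy.
  by move=> _ ->; rewrite -tail_turn; exact: tail_side.
by rewrite {2}/turn -(acts_prev xy xp) -(acts_flip xp xq).
Qed.

Lemma carried_prev i f x y :
  carried (@side _ _ T) i f x y -> carried (@side _ _ T) i f (prev x) (prev y).
Proof.
move=> fxy; have [xy fc] := fxy; split; last by rewrite !side_prev.
have [|p xp] := carried_star (z := prev x) side_selector fxy.
  by rewrite side_prev.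
by rewrite -(acts_prev xy xp).
Qed.

Lemma carried_flip i f x y :
  carried (@edge _ _ T) i f x y -> carried (@edge _ _ T) i f (flip x) (flip y).
Proof.
move=> fxy; have [xy fc] := fxy; split; last by rewrite !edge_flip.
have [|p xp] := carried_star (z := flip x) edge_selector fxy.
  by rewrite -edge_flip; exact: edge_side_sub.
by rewrite -(acts_flip xy xp).
Qed.

Lemma turn_family : family pe (@turn _ _ T) (equivalent vertex).
Proof.
exact: (selector_family vertex_selector (@turn_periodic _ _ T) carried_turn).
Qed.

Lemma prev_family : family pe (@prev _ _ T) (equivalent (@side _ _ T)).
Proof.
exact: (selector_family side_selector (@prev_periodic _ _ T) carried_prev).
Qed.

Lemma flip_family : family pe (@flip _ _ T) (equivalent (@edge _ _ T)).
Proof.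
exact: (selector_family edge_selector (@flip_periodic _ _ T) carried_flip).
Qed.

Section LocalRotations.
Hypothesis T_rot : rotations_at_vertices T.

Lemma no_flip : exists i, forall x, ~ equivalent (@edge _ _ T) i x (flip x).
Proof.
have [i hi] := T_rot; exists i => x [f [xy fc]].
rewrite edge_flip in fc.
have fE : f @` edge x = edge x.
  by have [_ _ /(_ _ _ _ xy)] := edge_selector; rewrite edge_flip.
have fid : f =1 id.
  apply: (hi (edge x) f) => //; first by left; exact: dart_edge.
  by apply: (carries_corona_le (leqnSn i)) fc; [exact: (dart_edge x).1..|].
have [v _ _] := xy; have /eqP := dart_neq x; apply.
by rewrite -(fid (tail x)) v tail_flip.
Qed.

(** A motion relating two darts of a tile preserves the tile and its corona, so it is the
    identity. *)
Lemma tile_rigid : exists i, forall x y, side x = side y ->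
  equivalent (@side _ _ T) i x y -> x = y.
Proof.
have [i hi] := T_rot; exists i => x y xy [f [fxy fc]].
rewrite -xy in fc.
have fid : f =1 id.
  apply: (hi (side x) f); first by right; exact: dart_tile.
    by have [_ _] := fxy; rewrite -xy.
  by apply: (carries_corona_le (leqnSn i)) fc; [exact: (dart_tile x).1..|
    have [_ _] := fxy; rewrite -xy].
by apply: dart_eq_tail => //; have [<- _ _] := fxy; rewrite fid.
Qed.

End LocalRotations.

End Equivalences.

(** * Incidence numbers *)

Section OrientedCells.
Context {R : realType} {L : Type}.
Variable T : tiling R L.
Local Notation V := 'rV[R]_2.
Local Notation D := (dart T).
Implicit Types (x y z : D) (k : nat).

Lemma ocell_eq k (o o' : ocell T k) : supp o = supp o' -> ofr o = ofr o' -> o = o'.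
Proof.
case: o o' => [s B hs hB] [s' B' hs' hB'] /= ss BB; subst s' B'.
by rewrite (Prop_irrelevance hs' hs) (Prop_irrelevance hB' hB).
Qed.

Lemma supp_relint k (o : ocell T k) : relint (supp o) (xget 0 (relint (supp o))).
Proof. by apply: xgetPex; exact: relint_neq0 (supp_kcell o).1. Qed.

Lemma frame_change k (o o' : ocell T k) : supp o' = supp o ->
  exists2 M, \det M != 0 & ofr o' = M *m ofr o.
Proof.
move=> ss; have [x ox] := cell_neq0 (supp_kcell o).1.
have fo := ofr_frame o; have fo' := ofr_frame o'; rewrite ss in fo'.
have [E _] := frame_dim (ex_intro _ x ox) fo' fo.
have /submxP[M ME] : (ofr o' <= ofr o)%MS by rewrite E.
exists M => //; have := fo'.1; rewrite ME /row_free => /eqP r.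
rewrite -unitfE -unitmxE -row_free_unit /row_free eqn_leq rank_leq_row /=.
by rewrite -{1}r mxrankM_maxl.
Qed.

Lemma sgz_mul_self (M : R) : M != 0 -> sgz M * sgz M = 1.
Proof. by move=> M0; rewrite -sgzM gtr0_sgz // -expr2 exprn_even_gt0. Qed.

Lemma sgz_inv (M : R) : M != 0 -> sgz M^-1 = sgz M.
Proof.
by move=> M0; rewrite -[LHS]mulr1 -(sgz_mul_self M0) mulrA -sgzM mulVf // sgz1 mul1r.
Qed.

Lemma frame_sub (c c' : set V) k l (B : 'M[R]_(k, 2)) (C : 'M[R]_(l, 2)) (x : V) :
  c x -> c `<=` c' -> frame c B -> frame c' C -> (B <= C)%MS.
Proof.
move=> cx cc' [_ hB] [_ hC]; apply/rV_subP => v vB.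
have : affine_hull c (v + x) by rewrite (hB x cx) /= addrK.
move=> [n [p [w [pc w1 E]]]]; have : affine_hull c' (v + x).
  by exists n, p, w; split=> // i; exact: cc'.
by rewrite (hC x (cc' _ cx)) /= addrK.
Qed.

Lemma incidenceE k (s : ocell T k) (t : ocell T k.+1) (N : 'M[R]_k.+1) :
  (col_mx (xget 0 (relint (supp s)) - xget 0 (relint (supp t))) (ofr s)
    : 'M[R]_(k.+1, 2)) = N *m ofr t -> incidence s t = sgz (\det N).
Proof.
move=> E; rewrite /incidence E mulmxKp //; exact: (ofr_frame t).1.
Qed.

Lemma incidence_exists k (s : ocell T k) (t : ocell T k.+1) : supp s `<=` supp t ->
  exists N : 'M[R]_k.+1,
  (col_mx (xget 0 (relint (supp s)) - xget 0 (relint (supp t))) (ofr s)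
    : 'M[R]_(k.+1, 2)) = N *m ofr t.
Proof.
move=> st; set q := xget 0 (relint (supp t)); set p := xget 0 (relint (supp s)).
have pt : supp t p by exact/st/(supp_relint s).1.
have /submxP[N NE] : (col_mx (p - q) (ofr s) <= ofr t)%MS; last by exists N.
rewrite col_mx_sub; apply/andP; split.
  have : affine_hull (supp t) p.
    by exists 1%N, (fun=> p), (fun=> 1); split; rewrite ?big_ord1 ?scale1r.
  by rewrite ((ofr_frame t).2 _ (supp_relint t).1).
exact: frame_sub (supp_relint s).1 st (ofr_frame s) (ofr_frame t).
Qed.

Lemma incidence_face k (o o' : ocell T k) (t : ocell T k.+1) M :
  supp o' = supp o -> ofr o' = M *m ofr o ->
  incidence o' t = sgz (\det M) * incidence o t.
Proof.
move=> ss BB; rewrite /incidence ss BB -sgzM; congr (sgz _).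
set u := _ - _.
have -> : (col_mx u (M *m ofr o) : 'M[R]_(k.+1, 2)) =
    (block_mx 1%:M 0 0 M : 'M[R]_(1 + k)) *m col_mx u (ofr o).
  by rewrite mul_block_col !mul1mx !mul0mx addr0 add0r.
have dE : \det (block_mx 1%:M 0 0 M : 'M[R]_(1 + k)) = \det M.
  by rewrite det_ublock det1 mul1r.
by rewrite -mulmxA det_mulmx; congr (_ * _).
Qed.

Lemma incidence_coface k (s : ocell T k) (t t' : ocell T k.+1) M :
  supp s `<=` supp t -> \det M != 0 ->
  supp t' = supp t -> ofr t' = M *m ofr t ->
  incidence s t' = sgz (\det M) * incidence s t.
Proof.
move=> st M0 tt BB; have [N NE] := incidence_exists st.
have Mu : M \in unitmx by rewrite unitmxE unitfE.
rewrite (incidenceE NE) (incidenceE (N := N *m invmx M)); last first.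
  by rewrite tt BB mulmxA -(mulmxA N) mulVmx // mulmx1.
by rewrite det_mulmx det_inv sgzM mulrC sgz_inv.
Qed.

(** Reorienting [s] changes both factors by the same sign. With [coincidence_supp], this frees
    (co)boundary sums from the chosen orientations. *)
Lemma incidence_supp k (psi : ocell T k -> int) (t : ocell T k.+1) s s' :
  oriented psi -> supp s = supp s' -> incidence s t * psi s = incidence s' t * psi s'.
Proof.
move=> opsi ss; have [M M0 BB] := frame_change ss.
rewrite (incidence_face _ ss BB) (opsi _ _ M ss BB).
by rewrite mulrACA sgz_mul_self // mul1r.
Qed.

Lemma coincidence_supp k (psi : ocell T k.+1 -> int) (s : ocell T k) t t' :
  oriented psi -> supp s `<=` supp t' -> supp t = supp t' ->
  incidence s t * psi t = incidence s t' * psi t'.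
Proof.
move=> opsi st tt; have [M M0 BB] := frame_change tt.
rewrite (incidence_coface st M0 tt BB) (opsi _ _ M tt BB).
by rewrite mulrACA sgz_mul_self // mul1r.
Qed.

Lemma chosen_exists k (o : ocell T k) : exists2 o' : ocell T k, supp o' = supp o & chosen o'.
Proof.
have fr : frame (supp o) (xget 0 [set B : 'M[R]_(k, 2) | frame (supp o) B]).
  exact: (@xgetPex _ 0 [set B : 'M[R]_(k, 2) | frame (supp o) B]
    (ex_intro _ (ofr o) (ofr_frame o))).
by exists (OCell (supp_kcell o) fr).
Qed.

(** Replaces a sum over cells with chosen orientations by one over a set [X] of darts that
    represents each of these cells once. *)
Lemma chosen_sum k (oc : D -> ocell T k) (F : ocell T k -> int)
    (P : set (set V)) (X : set D) :
  (forall s s', P (supp s) -> supp s = supp s' -> F s = F s') ->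
  (forall x y, X x -> X y -> supp (oc x) = supp (oc y) -> x = y) ->
  (forall x, X x -> P (supp (oc x))) ->
  (forall s : ocell T k, P (supp s) -> exists2 x, X x & supp (oc x) = supp s) ->
  \sum_(s \in [set s | chosen s /\ P (supp s)]) F s = \sum_(x \in X) F (oc x).
Proof.
move=> FF Xinj XP PX.
have ex x : exists o : ocell T k, supp o = supp (oc x) /\ chosen o.
  by have [s os oc'] := chosen_exists (oc x); exists s.
have [h hE] := choice ex.
rewrite (reindex_fsbig h X); last first.
  split=> [x Xx|x y /set_mem Xx /set_mem Xy hxy|s [cs Ps]].
  - by rewrite /=; have [-> ch] := hE x; split=> //; exact: XP.
  - by apply: Xinj => //; have [<- _] := hE x; have [<- _] := hE y; rewrite hxy.
  - have [x Xx xs] := PX s Ps; exists x => //; have [hs ch] := hE x.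
    by apply: ocell_eq; [rewrite hs|rewrite ch cs hs xs].
apply: eq_fsbigr => x /set_mem Xx; have [hs _] := hE x.
by apply: FF => //; rewrite hs; exact: XP.
Qed.

Lemma osum_fsbig (s : D -> D) (f : D -> int) x (X : set D) :
  (forall x, exists2 n, (0 < n)%N & iter n s x = x) ->
  (forall n, X (iter n s x)) -> (forall y, X y -> exists n, y = iter n s x) ->
  \sum_(y \in X) f y = osum s f x.
Proof.
move=> per Xs sX; rewrite /osum (fsbig_ord _ _ (fun j => f (iter j s x))).
apply: (reindex_fsbig (fun n => iter n s x)); split=> [n _|m n|y /sX[n ->]].
- exact: Xs.
- rewrite !inE /= => mo no E.
  wlog mn : m n mo no E / (m <= n)%N.
    by move=> H; case/orP: (leq_total m n) => ?; [|apply/esym]; apply: H.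
  move: E; rewrite -{1}(subnK mn) addnC iterD => /(iter_inj per)/esym.
  move=> /(iter_eqP per x) /dvdn_leq; lia.
- exists (n %% ord s x)%N; last exact: iter_mod_ord.
  by rewrite /= ltn_pmod // ord_gt0.
Qed.

End OrientedCells.

(** * Chains as functions on darts *)

Section Pullback.
Context {R : realType} {L : Type}.
Variable T : tiling R L.
Local Notation V := 'rV[R]_2.
Local Notation D := (dart T).
Implicit Types (x y z : D) (k : nat).

Section Selected.
Variables (k : nat) (c : D -> set V) (oc : D -> ocell T k).
Hypothesis c_sel : selector c.
Hypothesis oc_supp : forall x, supp (oc x) = c x.
Hypothesis oc_cover : forall o : ocell T k, exists x, supp (oc x) = supp o.
Hypothesis oc_acts : forall f x y, acts f x y ->
  exists2 M, \det M = 1 & ofr (oc y) = M *m (ofr (oc x) *m rot f).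

Lemma pullback_inj (psi psi' : ocell T k -> int) : oriented psi -> oriented psi' ->
  (forall x, psi (oc x) = psi' (oc x)) -> psi = psi'.
Proof.
move=> opsi opsi' pp; apply/funext => a; have [x xa] := oc_cover a.
have [M _ ME] := frame_change (esym xa).
by rewrite (opsi _ _ M (esym xa) ME) (opsi' _ _ M (esym xa) ME) pp.
Qed.

Lemma pullback_pe (psi : ocell T k -> int) : ePE psi -> pe (psi \o oc).
Proof.
move=> [opsi [i hi]]; apply/(pe_selector _ c_sel); exists i => x y [f [xy fc]] /=.
have cf : c y = f @` c x by have [_ _ cf] := c_sel; rewrite (cf _ _ _ xy).
have fr : frame (supp (oc y)) (ofr (oc x) *m rot f).
  by rewrite oc_supp cf -oc_supp; apply: frame_image; exact: ofr_frame.
(* The ePE condition speaks of the frame transported by [f], which may differ from the frame of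
   [oc y] by a change of determinant 1. *)
pose a := OCell (supp_kcell (oc y)) fr.
have -> : psi (oc x) = psi a.
  apply/esym/(hi f) => //=; first by rewrite !oc_supp.
  rewrite !oc_supp; apply: (carries_corona_le (leqnSn i)) fc => //.
    by have [cc _ _] := c_sel.
  by have [cc _ _] := c_sel.
have [M M1 ME] := oc_acts xy.
by rewrite (opsi a (oc y) M) // M1 sgz1 mul1r.
Qed.

(** Every oriented cell is some [oc x] up to a change of frame, whose sign relates its value to
    [h x]; the hypothesis is the independence of [x]. *)
Lemma push (h : D -> int) :
  (forall x y M, supp (oc y) = supp (oc x) -> ofr (oc y) = M *m ofr (oc x) ->
     h y = sgz (\det M) * h x) ->
  exists psi : ocell T k -> int, [/\ oriented psi, forall x, psi (oc x) = h x
    & pe h -> ePE psi].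
Proof.
move=> hP.
have ex (a : ocell T k) : exists r, exists x M, [/\ supp a = supp (oc x), ofr a = M *m ofr (oc x)
    & r = sgz (\det M) * h x].
  have [x xa] := oc_cover a; have [M _ ME] := frame_change (esym xa).
  by exists (sgz (\det M) * h x), x, M.
have [psi psiE] := choice ex.
have uniq (a : ocell T k) x M : supp a = supp (oc x) -> ofr a = M *m ofr (oc x) ->
    psi a = sgz (\det M) * h x.
  move=> ax aM; have [y [N [ay aN ->]]] := psiE a.
  have xy : supp (oc x) = supp (oc y) by rewrite -ax.
  have [P _ PE] := frame_change xy.
  rewrite (hP y x P xy PE) mulrA -sgzM -det_mulmx; congr (sgz (\det _) * _).
  apply: (row_free_inj (ofr_frame (oc y)).1).
  by rewrite -aN aM PE mulmxA.
have opsi : oriented psi.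
  move=> a a' M aa aM; have [x [N [ax aN ->]]] := psiE a.
  by rewrite (uniq a' x (M *m N)) ?aa // ?aM ?aN ?mulmxA // det_mulmx sgzM mulrA.
exists psi; split=> //.
  by move=> x; rewrite (uniq _ x 1%:M) ?mul1mx // det1 sgz1 mul1r.
(* The shift by one matches the index in [carried]. *)
move=> /(pe_selector _ c_sel)[i hi]; split=> //; exists i.+1 => f a a' aa aM fc.
have [cc cs cf] := c_sel; have [x [M [ax aN ->]]] := psiE a.
have cx : supp a = c x by rewrite ax oc_supp.
have [y xy] : exists y, acts f x y.
  apply: (star_dart (cc x) _ _ (cs x)); first by rewrite -cx; exact: fc.
  by move=> d [].
have [M1 M11 M1E] := oc_acts xy.
have M1u : M1 \in unitmx by rewrite unitmxE M11 unitr1.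
rewrite (uniq a' y (M *m invmx M1)).
- rewrite det_mulmx det_inv M11 invr1 mulr1; congr (_ * _); apply/esym/hi.
  by exists f; split=> //; rewrite -(cf _ _ _ xy) -cx -aa.
- by rewrite aa cx oc_supp (cf _ _ _ xy).
- by rewrite aM aN M1E mulmxA -[(M *m _) *m M1]mulmxA mulVmx // mulmx1 mulmxA.
Qed.

End Selected.

Lemma vertex_dart v : cell T [set v] -> exists x : D, tail x = v.
Proof.
move=> Cv; have [d d0 hd] := local_cells T v.
pose n : V := const_mx 1; have n0 : 0 < `|n|.
  by rewrite normr_gt0; apply/eqP => /matrixP/(_ 0 0)/eqP; rewrite !mxE oner_eq0.
pose h := d / `|n| / 2; have h0 : 0 < h by rewrite !divr_gt0.
have [c Cc cp] := relint_cover T (v + h *: n).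
have pv : v + h *: n != v.
  by rewrite -subr_eq0 [v + _]addrC addrK scaler_eq0 (gt_eqF h0) -normr_eq0 gt_eqF.
have cv : c v.
  apply: hd Cc cp.1 _; rewrite [v + _]addrC addrK normrZ gtr0_norm //.
  by rewrite /h mulrAC divfK ?gt_eqF // ltr_pdivrMr // ltr_pMr // ltr1n.
case: (kcell_cases Cc) => K.
- have [p cE] := vertexP K; move: cp cv pv; rewrite cE => -[/= -> _] ->.
  by rewrite eqxx.
- have [w cE] := vertex_of_edge K Cv cv; rewrite cE in K.
  by have [x [xv _]] := edge_dart K; exists x.
- by have [x [xv _]] := corner_dart Cv K cv; exists x.
Qed.

Lemma tile_dart t : tile T t -> exists x : D, side x = t.
Proof.
move=> Tt; have [p tp] := relint_neq0 Tt.1.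
pose n : V := const_mx 1; have n0 : n != 0.
  by apply/eqP => /matrixP/(_ 0 0)/eqP; rewrite !mxE oner_eq0.
have [|x xt _] := cone_cover Tt tp (p := p + n); last by exists x.
by rewrite -subr_eq0 [p + _]addrC addrK.
Qed.

Lemma edge_eq x y : edge x = edge y -> y = x \/ y = flip x.
Proof.
move=> ee; have : edge x (tail y) by rewrite ee; exact: tail_edge.
have vR v : cell T [set v] -> ~ relint (edge x) v.
  by move=> Cv; exact: vertex_not_relint_edge Cv (dart_edge x).
have hw : edge x (head y) by rewrite ee; exact: head_edge.
case/(edge_relint (dart_edge x)) => [vv|vw|/vR[]]; last exact: dart_tail.
- left; apply: dart_eq_edge => //.
  case/(edge_relint (dart_edge x)): hw => [wv|//|/vR[]]; last exact: dart_head.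
  by have := dart_neq y; rewrite vv wv eqxx.
- right; apply: dart_eq_edge; rewrite ?tail_flip ?head_flip //.
  case/(edge_relint (dart_edge x)): hw => [//|ww|/vR[]]; last exact: dart_head.
  by have := dart_neq y; rewrite vw ww eqxx.
Qed.

Lemma vertex_frame x : frame (vertex x) (0 : 'M[R]_(0, 2)).
Proof. by have [_ _ [B]] := polytope0_set1 (tail x); rewrite (flatmx0 B). Qed.

Definition oc0 x : ocell T 0 := OCell (set1_kcell (dart_tail x)) (vertex_frame x).

Definition oc1 x : ocell T 1 := OCell (dart_edge x) (frame_seg (dart_neq x)).

(** All tiles carry the standard orientation of the plane, so an edge directed along a dart has
    incidence 1 with the tile on its left. *)
Definition oc2 x : ocell T 2 :=
  OCell (dart_tile x) ((frame_tile _ (dart_tile x).2).2 (unitmx1 _ _)).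

Lemma oc0_cover (a : ocell T 0) : exists x, supp (oc0 x) = supp a.
Proof.
have [v aE] := vertexP (supp_kcell a); have := (supp_kcell a).1; rewrite aE.
by move=> /vertex_dart[x <-]; exists x.
Qed.

Lemma oc1_cover (a : ocell T 1) : exists x, supp (oc1 x) = supp a.
Proof.
have [v [w aE]] := edgeP (supp_kcell a); have := supp_kcell a; rewrite aE.
by move=> /edge_dart[x [<- <-]]; exists x.
Qed.

Lemma oc2_cover (a : ocell T 2) : exists x, supp (oc2 x) = supp a.
Proof. by have [x xa] := tile_dart (supp_kcell a); exists x. Qed.

Lemma oc0_acts f x y : acts f x y ->
  exists2 M, \det M = 1 & ofr (oc0 y) = M *m (ofr (oc0 x) *m rot f).
Proof. by move=> _; exists 1%:M; [rewrite det1|rewrite mul1mx /= mul0mx]. Qed.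

Lemma oc1_acts f x y : acts f x y ->
  exists2 M, \det M = 1 & ofr (oc1 y) = M *m (ofr (oc1 x) *m rot f).
Proof.
move=> [v w _]; exists 1%:M; first by rewrite det1.
by rewrite mul1mx /= -moveB v w.
Qed.

Lemma oc2_acts f x y : acts f x y ->
  exists2 M, \det M = 1 & ofr (oc2 y) = M *m (ofr (oc2 x) *m rot f).
Proof.
move=> _; exists (rot f)^T; first by rewrite det_tr rot_det.
by rewrite /= mul1mx rot_orthogonal_tr.
Qed.

Lemma push0 h : (forall x, h (turn x) = h x) -> exists psi : ocell T 0 -> int,
  [/\ oriented psi, forall x, psi (oc0 x) = h x & pe h -> ePE psi].
Proof.
move=> ht; apply: (push (@vertex_selector _ _ T) _ oc0_cover oc0_acts) => //.
move=> x y M /= /seteqP[xy _] _.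
have {}xy : tail x = tail y by exact/esym/(xy _ erefl).
have [n ->] := turn_connected xy.
rewrite det_mx00 sgz1 mul1r.
by elim: n => // n IH; rewrite iterS ht.
Qed.

Lemma push2 h : (forall x, h (prev x) = h x) -> exists psi : ocell T 2 -> int,
  [/\ oriented psi, forall x, psi (oc2 x) = h x & pe h -> ePE psi].
Proof.
move=> ht; apply: (push (@side_selector _ _ T) _ oc2_cover oc2_acts) => //.
move=> x y M /= xy; rewrite mulmx1 => <-; rewrite det1 sgz1 mul1r.
have [n ->] := prev_connected (esym xy).
by elim: n => // n IH; rewrite iterS ht.
Qed.

Lemma push1 h : odd_under (@flip _ _ T) h -> exists psi : ocell T 1 -> int,
  [/\ oriented psi, forall x, psi (oc1 x) = h x & pe h -> ePE psi].
Proof.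
move=> ho; apply: (push (@edge_selector _ _ T) _ oc1_cover oc1_acts) => //.
move=> x y M /= /esym xy; rewrite [M]mx11_scalar mul_scalar_mx det_scalar1.
have xn : head x - tail x != 0 by rewrite subr_eq0 eq_sym dart_neq.
case: (edge_eq xy) => ->; set d := head x - tail x in xn *.
  move=> /eqP; rewrite -subr_eq0 -{1}[d]scale1r -scalerBl scaler_eq0 (negbTE xn).
  by rewrite orbF subr_eq0 => /eqP <-; rewrite sgz1 mul1r.
rewrite tail_flip head_flip -opprB -/d => /eqP.
rewrite -subr_eq0 -scaleN1r -scalerBl scaler_eq0 (negbTE xn) orbF subr_eq0.
by move=> /eqP <-; rewrite sgzN sgz1 mulN1r ho.
Qed.

Lemma oc1_flip (psi : ocell T 1 -> int) x : oriented psi ->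
  psi (oc1 (flip x)) = - psi (oc1 x).
Proof.
move=> opsi; rewrite (opsi (oc1 x) (oc1 (flip x)) (-1)%:M).
- by rewrite det_scalar1 sgzN sgz1 mulN1r.
- exact: edge_flip.
- by rewrite /= mul_scalar_mx scaleN1r opprB tail_flip head_flip.
Qed.

Lemma oc0_turn (psi : ocell T 0 -> int) x : psi (oc0 (turn x)) = psi (oc0 x).
Proof. by congr psi; apply: ocell_eq; rewrite //= /vertex tail_turn. Qed.

Lemma oc2_prev (psi : ocell T 2 -> int) x : psi (oc2 (prev x)) = psi (oc2 x).
Proof. by congr psi; apply: ocell_eq; rewrite //= side_prev. Qed.

End Pullback.

(** * Boundary and coboundary in terms of darts *)

Section Incidences.
Context {R : realType} {L : Type}.
Variable T : tiling R L.
Local Notation V := 'rV[R]_2.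
Local Notation D := (dart T).
Implicit Types (x y z : D) (k : nat).

Lemma incidence_left x y : side y = side x -> incidence (oc1 y) (oc2 x) = 1.
Proof.
move=> yx; set p := xget 0 (relint (edge y)); set q := xget 0 (relint (side x)).
rewrite (@incidenceE _ _ _ _ (oc1 y) (oc2 x) (col_mx (p - q) (head y - tail y))).
  rewrite det_col_mx gtr0_sgz //.
  have [s _ pE] := (relint_seg p (dart_neq y)).1 (supp_relint (oc1 y)).
  have [_ _ _ /(_ q)] := dartP y; rewrite yx => /(_ (supp_relint (oc2 x))).
  rewrite pE; rewrite /cross !mxE; lra.
by rewrite /= mulmx1.
Qed.

Lemma incidence_right x : incidence (oc1 x) (oc2 (flip x)) = -1.
Proof.
rewrite (@incidence_face _ _ _ _ (oc1 (flip x)) (oc1 x) _ (-1)%:M).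
- by rewrite incidence_left // det_scalar1 sgzN sgz1 mulr1.
- by rewrite /= edge_flip.
- by rewrite /= mul_scalar_mx scaleN1r opprB tail_flip head_flip.
Qed.

Lemma incidence_tail x : incidence (oc0 x) (oc1 x) = -1.
Proof.
set p := xget 0 (relint (edge x)).
have [s /andP[s0 _] pE] := (relint_seg p (dart_neq x)).1 (supp_relint (oc1 x)).
rewrite (@incidenceE _ _ _ _ (oc0 x) (oc1 x) (- s)%:M).
  by rewrite det_scalar1 sgzN gtr0_sgz.
have -> : xget 0 (relint (supp (oc0 x))) = tail x by have [] := supp_relint (oc0 x).
rewrite mul_scalar_mx; apply/matrixP => i j.
transitivity ((tail x - p) 0 j); last by rewrite [i]ord1 pE !mxE; ring.
rewrite -(col_mxEu (tail x - p) (ofr (oc0 x)) 0 j).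
by congr (fun_of_matrix _ _ _); apply: val_inj; rewrite [i]ord1.
Qed.

Lemma incidence_head x : incidence (oc0 (flip x)) (oc1 x) = 1.
Proof.
rewrite (@incidence_coface _ _ _ _ (oc0 (flip x)) (oc1 (flip x)) (oc1 x) (-1)%:M).
- by rewrite incidence_tail det_scalar1 sgzN sgz1.
- by move=> _ ->; rewrite tail_flip /= edge_flip; exact: head_edge.
- by rewrite det_scalar1 oppr_eq0 oner_eq0.
- by rewrite /= edge_flip.
- by rewrite /= mul_scalar_mx scaleN1r opprB tail_flip head_flip.
Qed.

Lemma sum_flip (f : D -> int) x :
  \sum_(y \in [set y | edge y = edge x]) f y = f x + f (flip x).
Proof.
have per := @flip_periodic _ _ T.
rewrite (osum_fsbig (x := x) _ per).
- by rewrite /osum (ord_involution per (flipK x) (@flip_neq _ _ _ x)) big_ord_recr big_ord1.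
- by elim=> //= n IH; rewrite edge_flip.
- by move=> y /esym/edge_eq[->|->]; [exists 0%N|exists 1%N].
Qed.

Lemma coboundary_oc1 (psi : ocell T 0 -> int) x : oriented psi ->
  coboundary psi (oc1 x) = psi (oc0 (flip x)) - psi (oc0 x).
Proof.
move=> opsi.
(* The two ends of the edge are indexed by the two darts on it, each standing for its tail. *)
transitivity (\sum_(y \in [set y | edge y = edge x])
    incidence (oc0 y) (oc1 x) * psi (oc0 y)).
  apply: (@chosen_sum _ _ _ _ (@oc0 _ _ T)
    (fun s => incidence s (oc1 x) * psi s) [set c | c `<=` edge x]).
  - by move=> s s' _; exact: incidence_supp.
  - move=> y z /esym/edge_eq yx /esym/edge_eq zx /= /seteqP[yz _].
    have {}yz : tail y = tail z by exact: (yz _ erefl).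
    have tn := dart_neq x; case: yx zx yz => -> [] -> //; rewrite ?tail_flip => E.
    + by move: tn; rewrite E eqxx.
    + by move: tn; rewrite E eqxx.
  - by move=> y /= <- _ ->; exact: tail_edge.
  - move=> s; have [v sE] := vertexP (supp_kcell s); rewrite sE /= => /(_ v erefl).
    have Cv := (supp_kcell s).1; rewrite sE in Cv.
    case/(edge_relint (dart_edge x)) => [->|->|].
    + by exists x.
    + by exists (flip x); rewrite ?edge_flip /vertex ?tail_flip.
    + by move/(vertex_not_relint_edge Cv (dart_edge x)).
rewrite sum_flip incidence_tail incidence_head; lia.
Qed.

Lemma coboundary_oc2 (psi : ocell T 1 -> int) x : oriented psi ->
  coboundary psi (oc2 x) = osum (@prev _ _ T) (psi \o oc1 (T := T)) x.
Proof.
move=> opsi.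
transitivity (\sum_(y \in [set y | side y = side x])
    incidence (oc1 y) (oc2 x) * psi (oc1 y)).
  apply: (@chosen_sum _ _ _ _ (@oc1 _ _ T)
    (fun s => incidence s (oc2 x) * psi s) [set c | c `<=` side x]).
  - by move=> s s' _; exact: incidence_supp.
  - by move=> y z /= yx zx yz; apply: dart_eq_side; rewrite ?yx ?zx.
  - by move=> y /= <-; exact: edge_side_sub.
  - move=> s; have [v [w sE]] := edgeP (supp_kcell s) => /= sx.
    have E := supp_kcell s; rewrite sE in E sx.
    have [y [yx [] [yv yw]]] := side_dart E (dart_tile x) sx; exists y => //.
      by rewrite /edge yv yw.
    by rewrite /edge yv yw segC.
rewrite (eq_fsbigr (psi \o oc1 (T := T))); last first.
  by move=> y /set_mem yx /=; rewrite incidence_left // mul1r.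
apply: osum_fsbig; first exact: prev_periodic.
  by move=> n; exact: side_iter_prev.
by move=> y yx; apply: prev_connected.
Qed.

Lemma boundary_oc0 (psi : ocell T 1 -> int) x : oriented psi ->
  boundary psi (oc0 x) = - osum (@turn _ _ T) (psi \o oc1 (T := T)) x.
Proof.
move=> opsi.
transitivity (\sum_(y \in [set y | tail y = tail x])
    incidence (oc0 x) (oc1 y) * psi (oc1 y)).
  apply: (@chosen_sum _ _ _ _ (@oc1 _ _ T)
    (fun t => incidence (oc0 x) t * psi t) [set c | vertex x `<=` c]).
  - by move=> s s' /= xs ss; apply: coincidence_supp; rewrite -?ss.
  - move=> y z /= yx zx yz; apply: dart_eq_edge; rewrite ?yx ?zx //.
    apply: (seg_inj_r (dart_neq y)); rewrite [LHS]yz /edge yx zx //.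
  - by move=> y /= yx _ ->; rewrite -yx; exact: tail_edge.
  - move=> s /= xs; have sx := xs _ erefl.
    have [w sE] := vertex_of_edge (supp_kcell s) (dart_tail x) sx.
    have E := supp_kcell s; rewrite sE in E.
    by have [y [yv yw]] := edge_dart E; exists y; rewrite // sE /edge yv yw.
rewrite (eq_fsbigr (fun y => - psi (oc1 y))); last first.
  move=> y /set_mem /= yx; have -> : oc0 x = oc0 y.
    by apply: ocell_eq => //=; rewrite /vertex yx.
  by rewrite incidence_tail mulN1r.
rewrite (osum_fsbig (x := x) _ (@turn_periodic _ _ T)).
- by rewrite /osum sumrN.
- by move=> n; exact: tail_iter_turn.
- by move=> y yx; apply: turn_connected.
Qed.

Lemma boundary_oc1 (psi : ocell T 2 -> int) x : oriented psi ->
  boundary psi (oc1 x) = psi (oc2 x) - psi (oc2 (flip x)).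
Proof.
move=> opsi.
transitivity (\sum_(y \in [set y | edge y = edge x])
    incidence (oc1 x) (oc2 y) * psi (oc2 y)).
  apply: (@chosen_sum _ _ _ _ (@oc2 _ _ T)
    (fun t => incidence (oc1 x) t * psi t) [set c | edge x `<=` c]).
  - by move=> s s' /= xs ss; apply: coincidence_supp; rewrite -?ss.
  - by move=> y z /= yx zx yz; apply: dart_eq_side; rewrite ?yx ?zx.
  - by move=> y /= <-; exact: edge_side_sub.
  - move=> s /= xs.
    have [y [yx yv]] := side_dart (dart_edge x) (supp_kcell s) xs; exists y => //=.
    by case: yv => -[yv yw]; rewrite /edge yv yw // segC.
by rewrite sum_flip incidence_left // incidence_right mul1r mulN1r.
Qed.

Lemma oriented_coboundary k (psi : ocell T k -> int) : oriented psi ->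
  oriented (coboundary psi).
Proof.
move=> opsi t t' M tt BB.
have [N N0 NB] := frame_change tt.
have MN : M = N by apply: (row_free_inj (ofr_frame t).1); rewrite -BB -NB.
have M0 : \det M != 0 by rewrite MN.
rewrite /coboundary tt.
have fin : finite_set [set s : ocell T k | chosen s /\ supp s `<=` supp t].
  apply: (@sub_finite_set _ _ [set s : ocell T k | chosen s /\
     [set c | cell T c /\ c `<=` supp t] (supp s)]).
    by move=> s [cs st]; split => //; split => //; exact: (supp_kcell s).1.
  by apply/chosen_finite/faces_finite/(supp_kcell t).1.
rewrite !fsbig_finite //= mulr_sumr big_seq [RHS]big_seq; apply: eq_bigr => s.
rewrite in_fset_set // inE => -[_ st].
by rewrite (incidence_coface st M0 tt BB) mulrA.
Qed.

Lemma oriented_boundary k (psi : ocell T k.+1 -> int) : oriented psi ->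
  oriented (boundary psi).
Proof.
move=> opsi s s' M ss BB; rewrite /boundary ss.
have fin : finite_set [set t : ocell T k.+1 | chosen t /\ supp s `<=` supp t].
  apply: (@sub_finite_set _ _ [set t : ocell T k.+1 | chosen t /\
     [set c | cell T c /\ supp s `<=` c] (supp t)]).
    by move=> t [cs st]; split => //; split => //; exact: (supp_kcell t).1.
  by apply/chosen_finite/cofaces_finite/(supp_kcell s).1.
rewrite !fsbig_finite //= mulr_sumr; apply: eq_bigr => t _.
by rewrite (incidence_face _ ss BB) mulrA.
Qed.

End Incidences.

(** * Poincare duality *)

Section PoincareDuality.
Context {R : realType} {L : Type}.
Variable T : tiling R L.
Local Notation V := 'rV[R]_2.
Local Notation D := (dart T).
Local Notation A := (@prev _ _ T).
Local Notation B := (@turn _ _ T).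
Local Notation flipT := (@flip _ _ T).
Implicit Types (x y z : D) (k i j n d : nat).

Lemma iter_motion (f : motion R) n : exists g : motion R, g =1 iter n f.
Proof.
elim: n => [|n [g gE]]; first by exists (id_motion); exact: id_motionE.
by exists (comp_motion f g) => x; rewrite comp_motionE gE.
Qed.

Lemma iter_rotation i (f : motion R) x k : carried (@vertex _ _ T) i f x (iter k B x) ->
  forall j, iter j f (tail x) = tail x /\ iter j f (head x) = head (iter (j * k) B x).
Proof.
move=> fx; have step n : carried (@vertex _ _ T) i f (iter n B x) (iter (n + k) B x).
  by rewrite iterD; elim: n => // n; exact: carried_turn.
elim=> [//|j [tj hj]]; split.
  by rewrite iterS tj; have [[-> _ _] _] := fx; exact: tail_iter_turn.
by rewrite iterS hj mulSnr; have [[_ -> _] _] := step (j * k)%N.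
Qed.

(** Translates the order of a rotation into divisibility in an orbit of [turn]; a motion that fixes
    both ends of an edge is the identity. *)
Lemma iter_rotation_id i (f : motion R) x k j :
  carried (@vertex _ _ T) i f x (iter k B x) ->
  iter j f =1 id <-> iter (j * k) B x = x.
Proof.
move=> fx; have [tj hj] := iter_rotation fx j; split=> [fid|E].
  by apply: dart_eq_edge; rewrite ?tail_iter_turn // -hj fid.
have [g gE] := iter_motion f j; move=> p; rewrite -gE.
apply: (motion_fix2 (dart_neq x)); rewrite gE ?tj ?hj ?E //.
Qed.

(** A motion realizing [d] turns is a rotation of order exactly [ord B x %/ d], to which the
    condition on modified chains applies. This supplies the divisibility that [pe_distribute]
    requires. *)
Lemma dagger_dvd (psi : ocell T 0 -> int) : dagger psi ->
  exists i, forall x d, (0 < d)%N -> (d %| ord B x)%N ->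
    equivalent (@vertex _ _ T) i x (iter d B x) -> ((ord B x %/ d)%N %| psi (oc0 x))%Z.
Proof.
have per := @turn_periodic _ _ T.
move=> [_ /(_ erefl)[i _ hi]]; exists i => x d d0 dx [f fx]; apply: hi.
have o0 := ord_gt0 per x.
have vE : vertex (iter d B x) = vertex x by rewrite /vertex tail_iter_turn.
exists f; split.
- by have [_ _ vf] := vertex_selector T; rewrite (vf _ _ _ fx.1) vE.
- have := fx.2; rewrite vE => fc; apply: (carries_corona_le (leqnSn i)) fc.
  + exact: dart_tail.
  + exact: dart_tail.
  + by have [_ _ vf] := vertex_selector T; rewrite (vf _ _ _ fx.1) vE.
- by rewrite divn_gt0 // dvdn_leq.
- by apply/(iter_rotation_id _ fx); rewrite divnK // iter_ord.
move=> m /andP[m0 md] /(iter_rotation_id _ fx) /(iter_eqP per x)/dvdn_leq.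
by rewrite muln_gt0 m0 d0 => /(_ isT); rewrite leqNgt -ltn_divRL // md.
Qed.

(** An orbit sum is [ord B x %/ d] times the sum over one fundamental domain of [d] darts, and the
    order of every local rotation divides this factor. *)
Lemma dvd_osum_turn (h : D -> int) : pe h ->
  exists2 i, (0 < i)%N & forall x n, rot_symmetry T i (vertex x) n ->
    (n %| osum B h x)%Z.
Proof.
move=> /(pe_selector _ (vertex_selector T))[i hi]; exists i.+1 => // x n.
have per := @turn_periodic _ _ T.
move=> [f [fv fc n0 fn fmin]].
have [|||y xy] := @star_dart _ _ T (vertex x) i f x _ _ fc.
- exact: dart_tail.
- by move=> c [].
- by move=> _ ->; exact: tail_side.
have ftx : f (tail x) = tail x.
  by have : vertex x (f (tail x)) by rewrite -fv; exists (tail x).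
have txy : tail x = tail y by have [<- _ _] := xy.
have [k yk] := turn_connected txy.
have fx : carried (@vertex _ _ T) i f x (iter k B x).
  by rewrite -yk; split; rewrite // /vertex -txy.
have F := turn_family T.
have [d [d0 dx dP]] := orbit_symmetry per (fam_refl F i) (@fam_sym _ _ _ _ F i)
  (@fam_trans _ _ _ _ F i) (@fam_perm _ _ _ _ F i) x.
have dk : (d %| k)%N by apply/dP; exists f.
have -> : osum B h x = psum B h x d *+ (ord B x %/ d).
  rewrite -(psum_mul (@fam_perm _ _ _ _ F i)) //; last exact/dP.
  by rewrite divnK.
(* As [d] divides [k], the power of [f] with this exponent is the identity; a nonzero remainder
   modulo [n] would contradict the minimality of [n]. *)
have nd : (n %| ord B x %/ d)%N.
  have fid : iter (ord B x %/ d) f =1 id.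
    apply/(iter_rotation_id _ fx).
    by rewrite -{1}(divnK dk) mulnCA divnK // iter_mul_ord.
  rewrite /dvdn; apply: contraT; rewrite -lt0n => r0; exfalso.
  apply: (fmin (ord B x %/ d %% n)%N); first by rewrite r0 ltn_pmod.
  move=> p; rewrite -[RHS]fid [in RHS](divn_eq (ord B x %/ d) n) addnC iterD.
  congr (iter _ _ _); apply/esym; elim: (ord B x %/ d %/ n)%N => // q IH.
  by rewrite mulSn iterD IH; exact: fn.
by rewrite -mulr_natr dvdz_mull // natz.
Qed.

Lemma pe_pullback0 (psi : ocell T 0 -> int) : ePE psi -> pe (psi \o (@oc0 _ _ T)).
Proof. by apply: (pullback_pe (vertex_selector T)) => //; exact: oc0_acts. Qed.

Lemma pe_pullback1 (psi : ocell T 1 -> int) : ePE psi -> pe (psi \o (@oc1 _ _ T)).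
Proof. by apply: (pullback_pe (edge_selector T)) => //; exact: oc1_acts. Qed.

Lemma pe_pullback2 (psi : ocell T 2 -> int) : ePE psi -> pe (psi \o (@oc2 _ _ T)).
Proof. by apply: (pullback_pe (side_selector T)) => //; exact: oc2_acts. Qed.

Lemma oc0_inj (psi psi' : ocell T 0 -> int) : oriented psi -> oriented psi' ->
  (forall x, psi (oc0 x) = psi' (oc0 x)) -> psi = psi'.
Proof. exact: (pullback_inj (@oc0_cover _ _ T)). Qed.

Lemma oc1_inj (psi psi' : ocell T 1 -> int) : oriented psi -> oriented psi' ->
  (forall x, psi (oc1 x) = psi' (oc1 x)) -> psi = psi'.
Proof. exact: (pullback_inj (@oc1_cover _ _ T)). Qed.

Lemma oc2_inj (psi psi' : ocell T 2 -> int) : oriented psi -> oriented psi' ->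
  (forall x, psi (oc2 x) = psi' (oc2 x)) -> psi = psi'.
Proof. exact: (pullback_inj (@oc2_cover _ _ T)). Qed.

Lemma oriented0 k : oriented (0 : ocell T k -> int).
Proof. by move=> s t M _ _; rewrite mulr0. Qed.

(** There are no 3-cells; hence all 2-cochains are cocycles and no 2-chain but 0 is a boundary. *)
Lemma ocell3_empty (psi psi' : ocell T 3 -> int) : psi = psi'.
Proof. by apply/funext => s; have := polytope_dim_le2 (supp_kcell s).2. Qed.

Lemma flip_turn x : flip (turn x) = prev x. Proof. exact: flipK. Qed.

Lemma prev_surj x : exists y, x = prev y.
Proof.
exists (inv_perm A x); rewrite (inv_permK (prev_family T)) //.
Qed.

Lemma turn_surj x : exists y, x = turn y.
Proof. by exists (inv_perm B x); rewrite (inv_permK (turn_family T)). Qed.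

Lemma duality0 : exists f : {additive ePE_cohomology T 0 -> dagger_homology T 2},
  bijective f.
Proof.
apply: (@subquotient_iso _ _ _ _ _ _
  (fun (psi : ocell T 0 -> int) (phi : ocell T 2 -> int) =>
     forall x, psi (oc0 x) = phi (oc2 x))).
- move=> psi psi' phi phi' E E' x.
  by transitivity (psi (oc0 x) - psi' (oc0 x)); [|rewrite E E'].
- move=> psi; rewrite unfold_in => /asboolP[epsi dpsi].
  (* Invariance under [flip] is the cocycle condition; with invariance under [turn] it gives
     invariance under [prev]. *)
  have hflip x : psi (oc0 (flip x)) = psi (oc0 x).
    apply/eqP; rewrite -subr_eq0 -coboundary_oc1 ?dpsi //; exact: epsi.1.
  have [|phi [ophi phiE ephi]] := @push2 _ _ T (fun x => psi (oc0 x)).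
    by move=> x; rewrite -flip_turn hflip oc0_turn.
  exists phi => //; rewrite unfold_in /=; apply/asboolP; split.
    by split=> //; apply: ephi; exact: pe_pullback0.
  apply: oc1_inj => [||x]; [exact: oriented_boundary|exact: oriented0|].
  by rewrite boundary_oc1 // !phiE hflip subrr.
- move=> phi; rewrite unfold_in /= => /asboolP[[ephi _] dphi].
  have hflip x : phi (oc2 (flip x)) = phi (oc2 x).
    apply/esym/eqP; rewrite -subr_eq0 -boundary_oc1 ?dphi //; exact: ephi.1.
  have [|psi [opsi psiE epsi]] := @push0 _ _ T (fun x => phi (oc2 x)).
    by move=> x; rewrite /turn hflip oc2_prev.
  exists psi => //; rewrite unfold_in; apply/asboolP; split.
    by apply: epsi; exact: pe_pullback2.
  apply: oc1_inj => [||x]; [exact: oriented_coboundary|exact: oriented0|].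
  by rewrite coboundary_oc1 // !psiE hflip subrr.
- move=> psi phi; rewrite !unfold_in /= => /asboolP[epsi _] /asboolP[[ephi _] _] E.
  apply/eqP/asboolP => [psi0|[xi _ phiE]].
    exists 0; first exact: dagger0.
    rewrite boundary0; apply: oc2_inj => [||x]; [exact: ephi.1|exact: oriented0|].
    by rewrite -E psi0.
  apply: oc0_inj => [||x]; [exact: epsi.1|exact: oriented0|].
  by rewrite E phiE (ocell3_empty xi 0) boundary0.
Qed.

Lemma duality1 : exists f : {additive ePE_cohomology T 1 -> dagger_homology T 1},
  bijective f.
Proof.
have FA := prev_family T; have FB := turn_family T.
have flipA x : flip (prev x) = turn x by [].
apply: (@subquotient_iso _ _ _ _ _ _
  (fun psi phi : ocell T 1 -> int =>
     exists h, dual1 (@pe _ _ T) A B (psi \o (@oc1 _ _ T)) (phi \o (@oc1 _ _ T)) h)).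
- move=> psi psi' phi phi' [h [h_pe E F]] [h' [h'_pe E' F']].
  exists (fun x => h x - h' x); split=> [|x|x].
  + exact: (pe_op FA (fun a b => a - b)).
  + transitivity (psi (oc1 (B x)) - psi' (oc1 (B x))) => //.
    by have := E x; have := E' x; rewrite /= => -> ->; lia.
  + transitivity (phi (oc1 (A x)) - phi' (oc1 (A x))) => //.
    by have := F x; have := F' x; rewrite /= => -> ->; lia.
- move=> psi; rewrite unfold_in => /asboolP[epsi dpsi].
  have [||p [h [p_pe p_odd p0 ph]]] :=
      dual1_exists FA FB (@flipK _ _ T) flipA (pe_pullback1 epsi).
  + by move=> x; exact: oc1_flip epsi.1.
  + by move=> x; rewrite -coboundary_oc2 ?dpsi //; exact: epsi.1.
  have [phi [ophi phiE ephi]] := push1 p_odd.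
  exists phi; last first.
    by exists h; case: ph => h_pe E F; split=> // x; rewrite /= phiE.
  rewrite unfold_in /=; apply/asboolP; split; first by split=> //; exact: ephi.
  apply: oc0_inj => [||x]; [exact: oriented_boundary|exact: oriented0|].
  rewrite boundary_oc0 // (eq_osum _ (g := p)) ?p0 ?oppr0 // => y.
- move=> phi; rewrite unfold_in /= => /asboolP[[ephi _] dphi].
  have [||p [h [p_pe p_odd p0 ph]]] :=
      dual1_exists FB FA (@flipK _ _ T) flip_turn (pe_pullback1 ephi).
  + by move=> x; exact: oc1_flip ephi.1.
  + move=> x; apply/eqP; rewrite -oppr_eq0 -boundary_oc0 ?dphi //.
    exact: ephi.1.
  have [psi [opsi psiE epsi]] := push1 p_odd.
  exists psi; last first.
    by exists h; case: ph => h_pe E F; split=> // x; rewrite /= psiE.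
  rewrite unfold_in /=; apply/asboolP; split; first exact: epsi.
  apply: oc2_inj => [||x]; [exact: oriented_coboundary|exact: oriented0|].
  rewrite coboundary_oc2 // (eq_osum _ (g := p)) ?p0 // => y.
move=> psi phi; rewrite !unfold_in /= => /asboolP[epsi _] /asboolP[[ephi _] _] [h hP].
apply/asboolP/asboolP => [[c ec psiE]|[c [ec _] phiE]].
- have [||f f_pe [fA fE]] := dual1_boundary FA hP (pe_pullback0 ec).
  + by move=> x; exact: oc0_turn.
  + move=> x /=; rewrite psiE coboundary_oc1 ?flip_turn ?oc0_turn //; exact: ec.1.
  (* The sign is needed as the boundary takes the value at [A y] minus that at [B y], opposite to
     the difference in [fE]. *)
  have [|g [og gE eg]] := @push2 _ _ T (fun x => - f x).
    by move=> x; rewrite fA.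
  exists g; first split=> //.
    by apply: eg; exact: (pe_opp FA).
  apply: oc1_inj => [||x]; [exact: ephi.1|exact: oriented_boundary|].
  have [y ->] := prev_surj x; rewrite boundary_oc1 // !gE flipA fA.
  by have /= -> := fE y; lia.
(* For the converse, tiles and vertices exchange roles. *)
have hP' : dual1 (@pe _ _ T) B A (phi \o (@oc1 _ _ T)) (psi \o (@oc1 _ _ T)) h.
  by case: hP.
have [|||f f_pe [fB fE]] := dual1_boundary FB hP' (c := fun x => - c (oc2 x)).
- by apply: (pe_opp FA); exact: pe_pullback2.
- by move=> x; rewrite oc2_prev.
- move=> x /=; rewrite phiE boundary_oc1 ?flipA ?oc2_prev; last exact: ec.1.
  by rewrite opprK addrC.
have [|g [og gE eg]] := @push0 _ _ T f; first exact: fB.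
exists g; first exact: eg.
apply: oc1_inj => [||x]; [exact: epsi.1|exact: oriented_coboundary|].
have [y ->] := turn_surj x; rewrite coboundary_oc1 // !gE flip_turn fB.
exact: fE.
Qed.

Section LocalRotations.
Hypothesis T_rot : rotations_at_vertices T.

Lemma duality2 : exists f : {additive ePE_cohomology T 2 -> dagger_homology T 0},
  bijective f.
Proof.
have FA := prev_family T; have FB := turn_family T.
have Fe := flip_family T; have fl := no_flip T_rot.
have flipA x : flip (prev x) = turn x by [].
have perA := @prev_periodic _ _ T; have perB := @turn_periodic _ _ T.
apply: (@subquotient_iso _ _ _ _ _ _
  (fun (psi : ocell T 2 -> int) (sigma : ocell T 0 -> int) =>
     exists kappa, [/\ pe kappa, forall x, psi (oc2 x) = osum A kappa x
       & forall x, sigma (oc0 x) = osum B kappa x])).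
- move=> psi psi' phi phi' [h [h_pe E F]] [h' [h'_pe E' F']].
  exists (fun x => h x - h' x); split=> [|x|x].
  + exact: (pe_op FA (fun a b => a - b)).
  + by transitivity (psi (oc2 x) - psi' (oc2 x)); rewrite // E E' osumB.
  + by transitivity (phi (oc0 x) - phi' (oc0 x)); rewrite // F F' osumB.
- move=> psi; rewrite unfold_in => /asboolP[epsi _].
  have [||kappa k_pe kE] := pe_distribute FA (pe_pullback2 epsi).
  + by move=> x; exact: oc2_prev.
  (* Without symmetry of the tile only a full period leads to an equivalent dart, so the divisor is
     1. *)
  + have [i hi] := tile_rigid T_rot; exists i => x d d0 dx /hi.
    rewrite side_iter_prev => /(_ erefl)/esym/(iter_eqP perA) xd.
    have -> : d = ord A x by apply/eqP; rewrite eqn_dvd dx.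
    by rewrite divnn ord_gt0 // dvd1z.
  have [|phi [ophi phiE ephi]] := @push0 _ _ T (osum B kappa).
    by move=> x; exact: osum_perm.
  exists phi; last by exists kappa; split=> // x; rewrite kE.
  rewrite unfold_in /=; apply/asboolP; split.
    by apply: ephi; exact: (pe_osum FB k_pe).
  move=> _; have [i i0 hi] := dvd_osum_turn k_pe; exists i => // a n.
  have [x xa] := oc0_cover a; have -> : a = oc0 x.
    by apply: ocell_eq => //; rewrite !(flatmx0 (ofr _)).
  by rewrite phiE; exact: hi.
- move=> phi; rewrite unfold_in /= => /asboolP dphi.
  have [||kappa k_pe kE] := pe_distribute FB (pe_pullback0 dphi.1).
  + by move=> x; exact: oc0_turn.
  + exact: dagger_dvd.
  have [|psi [opsi psiE epsi]] := @push2 _ _ T (osum A kappa).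
    by move=> x; exact: osum_perm.
  exists psi; last by exists kappa; split=> // x; rewrite kE.
  rewrite unfold_in /=; apply/asboolP; split.
    by apply: epsi; exact: (pe_osum FA k_pe).
  exact: ocell3_empty.
move=> psi phi; rewrite !unfold_in /= => /asboolP[epsi _] /asboolP[ephi _].
move=> [kappa [k_pe kA kB]].
apply/asboolP/asboolP => [[eta e_eta psiE]|[eta [e_eta _] phiE]].
- have [|x|p [p_pe p_odd] pE] := dual2_boundary FA FB Fe (@flipK _ _ T) flipA fl
      k_pe (pe_pullback1 e_eta).
  + by move=> x; exact: oc1_flip e_eta.1.
  + by rewrite -kA psiE coboundary_oc2 //; exact: e_eta.1.
  (* The sign cancels the one in [boundary_oc0], where edges leave their tail with incidence -1. *)
  have [|g [og gE eg]] := @push1 _ _ T (fun x => - p x).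
    by move=> x; rewrite p_odd.
  exists g; first split=> //.
    by apply: eg; exact: (pe_opp FA).
  apply: oc0_inj => [||x]; [exact: ephi.1|exact: oriented_boundary|].
  rewrite boundary_oc0 // (eq_osum _ (g := fun y => - p y)) // kB pE.
  by rewrite /osum sumrN opprK.
have [||x|p [p_pe p_odd] pE] := dual2_boundary FB FA Fe (@flipK _ _ T) flip_turn fl
    k_pe (eta := fun x => - eta (oc1 x)).
- by apply: (pe_opp FA); exact: pe_pullback1.
- by move=> x; rewrite oc1_flip //; exact: e_eta.1.
- rewrite -kB phiE boundary_oc0; last exact: e_eta.1.
  by rewrite /osum sumrN.
have [g [og gE eg]] := push1 p_odd.
exists g; first exact: eg.
apply: oc2_inj => [||x]; [exact: epsi.1|exact: oriented_coboundary|].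
by rewrite coboundary_oc2 // (eq_osum _ (g := p)) // kA pE.
Qed.

End LocalRotations.
End PoincareDuality.

Theorem theorem3p7 (R : realType) (L : Type) (T : tiling R L)
    (T_eFLC : eFLC T) (T_rot : rotations_at_vertices T)
    (k : nat) (k_le2 : (k <= 2)%N) :
  exists f : {additive ePE_cohomology T k -> dagger_homology T (2 - k)%N},
    bijective f.
Proof.
case: k k_le2 => [|[|[|//]]] _.
- exact: duality0.
- exact: duality1.
- exact: duality2.
Qed.
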